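(* Assume that $\mathbf E_0,\mathbf H_0\in L^2(\Omega;L^2(D)^3)$, that $q_m\in C^1(D)$ for all $m\in\mathbb{N}$, and that $Q_1^{1/2}\in HS(L^2(D),H^{\gamma_1}(D))$, $Q_2^{1/2}\in HS(L^2(D),H^{\gamma_2}(D))$ with $\gamma_1\ge\gamma$ and $\gamma_2\ge1+\gamma$ for some $\gamma>\frac32$. Consider the finite difference full discretization described in the context under the periodic boundary condition. Then for sufficiently small $\Delta t>0$ the numerical solution $\{U^n\}_{n\in\mathbb{N}}$ has a unique invariant measure $\pi$. Thus $\{U^n\}_{n\in\mathbb{N}}$ is ergodic. Moreover, $\{U^n\}_{n\in\mathbb{N}}$ is exponentially mixing.
   Context: $D=(x_L,x_R)\times(y_L,y_R)\times(z_L,z_R)\subset\mathbb{R}^3$ is a cuboid; $\sigma\in W^{1,\infty}(D)$ with $\sigma\ge\sigma_0>0$ for a constant $\sigma_0$; $\lambda_1\in\mathbb{R}$, $\boldsymbol\lambda_2\in\mathbb{R}^3$; $\mathbf E_0,\mathbf H_0$ are the initial electric and magnetic fields, from which the initial grid data are taken. Noise: $W_1,W_2$ are independent $Q_1$- resp. $Q_2$-Wiener processes on a filtered probability space $(\Omega,\mathcal F,\{\mathcal F_t\}_{t\ge0},\mathbb P)$, $W_i(t)=\sum_{k\ge1}\sqrt{\eta_k^{(i)}}q_k\beta_k^{(i)}(t)$, where $\{q_k\}$ is an orthonormal basis of $L^2(D)$, $Q_iq_k=\eta_k^{(i)}q_k$ with $\eta_k^{(i)}\ge0$, and $\beta_k^{(i)}$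 are independent Brownian motions. $HS(U,H)$ denotes the Hilbert–Schmidt operators from $U$ to $H$. With $t_n=n\Delta t$: $\Delta W_2^n=W_2(t_{n+1})-W_2(t_n)$, and $\Delta\overline W_1^n=\sqrt{\Delta t}\sum_{i\ge1}\zeta_i^{(1),n}Q_1^{1/2}q_i$ with $\zeta_i^{(1),n}=\max(-A_{\Delta t},\min(\xi_i^{(1),n},A_{\Delta t}))$, $\xi_i^{(1),n}=(\beta_i^{(1)}(t_{n+1})-\beta_i^{(1)}(t_n))/\sqrt{\Delta t}$, $A_{\Delta t}=\sqrt{2b|\ln\Delta t|}$, $b\ge4$ fixed. Grid: uniform mesh sizes $\Delta x,\Delta y,\Delta z$, nodes $x_i=x_L+i\Delta x$ ($0\le i\le I_x$), $y_j=y_L+j\Delta y$ ($0\le j\le J_y$), $z_k=z_L+k\Delta z$ ($0\le k\le K_z$); $Z_{i,j,k}^n$ approximates $Z$ at $(t_n,x_i,y_j,z_k)$; $\sigma_{i,j,k}=\sigma(x_i,y_j,z_k)$; $\bar i=i+\frac12$, $\bar j=j+\frac12$, $\bar k=k+\frac12$. Half-integer spatial indices on grid functions denote midpoint averages of neighbouring values in that direction, e.g. $Z_{\bar i,j,k}=\frac12(Z_{i,j,k}+Z_{i+1,j,k})$. Differences: $\delta_xZ_{i,j,k}=(Z_{i+1,j,k}-Z_{i,j,k})/\Delta x$, and similarly $\delta_y,\delta_z$. For a scalar $s$: $\delta_t^{s}Z^n=(Z^{n+1}-e^{-s\Delta t}Z^n)/\Delta t$ and $A_t^{s}Z^n=(Z^{n+1}+e^{-s\Delta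 t}Z^n)/2$. Noise at cell centres: $(\dot{\overline W}_1)^n_{\bar i,\bar j,\bar k}=\Delta\overline W_1^n(x_{\bar i},y_{\bar j},z_{\bar k})/\Delta t$ and $(\dot W_2)^n_{\bar i,\bar j,\bar k}=\Delta W_2^n(x_{\bar i},y_{\bar j},z_{\bar k})/\Delta t$. Finite difference full discretization (with $s=\sigma_{i,j,k}$ and $\mathbf e_1,\mathbf e_2,\mathbf e_3$ the standard basis of $\mathbb{R}^3$): for all cells and all $n\in\mathbb N$, $$\delta_t^{s}\mathbf E^n_{\bar i,\bar j,\bar k}=\mathbf e_1\times\delta_xA_t^{s}\mathbf H^n_{i,\bar j,\bar k}+\mathbf e_2\times\delta_yA_t^{s}\mathbf H^n_{\bar i,j,\bar k}+\mathbf e_3\times\delta_zA_t^{s}\mathbf H^n_{\bar i,\bar j,k}-\lambda_1A_t^{s}\mathbf H^n_{\bar i,\bar j,\bar k}(\dot{\overline W}_1)^n_{\bar i,\bar j,\bar k}+\boldsymbol\lambda_2(\dot W_2)^n_{\bar i,\bar j,\bar k},$$ $$\delta_t^{s}\mathbf H^n_{\bar i,\bar j,\bar k}=-\mathbf e_1\times\delta_xA_t^{s}\mathbf E^n_{i,\bar j,\bar k}-\mathbf e_2\times\delta_yA_t^{s}\mathbf E^n_{\bar i,j,\bar k}-\mathbf e_3\times\delta_zA_t^{s}\mathbf E^n_{\bar i,\bar j,k}+\lambda_1A_t^{s}\mathbf E^n_{\bar i,\bar j,\bar k}(\dot{\overline W}_1)^n_{\bar i,\bar j,\bar k}+\boldsymbol\lambda_2(\dot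 W_2)^n_{\bar i,\bar j,\bar k}.$$ $U^n\in\mathbb{R}^{6I_xJ_yK_z}$ is the vector collecting all cell-centre values $(E_1)^n_{\bar i,\bar j,\bar k},(E_2)^n_{\bar i,\bar j,\bar k},(E_3)^n_{\bar i,\bar j,\bar k},(H_1)^n_{\bar i,\bar j,\bar k},(H_2)^n_{\bar i,\bar j,\bar k},(H_3)^n_{\bar i,\bar j,\bar k}$, $1\le i\le I_x$, $1\le j\le J_y$, $1\le k\le K_z$ (indices understood periodically). With $P_n\varphi(x)=\mathbb{E}[\varphi(U^n)]$, $U^0=x$, and $\pi(\varphi)=\int\varphi\,d\pi$: $\pi$ is invariant if $\pi(P_n\varphi)=\pi(\varphi)$ for all bounded Borel $\varphi$ and all $n$; ergodicity means $\frac1N\sum_{n=0}^{N-1}P_n\varphi\to\pi(\varphi)$ in $L^2(\pi)$ for all $\varphi\in L^2(\pi)$; exponential mixing means that there exist $\rho>0$ and a positive function $C(\cdot)$ with $|P_n\varphi(x)-\pi(\varphi)|\le C(x)L_\varphi e^{-\rho t_n}$ for all bounded Lipschitz $\varphi$ (Lipschitz constant $L_\varphi$), all $n$ and all $x$. *)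

(* Defs.v *)
From HB Require Import structures.
From mathcomp Require Import all_boot all_order all_algebra.
From mathcomp Require Import all_classical all_reals all_analysis.

Set Implicit Arguments.
Unset Strict Implicit.
Unset Printing Implicit Defensive.

Import Order.TTheory GRing.Theory Num.Theory.
Import numFieldNormedType.Exports.

Local Open Scope classical_set_scope.
Local Open Scope ring_scope.

(* Points of R^3 are triples, so that the product Lebesgue measure and the
   product topology apply; field values in R^3 are row vectors. *)
Notation point3 R := (R * R * R)%type.
Notation vec3 R := 'rV[R]_3.

Section space.
Context {R : realType}.
Implicit Types (D : set (point3 R)) (f g : point3 R -> R).

Definition leb3 :=
  ((@lebesgue_measure R \x @lebesgue_measure R) \x @lebesgue_measure R)%E.

Definition cuboid (lo hi : point3 R) : set (point3 R) :=
  [set p | [/\ lo.1.1 < p.1.1 < hi.1.1,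
               lo.1.2 < p.1.2 < hi.1.2 & lo.2 < p.2 < hi.2]].

Definition dist3 (p q : point3 R) : R :=
  Num.sqrt ((p.1.1 - q.1.1) ^+ 2 + (p.1.2 - q.1.2) ^+ 2 + (p.2 - q.2) ^+ 2).

Definition axis (l : 'I_3) : point3 R :=
  ((l == 0)%:R, (l == 1)%:R, (l == 2%:R)%:R).

Definition partial (l : 'I_3) f : point3 R -> R := fun p => 'D_(axis l) f p.

Definition multi_index := (nat * nat * nat)%type.
Definition order_mi (a : multi_index) : nat := (a.1.1 + a.1.2 + a.2)%N.

Definition partial_mi (a : multi_index) f : point3 R -> R :=
  iter a.1.1 (partial 0) (iter a.1.2 (partial 1) (iter a.2 (partial 2%:R) f)).

Fixpoint Ck (k : nat) f : Prop :=
  continuous f /\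
  if k is k'.+1 then
    forall l, (forall p, derivable f p (axis l)) /\ Ck k' (partial l f)
  else True.

Definition C1_on D f :=
  forall p, D p ->
    {for p, continuous f} /\
    forall l, derivable f p (axis l) /\ {for p, continuous (partial l f)}.

Definition test_function D f :=
  (forall k, Ck k f) /\
  exists K : set (point3 R),
    [/\ compact K, K `<=` D & forall p, ~ K p -> f p = 0].

Definition L2 D f :=
  measurable_fun D f /\ (\int[leb3]_(p in D) ((f p) ^+ 2)%:E < +oo)%E.

Definition inner D f g : R := \int[leb3]_(p in D) (f p * g p).

Definition Linfty D f :=
  measurable_fun D f /\ exists M : R, \forall p \ae leb3, D p -> `|f p| <= M.

Definition weak_derivative D (a : multi_index) f g :=
  forall phi, test_function D phi ->
    \int[leb3]_(p in D) (f p * partial_mi a phi p) =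
    (-1) ^+ order_mi a * \int[leb3]_(p in D) (g p * phi p).

(* The continuity clause selects the continuous representative (up to the
   boundary), which is what gives a meaning to the nodal values of f. *)
Definition W1infty D f :=
  [/\ Linfty D f,
      (forall a, order_mi a = 1%N ->
         exists g, Linfty D g /\ weak_derivative D a f g) &
      {within closure D, continuous f}].

Definition gagliardo D (t : R) g : \bar R :=
  (\int[leb3]_(p in D) \int[leb3]_(q in D)
     ((g p - g q) ^+ 2 / (dist3 p q `^ (3 + 2 * t)))%:E)%E.

(* Squared norm of H^s(D) (s >= 0 real, Sobolev-Slobodeckij), computed from a
   family G of weak derivatives of order at most m = floor s. *)
Definition sobolev_sum D (s : R) (G : multi_index -> point3 R -> R) : \bar R :=
  let m := Num.truncn s in
  let mi (a : 'I_m.+1 * 'I_m.+1 * 'I_m.+1) : multi_index :=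
    (a.1.1 : nat, a.1.2 : nat, a.2 : nat) in
  (\sum_(a | (order_mi (mi a) <= m)%N) \int[leb3]_(p in D) ((G (mi a) p) ^+ 2)%:E
   + if s == m%:R then 0
     else \sum_(a | order_mi (mi a) == m) gagliardo D (s - m%:R) (G (mi a)))%E.

(* Weak derivatives are a.e. unique, so the infimum is over at most one value;
   it is +oo when f has no square-integrable weak derivatives of order <= s. *)
Definition sobolev_sqnorm D (s : R) f : \bar R :=
  ereal_inf [set r | exists G,
    [/\ L2 D f,
        (forall a, (order_mi a <= Num.truncn s)%N ->
           L2 D (G a) /\ weak_derivative D a f (G a)) &
        r = sobolev_sum D s G]].

Definition orthonormal_basis D (q : nat -> point3 R -> R) :=
  [/\ (forall k, L2 D (q k)),
      (forall j k, inner D (q j) (q k) = (j == k)%:R) &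
      forall f, L2 D f ->
        (\int[leb3]_(p in D)
           ((f p - \sum_(k < N) inner D f (q k) * q k p) ^+ 2)%:E)%E
        @[N --> \oo] --> 0%E].

(* Q^(1/2) q_k, where Q q_k = eta_k q_k *)
Definition sqrtQ (eta : nat -> R) (q : nat -> point3 R -> R) (k : nat) :
  point3 R -> R := fun p => Num.sqrt (eta k) * q k p.

(* Q^(1/2) \in HS(L^2(D), H^s(D)): finite Hilbert-Schmidt norm, computed in the
   orthonormal basis q of L^2(D). *)
Definition sqrtQ_HS D (s : R) (eta : nat -> R) (q : nat -> point3 R -> R) :=
  (\sum_(k <oo) sobolev_sqnorm D s (sqrtQ eta q k) < +oo)%E.

End space.

Section probability.
Context {R : realType} {d : measure_display} {Omega : measurableType d}.
Variable P : probability Omega R.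

Definition filtration (F : R -> set (set Omega)) :=
  (forall t, 0 <= t -> sigma_algebra setT (F t) /\ F t `<=` measurable) /\
  (forall s t, 0 <= s -> s <= t -> F s `<=` F t).

Definition brownian_motion (F : R -> set (set Omega))
    (beta : R -> Omega -> R) :=
  [/\ (\forall w \ae P, beta 0 w = 0),
      (forall t, 0 <= t -> forall B, measurable B -> F t (beta t @^-1` B)),
      (forall s t, 0 <= s -> s < t -> forall B, measurable B ->
         P ((fun w => beta t w - beta s w) @^-1` B) =
         normal_prob 0 (Num.sqrt (t - s)) B),
      (forall s t, 0 <= s -> s < t -> forall A B, F s A -> measurable B ->
         let X := fun w => beta t w - beta s w in
         P (A `&` (X @^-1` B)) = (P A * P (X @^-1` B))%E) &
      \forall w \ae P, {within `[0, +oo[, continuous (beta ^~ w)}].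

Definition process_events (X : R -> Omega -> R) : set (set Omega) :=
  <<s [set A | exists t B, [/\ 0 <= t, measurable B & A = X t @^-1` B]] >>.

Definition independent_processes (I : eqType) (X : I -> R -> Omega -> R) :=
  forall (s : seq I) (A : I -> set Omega), uniq s ->
    (forall i, process_events (X i) (A i)) ->
    P (\big[setI/setT]_(i <- s) A i) = (\prod_(i <- s) P (A i))%E.

Definition L2_random_field (D : set (point3 R))
    (Z : Omega -> point3 R -> vec3 R) :=
  (forall l, measurable_fun (setT `*` D) (fun wp => Z wp.1 wp.2 0 l)) /\
  (\int[P]_w \int[leb3]_(p in D) (\sum_l (Z w p 0 l) ^+ 2)%:E < +oo)%E.

End probability.

Section noise.
Context {R : realType} {Omega : Type}.
Variables (eta : nat -> R) (q : nat -> point3 R -> R).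
Variable beta : nat -> R -> Omega -> R.

(* The value at the point p of W(t) = sum_k beta_k(t) Q^(1/2) q_k. *)
Definition wiener (t : R) (p : point3 R) (w : Omega) : R :=
  limn (fun N => \sum_(k < N) sqrtQ eta q k p * beta k t w).

Definition wiener_increment dt (n : nat) p w : R :=
  wiener (n.+1%:R * dt) p w - wiener (n%:R * dt) p w.

Definition trunc_level (b dt : R) : R := Num.sqrt (2 * b * `|ln dt|).

Definition xi dt (k n : nat) w : R :=
  (beta k (n.+1%:R * dt) w - beta k (n%:R * dt) w) / Num.sqrt dt.

Definition zeta b dt (k n : nat) w : R :=
  Num.max (- trunc_level b dt) (Num.min (xi dt k n w) (trunc_level b dt)).

Definition truncated_increment b dt (n : nat) p w : R :=
  Num.sqrt dt * limn (fun N => \sum_(k < N) zeta b dt k n w * sqrtQ eta q k p).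

End noise.

Section grid_operators.
Context {R : realType} {V : lmodType R}.
Implicit Types Z : nat -> nat -> nat -> V.

Definition avg_x Z i j k := 2^-1 *: (Z i j k + Z i.+1 j k).
Definition avg_y Z i j k := 2^-1 *: (Z i j k + Z i j.+1 k).
Definition avg_z Z i j k := 2^-1 *: (Z i j k + Z i j k.+1).

(* value at (i + 1/2, j + 1/2, k + 1/2) *)
Definition centre Z := avg_x (avg_y (avg_z Z)).

Definition diff_x (h : R) Z i j k := h^-1 *: (Z i.+1 j k - Z i j k).
Definition diff_y (h : R) Z i j k := h^-1 *: (Z i j.+1 k - Z i j k).
Definition diff_z (h : R) Z i j k := h^-1 *: (Z i j k.+1 - Z i j k).

Definition delta_t (s dt : R) Z0 Z1 i j k : V :=
  dt^-1 *: (Z1 i j k - expR (- s * dt) *: Z0 i j k).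
Definition avg_t (s dt : R) Z0 Z1 i j k : V :=
  2^-1 *: (Z1 i j k + expR (- s * dt) *: Z0 i j k).

Definition periodic (Ix Jy Kz : nat) Z :=
  forall i j k, [/\ Z (i + Ix)%N j k = Z i j k,
                    Z i (j + Jy)%N k = Z i j k & Z i j (k + Kz)%N = Z i j k].

End grid_operators.

Section scheme.
Context {R : realType}.

(* Indices in 'I_3 are added modulo 3. *)
Definition cross (u v : vec3 R) : vec3 R :=
  \row_(l < 3) (u 0 (l + 1) * v 0 (l + 2%:R) - u 0 (l + 2%:R) * v 0 (l + 1)).

Definition basis_vec (l : 'I_3) : vec3 R := delta_mx 0 l.

Variables (lo hi : point3 R) (Ix Jy Kz : nat).

Definition dx : R := (hi.1.1 - lo.1.1) / Ix%:R.
Definition dy : R := (hi.1.2 - lo.1.2) / Jy%:R.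
Definition dz : R := (hi.2 - lo.2) / Kz%:R.

Definition node (i j k : nat) : point3 R :=
  (lo.1.1 + i%:R * dx, lo.1.2 + j%:R * dy, lo.2 + k%:R * dz).

Definition cell_centre (i j k : nat) : point3 R :=
  (lo.1.1 + (i%:R + 2^-1) * dx, lo.1.2 + (j%:R + 2^-1) * dy,
   lo.2 + (k%:R + 2^-1) * dz).

(* e_1 x delta_x Z_{i,j+1/2,k+1/2} + e_2 x delta_y Z_{i+1/2,j,k+1/2}
   + e_3 x delta_z Z_{i+1/2,j+1/2,k} *)
Definition discrete_curl (Z : nat -> nat -> nat -> vec3 R) i j k : vec3 R :=
  cross (basis_vec 0) (diff_x dx (avg_y (avg_z Z)) i j k)
  + cross (basis_vec 1) (diff_y dy (avg_x (avg_z Z)) i j k)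
  + cross (basis_vec 2%:R) (diff_z dz (avg_x (avg_y Z)) i j k).

(* One step (E0, H0) -> (E1, H1) in the cell (i,j,k); w1 and w2 are the noise
   increments at its centre.  The scalar s is frozen in the cell: it is the
   same at all the nodal values entering the averages and differences. *)
Definition scheme_step (sigma : point3 R -> R) (lambda1 : R) (lambda2 : vec3 R)
    (dt w1 w2 : R) (E0 H0 E1 H1 : nat -> nat -> nat -> vec3 R) i j k : Prop :=
  let s := sigma (node i j k) in
  let AE := avg_t s dt E0 E1 in
  let AH := avg_t s dt H0 H1 in
  delta_t s dt (centre E0) (centre E1) i j k =
    discrete_curl AH i j k
    - (lambda1 * (w1 / dt)) *: centre AH i j k + (w2 / dt) *: lambda2
  /\
  delta_t s dt (centre H0) (centre H1) i j k =
    - discrete_curl AE i j k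
    + (lambda1 * (w1 / dt)) *: centre AE i j k + (w2 / dt) *: lambda2.

(* Grid functions on the nodes, with periodic boundary condition, solving the
   scheme in all the cells 0 <= i < Ix, 0 <= j < Jy, 0 <= k < Kz. *)
Definition numerical_solution (d : measure_display) (Omega : measurableType d)
    (P : probability Omega R)
    (sigma : point3 R -> R) (lambda1 : R) (lambda2 : vec3 R) (dt : R)
    (dW1 dW2 : nat -> point3 R -> Omega -> R)
    (E H : nat -> Omega -> nat -> nat -> nat -> vec3 R) :=
  [/\ (forall n w, periodic Ix Jy Kz (E n w) /\ periodic Ix Jy Kz (H n w)),
      (forall n i j k l, measurable_fun setT (fun w => E n w i j k 0 l) /\
                         measurable_fun setT (fun w => H n w i j k 0 l)) &
      forall n, \forall w \ae P, forall i j k,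
        (i < Ix)%N -> (j < Jy)%N -> (k < Kz)%N ->
        scheme_step sigma lambda1 lambda2 dt
          (dW1 n (cell_centre i j k) w) (dW2 n (cell_centre i j k) w)
          (E n w) (H n w) (E n.+1 w) (H n.+1 w) i j k].

End scheme.

(* An entry of the state vector is given by a field (E or H), a component and a
   cell. *)
Notation state_index Ix Jy Kz :=
  (bool * 'I_3 * ('I_Ix * 'I_Jy * 'I_Kz))%type.
Notation state R Ix Jy Kz := 'rV[R]_#|{: state_index Ix Jy Kz}|.

Lemma card_state_index Ix Jy Kz :
  #|{: state_index Ix Jy Kz}| = (6 * Ix * Jy * Kz)%N.
Proof. by rewrite !card_prod card_bool !card_ord !mulnA. Qed.

(* The scheme acts on the nodal values; by periodicity the nodal values are
   determined by the cell-centre values (and every state x is attained) exactly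
   when Ix, Jy and Kz are odd. *)
Definition cell_vector (R : realType) (Ix Jy Kz : nat)
    (E H : nat -> nat -> nat -> vec3 R) : state R Ix Jy Kz :=
  \row_a let: (isH, l, (i, j, k)) := (enum_val a : state_index Ix Jy Kz) in
         centre (if isH then H else E) i j k 0 l.

(* R^N with its Borel sigma-algebra *)
Notation borel_space R N := (g_sigma_algebraType (@open 'rV[R]_N)).

Section long_time.
Context {R : realType} {d : measure_display} {Omega : measurableType d}.
Variables (P : probability Omega R) (N : nat).
(* U x n is the chain at step n, started from U x 0 = x. *)
Variable U : 'rV[R]_N -> nat -> Omega -> 'rV[R]_N.
Implicit Types (pi : probability (borel_space R N) R) (phi : 'rV[R]_N -> R).

Definition semigroup (n : nat) phi : 'rV[R]_N -> R :=
  fun x => fine 'E_P[fun w => phi (U x n w)].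

Definition bounded_fun phi := exists M : R, forall x, `|phi x| <= M.

Definition mean pi phi : R := \int[pi]_x phi x.

Definition invariant pi :=
  forall phi, measurable_fun [set: borel_space R N] phi -> bounded_fun phi ->
    forall n, mean pi (semigroup n phi) = mean pi phi.

Definition unique_invariant pi :=
  invariant pi /\
  forall pi' : probability (borel_space R N) R, invariant pi' ->
    forall A : set (borel_space R N), measurable A -> pi' A = pi A.

Definition cesaro_mean (M : nat) phi : 'rV[R]_N -> R :=
  fun x => M%:R^-1 * \sum_(n < M) semigroup n phi x.

Definition ergodic pi :=
  forall phi, (phi : borel_space R N -> R) \in Lfun pi 2%:E ->
    Lnorm pi 2%:E (fun x => (cesaro_mean M phi x - mean pi phi)%:E)
    @[M --> \oo] --> 0%E.

Definition norm2 (x : 'rV[R]_N) : R := Num.sqrt (\sum_a (x 0 a) ^+ 2).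

Definition lipschitz_const (L : R) phi :=
  0 <= L /\ forall x y, `|phi x - phi y| <= L * norm2 (x - y).

Definition exponentially_mixing (dt : R) pi :=
  exists (rho : R) (C : 'rV[R]_N -> R),
    [/\ 0 < rho, (forall x, 0 < C x) &
        forall phi L, bounded_fun phi -> lipschitz_const L phi ->
          forall n x, `|semigroup n phi x - mean pi phi|
                      <= C x * L * expR (- rho * (n%:R * dt))].

End long_time.

(* Main.v *)
(* Summation by parts on the periodic grid makes the discrete curl
   skew-symmetric in the cell-centre values, and so is the rotation produced by
   the multiplicative noise.  Hence every step solves
     v = u (explicit part) + forcing + v B     with B skew-symmetric,
   1 - B is invertible, and pairing with v plus the damped u gives an energy
   estimate: two solutions driven by the same noise approach each other by the
   factor 1 / (1 + sigma0 dt) + C dt^2, which is below 1 for small dt.  The curl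
   is a function of the cell-centre values only if these determine the nodal
   values; this holds because a numerical solution starts from every state.

   The noise at the cell centres is almost surely a measurable function of the
   independent Gaussian increments of the Brownian motions: a Gaussian series
   converges almost surely or diverges almost surely, according to the sum of the
   squared coefficients.  So U^n is an iterated random contraction driven by an
   independent identically distributed sequence, and running the iteration
   backwards converges almost surely to a stationary state, whose law is pi.
   The contraction gives exponential mixing and, as bounded Lipschitz functions
   determine a law, uniqueness.  Bounded Lipschitz functions are dense in L^2(pi),
   on which the semigroup is a contraction, so P_n phi tends to pi(phi) in L^2(pi)
   and so do the averages. *)
Require Import Defs.
From mathcomp Require Import all_boot all_order all_algebra.
From mathcomp Require Import all_classical all_reals all_analysis.
From mathcomp Require Import measurable_realfun.
From mathcomp Require Import ring lra.
Set Implicit Arguments.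
Unset Strict Implicit.
Unset Printing Implicit Defensive.
Import Order.TTheory GRing.Theory Num.Theory.
Import numFieldNormedType.Exports.
Local Open Scope classical_set_scope.
Local Open Scope ring_scope.

(** * The Euclidean norm and the Borel sets *)

(** [sigma] varies from cell to cell, so the damping does not commute with the discrete curl, and a
    step is not a damping followed by an isometry. Pairing with the new difference plus the damped
    old one cancels the skew terms and leaves a commutator of order [dt ^+ 2], with a constant that
    depends on the mesh: hence a threshold for [dt] that depends on the mesh. The multiplicative
    noise sits in skew terms alone, so the rate is deterministic and only the additive noise needs a
    moment.

    A Wiener increment is a difference of two limits of series, one per time, and [limn] has a
    default value at divergence; it is a function of the Brownian increments only because both
    series behave alike. The Gaussian estimates behind this come from one closed formula, the
    expectation of [expR (- (l * S ^+ 2))] for a finite sum [S]: small [l] gives second moments,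
    large variance gives divergence.

    Conditioning is done by Fubini: an iid family may be replaced by one living on a product space
    without changing its law, and one factor is integrated at a time. *)

Section comparison_sets.
Context {R : realType} {d : measure_display} {T : measurableType d}.

Lemma measurable_ltr_set (f g : T -> R) : measurable_fun setT f -> measurable_fun setT g ->
  measurable [set t | f t < g t].
Proof.
move=> mf mg; rewrite -[X in measurable X]setTI.
exact: (measurable_fun_ltr mf mg measurableT (Y := [set true])).
Qed.

Lemma measurable_ler_set (f g : T -> R) : measurable_fun setT f -> measurable_fun setT g ->
  measurable [set t | f t <= g t].
Proof.
move=> mf mg; rewrite -[X in measurable X]setTI.
exact: (measurable_fun_ler mf mg measurableT (Y := [set true])).
Qed.

End comparison_sets.

Section euclidean_norm.
Context {R : realType}.

Definition dotv n (u v : 'rV[R]_n) : R := \sum_a u 0 a * v 0 a.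

Lemma dotvC n (u v : 'rV[R]_n) : dotv u v = dotv v u.
Proof. by apply: eq_bigr => a _; rewrite mulrC. Qed.

Lemma dotvDl n (u v w : 'rV[R]_n) : dotv (u + v) w = dotv u w + dotv v w.
Proof. by rewrite -big_split; apply: eq_bigr => a _; rewrite !mxE mulrDl. Qed.

Lemma dotvDr n (u v w : 'rV[R]_n) : dotv w (u + v) = dotv w u + dotv w v.
Proof. by rewrite dotvC dotvDl !(dotvC w). Qed.

Lemma dotvZl n k (u v : 'rV[R]_n) : dotv (k *: u) v = k * dotv u v.
Proof. by rewrite mulr_sumr; apply: eq_bigr => a _; rewrite !mxE mulrA. Qed.

Lemma dotvNl n (u v : 'rV[R]_n) : dotv (- u) v = - dotv u v.
Proof. by rewrite -scaleN1r dotvZl mulN1r. Qed.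

Lemma dotvBl n (u v w : 'rV[R]_n) : dotv (u - v) w = dotv u w - dotv v w.
Proof. by rewrite dotvDl dotvNl. Qed.

Lemma dotvBr n (u v w : 'rV[R]_n) : dotv w (u - v) = dotv w u - dotv w v.
Proof. by rewrite dotvC dotvBl !(dotvC w). Qed.

Lemma dotvZr n k (u v : 'rV[R]_n) : dotv u (k *: v) = k * dotv u v.
Proof. by rewrite dotvC dotvZl dotvC. Qed.

Lemma dotvv_ge0 n (u : 'rV[R]_n) : 0 <= dotv u u.
Proof. by apply: sumr_ge0 => a _; rewrite -expr2 sqr_ge0. Qed.

Lemma norm2_ge0 n (u : 'rV[R]_n) : 0 <= norm2 u.
Proof. exact: sqrtr_ge0. Qed.

Lemma sqr_norm2 n (u : 'rV[R]_n) : norm2 u ^+ 2 = dotv u u.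
Proof.
rewrite sqr_sqrtr; last by apply: sumr_ge0 => a _; exact: sqr_ge0.
by apply: eq_bigr => a _; rewrite expr2.
Qed.

Lemma norm2_coord n (u : 'rV[R]_n) a : `|u 0 a| <= norm2 u.
Proof.
rewrite -(ler_pXn2r (n := 2))// ?nnegrE ?norm2_ge0// sqr_norm2 real_normK ?num_real//.
rewrite /dotv (bigD1 a)//= -expr2 lerDl.
by apply: sumr_ge0 => b _; rewrite -expr2 sqr_ge0.
Qed.

Lemma norm2_eq0 n (u : 'rV[R]_n) : norm2 u = 0 -> u = 0.
Proof.
move=> u0; apply/rowP => a; rewrite mxE; apply/eqP; rewrite -normr_eq0.
by rewrite eq_le normr_ge0 andbT -u0 norm2_coord.
Qed.

Lemma cauchy_schwarz n (u v : 'rV[R]_n) : `|dotv u v| <= norm2 u * norm2 v.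
Proof.
have [v0|v0] := eqVneq (norm2 v) 0.
  rewrite (norm2_eq0 v0) /dotv big1 ?normr0 ?mulr_ge0 ?norm2_ge0// => a _.
  by rewrite mxE mulr0.
rewrite -(ler_pXn2r (n := 2))// ?nnegrE ?mulr_ge0 ?norm2_ge0//.
rewrite real_normK ?num_real// exprMn !sqr_norm2.
have vv : 0 < dotv v v by rewrite -sqr_norm2 exprn_gt0// lt_def v0 norm2_ge0.
(* This squared norm equals [dotv v v] times the difference of the two sides of the squared
   inequality. *)
have := dotvv_ge0 (dotv v v *: u - dotv u v *: v).
rewrite !(dotvBl, dotvBr, dotvZl, dotvZr) (dotvC v u) => h.
rewrite -(ler_pM2l vv) -subr_ge0; apply: le_trans h _.
by rewrite le_eqVlt; apply/orP; left; apply/eqP; ring.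
Qed.

Lemma norm2D n (u v : 'rV[R]_n) : norm2 (u + v) <= norm2 u + norm2 v.
Proof.
rewrite -(ler_pXn2r (n := 2))// ?nnegrE ?addr_ge0 ?norm2_ge0//.
rewrite sqr_norm2 sqrrD !sqr_norm2 !(dotvDl, dotvDr) (dotvC v u).
have := cauchy_schwarz u v; have := ler_norm (dotv u v); lra.
Qed.

Lemma norm2Z n k (u : 'rV[R]_n) : norm2 (k *: u) = `|k| * norm2 u.
Proof.
apply: (@pexpIrn _ 2) => //; rewrite ?nnegrE ?mulr_ge0 ?norm2_ge0//.
by rewrite exprMn !sqr_norm2 dotvZl dotvZr real_normK ?num_real// expr2 mulrA.
Qed.

Lemma norm2N n (u : 'rV[R]_n) : norm2 (- u) = norm2 u.
Proof. by rewrite -scaleN1r norm2Z normrN1 mul1r. Qed.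

Lemma norm2_0 n : norm2 (0 : 'rV[R]_n) = 0.
Proof. by rewrite -(scale0r (0 : 'rV_n)) norm2Z normr0 mul0r. Qed.

Lemma norm2_distC n (u v : 'rV[R]_n) : norm2 (u - v) = norm2 (v - u).
Proof. by rewrite -norm2N opprB. Qed.

Lemma norm2_le_sum n (u : 'rV[R]_n) : norm2 u <= \sum_a `|u 0 a|.
Proof.
rewrite -(ler_pXn2r (n := 2))// ?nnegrE ?norm2_ge0 ?sumr_ge0//.
rewrite sqr_norm2 expr2 mulr_sumr; apply: ler_sum => a _.
rewrite -expr2 -[_ ^+ 2]real_normK ?num_real// expr2 ler_wpM2r//.
by rewrite (bigD1 a)//= lerDl sumr_ge0.
Qed.

(** A crude bound of the operator norm of [u *m A]. Its size is harmless: in the contraction rate it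
    is multiplied by [dt ^+ 2]. *)
Definition opbound m n (A : 'M[R]_(m, n)) : R := \sum_i norm2 (row i A).

Lemma opbound_ge0 m n (A : 'M[R]_(m, n)) : 0 <= opbound A.
Proof. by apply: sumr_ge0 => i _; exact: norm2_ge0. Qed.

Lemma norm2_mulmx m n (A : 'M[R]_(m, n)) u : norm2 (u *m A) <= opbound A * norm2 u.
Proof.
rewrite mulmx_sum_row /opbound mulr_suml.
have h (s : seq 'I_m) : norm2 (\sum_(i <- s) u 0 i *: row i A) <=
    \sum_(i <- s) norm2 (row i A) * norm2 u.
  elim: s => [|i s ih]; first by rewrite !big_nil norm2_0.
  rewrite !big_cons; apply: le_trans (norm2D _ _) _; apply: lerD => //.
  by rewrite norm2Z mulrC ler_wpM2l ?norm2_ge0 ?norm2_coord.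
exact: h.
Qed.

Lemma lipschitz_continuous n (phi : 'rV[R]_n -> R) L :
  lipschitz_const L phi -> continuous phi.
Proof.
move=> [L0 hL] x A /nbhs_ballP[e /= e0 eA].
(* Balls of ['rV_n] are those of the sup norm, and [norm2] is at most [n] times that norm. The
   successors in [L + 1] and [n.+1] avoid zero denominators and make the final inequality strict. *)
pose r := e / (L + 1) / n.+1%:R.
have r0 : 0 < r by rewrite !divr_gt0// ltr_wpDl.
apply/nbhs_ballP; exists r => //= y [_ xy].
apply: eA; rewrite /ball/=; apply: le_lt_trans (hL _ _) _.
have : norm2 (x - y) <= n%:R * r.
  apply: le_trans (norm2_le_sum _) _.
  apply: (@le_trans _ _ (\sum_(a < n) r)); last by rewrite sumr_const card_ord mulr_natl.
  by apply: ler_sum => a _; rewrite !mxE ltW//; exact: xy.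
move=> h; apply: (@le_lt_trans _ _ (L * (n%:R * r))); first exact: ler_wpM2l.
rewrite /r; have L1 : 0 < L + 1 by rewrite ltr_wpDl.
have -> : L * (n%:R * (e / (L + 1) / n.+1%:R)) = e * (L / (L + 1)) * (n%:R / n.+1%:R).
  field; apply/andP; split; last by rewrite gt_eqF.
  by rewrite -[X in X + _ != _]/(1%:R) -natrD pnatr_eq0.
rewrite -[ltRHS]mulr1; apply: ltr_pM => //.
- by rewrite mulr_ge0 ?divr_ge0// ltW.
- by rewrite -[ltRHS]mulr1 ltr_pM2l// ltr_pdivrMr// mul1r ltrDl.
- by rewrite ltr_pdivrMr// mul1r ltr_nat.
Qed.

End euclidean_norm.

Section borel_rV.
Context {R : realType} {N : nat}.

Lemma measurable_coord (a : 'I_N) :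
  measurable_fun [set: borel_space R N] (fun x : borel_space R N => (x : 'rV[R]_N) 0 a).
Proof.
apply: (measurability _ (RGenOpens.measurableE R)).
move=> _ [_ [u [v ->]] <-]; rewrite setTI; apply: sub_sigma_algebra.
by apply: open_comp => // x _; exact: coord_continuous.
Qed.

Lemma measurable_lipschitz L (phi : 'rV[R]_N -> R) : lipschitz_const L phi ->
  measurable_fun [set: borel_space R N] (phi : borel_space R N -> R).
Proof.
move=> /lipschitz_continuous cphi.
apply: (measurability _ (RGenOpens.measurableE R)).
move=> _ [_ [u [v ->]] <-]; rewrite setTI; apply: sub_sigma_algebra.
by apply: open_comp => // x _; exact: cphi.
Qed.

(** An open set is the union of the countably many sup-norm cubes, with rational centre and radius
    [n.+1%:R^-1], that it contains; the preimage of a cube only involves finitely many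
    coordinates. *)
Lemma measurable_borel_coord d (T : measurableType d) (f : T -> 'rV[R]_N) :
  (forall a, measurable_fun setT (fun t => f t 0 a)) ->
  measurable_fun setT (f : T -> borel_space R N).
Proof.
move=> mf; apply: (@measurability _ _ T (borel_space R N) setT f open erefl) => _ [U oU <-]; rewrite setTI.
pose box (p : 'rV[rat]_N * nat) : set 'rV[R]_N :=
  [set y | forall a, `|ratr (p.1 0 a) - y 0 a| < p.2.+1%:R^-1].
have -> : f @^-1` U = \bigcup_(p in [set p | box p `<=` U]) (f @^-1` box p).
  apply/seteqP; split => [t Ut|t [p pU]]; last exact: pU.
  have /nbhs_ballP[e /= e0 eU] : nbhs (f t) U by exact: open_nbhs_nbhs.
  (* Twice the radius is below [e], since points of the cube are compared with [f t] through its
     rational centre. *)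
  have [n _ ne] : exists2 n : nat, True & n.+1%:R^-1 *+ 2 < e :> R.
    exists (Num.truncn (2 / e)) => //; set m := _.+1.
    have : 2 / e < m%:R by exact: truncnS_gt.
    rewrite ltr_pdivrMr// => h; have m0 : 0 < m%:R :> R by [].
    by rewrite -(ltr_pM2l m0) mulrnAr divff ?gt_eqF.
  have hq a : exists c : rat, `|ratr c - f t 0 a| < n.+1%:R^-1.
    have : f t 0 a - n.+1%:R^-1 < f t 0 a + n.+1%:R^-1 by rewrite ltrD2l gtrN.
    move=> /rat_in_itvoo[c]; rewrite in_itv/= => /andP[c1 c2]; exists c.
    by rewrite ltr_norml ltrBrDr ltrBlDr addrC c1 addrC c2.
  have /choice[c hc] := hq.
  exists (\row_a c a, n); last by move=> a; rewrite /= mxE.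
  move=> y /= hy; apply: eU; split=> // i a; rewrite ord1 /ball/=.
  apply: le_lt_trans ne; rewrite mulr2n.
  apply: le_trans (ler_distD (ratr (c a)) _ _) _.
  have := hy a; rewrite mxE => /ltW h; have /ltW h' := hc a.
  by rewrite distrC lerD.
rewrite bigcup_mkcond; apply: countable_bigcupT_measurable => [|p]; first exact: countableP.
case: ifPn => // _.
have -> : f @^-1` box p = \bigcap_(a in setT) [set t | `|ratr (p.1 0 a) - f t 0 a| < p.2.+1%:R^-1].
  by apply/seteqP; split => [t h a _|t h a]; exact: h.
apply: fin_bigcap_measurable => // a _.
apply: measurable_ltr_set => //.
by apply: measurableT_comp => //; exact: measurable_funB.
Qed.

Lemma measurable_norm2 : measurable_fun [set: borel_space R N] (fun x : borel_space R N => norm2 (x : 'rV[R]_N)).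
Proof.
apply: (@measurable_lipschitz 1); split=> // x y; rewrite mul1r.
rewrite ler_norml; apply/andP; split.
  rewrite lerNl opprB lerBlDl norm2_distC; apply: le_trans (norm2D _ _).
  by rewrite addrC subrK.
by rewrite lerBlDl; apply: le_trans (norm2D _ _); rewrite addrC subrK.
Qed.

End borel_rV.

(** * Families of independent identically distributed random variables *)

Lemma measurable_section d1 d2 d3 (T1 : measurableType d1) (T2 : measurableType d2)
    (T3 : measurableType d3) (f : T1 * T2 -> T3) (x : T1) :
  measurable_fun setT f -> measurable_fun setT (fun y => f (x, y)).
Proof. by move=> mf; exact: (measurableT_comp mf (pair1_measurable x)). Qed.

Section law.
Context {R : realType} {d d' : measure_display} {T : measurableType d}
  {T' : measurableType d'}.

Definition law (P : probability T R) (f : T -> T') (mf : measurable_fun setT f) :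
  probability T' R := distribution P (mfun_Sub (mem_set mf)).

Lemma ge0_integral_law P f (mf : measurable_fun setT f) (g : T' -> \bar R) :
  measurable_fun [set: T'] g -> (forall y, 0 <= g y)%E ->
  (\int[law P mf]_y g y = \int[P]_x g (f x))%E.
Proof. by move=> mg g0; rewrite /law ge0_integral_distribution. Qed.

End law.

(** Finite-dimensional boxes: a system closed under intersection that generates the product
    sigma-algebra, so that a law on [I -> R] is determined by product formulas. *)
Definition cylinder (R : realType) (I : eqType) : set (set (I -> R)) :=
  [set A | exists (s : seq I) (B : I -> set R), (forall i, measurable (B i)) /\
     A = [set z | forall i, i \in s -> B i (z i)]].

Notation seqspace R I := (g_sigma_algebraType (@cylinder R I)).

Section sequence_space.
Context {R : realType} {I : eqType}.

Lemma cylinder_setI : setI_closed (@cylinder R I).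
Proof.
move=> _ _ [s1 [B1 [mB1 ->]]] [s2 [B2 [mB2 ->]]].
exists (s1 ++ s2), (fun i => (if i \in s1 then B1 i else setT) `&`
                           (if i \in s2 then B2 i else setT)); split.
  by move=> i; apply: measurableI; case: ifP.
apply/seteqP; split => z /=.
  move=> [h1 h2] i _; split; case: ifP => // si; [exact: h1|exact: h2].
move=> h; split => i si; have := h i; rewrite mem_cat si ?orbT => /(_ erefl)[].
  by [].
by [].
Qed.

Lemma measurable_seq_coord (i : I) :
  measurable_fun [set: seqspace R I] (fun z : seqspace R I => (z : I -> R) i).
Proof.
move=> _ B mB; rewrite setTI; apply: sub_sigma_algebra.
exists [:: i], (fun=> B); split=> //; apply/seteqP; split => z /=.
  by move=> Bz j; rewrite inE => /eqP ->.
by apply; rewrite inE.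
Qed.

Lemma measurable_seq_map d (T : measurableType d) (f : T -> I -> R) :
  (forall i, measurable_fun setT (fun t => f t i)) ->
  measurable_fun setT (f : T -> seqspace R I).
Proof.
move=> mf; apply: (@measurability _ _ T (seqspace R I) setT f (@cylinder R I) erefl).
move=> _ [_ [s [B [mB ->]]] <-]; rewrite setTI.
elim: s => [|i s ih].
  rewrite (_ : _ @^-1` _ = setT) //; by apply/seteqP; split.
rewrite (_ : _ @^-1` _ = (fun t => f t i) @^-1` B i `&`
    f @^-1` [set z | forall j, j \in s -> B j (z j)]).
  by apply: measurableI => //; rewrite -[X in measurable X]setTI; exact: mf.
apply/seteqP; split => t /=.
  by move=> h; split=> [|j js]; apply: h; rewrite inE ?eqxx// js orbT.
by move=> [h1 h2] j; rewrite inE => /orP[/eqP ->//|]; exact: h2.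
Qed.

End sequence_space.

Section iid.
Context {R : realType}.

(** One formula carries both independence and the common law, the latter through lists of length
    one. [nu] is a bare set function. *)
Definition iid d (T : measurableType d) (P : probability T R) (I : eqType)
    (X : I -> T -> R) (nu : set R -> \bar R) :=
  (forall i, measurable_fun setT (X i)) /\
  forall (s : seq I) (B : I -> set R), uniq s -> (forall i, measurable (B i)) ->
    P [set w | forall i, i \in s -> B i (X i w)] = (\prod_(i <- s) nu (B i))%E.

Section law_of_iid.
Context d1 d2 (T1 : measurableType d1) (T2 : measurableType d2) (I : eqType).
Variables (P1 : probability T1 R) (P2 : probability T2 R).
Variables (X1 : I -> T1 -> R) (X2 : I -> T2 -> R) (nu : set R -> \bar R).
Hypotheses (hX1 : iid P1 X1 nu) (hX2 : iid P2 X2 nu).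

Let m1 : measurable_fun setT ((fun w i => X1 i w) : T1 -> seqspace R I).
Proof. by apply: measurable_seq_map; exact: hX1.1. Qed.

Let m2 : measurable_fun setT ((fun w i => X2 i w) : T2 -> seqspace R I).
Proof. by apply: measurable_seq_map; exact: hX2.1. Qed.

(** Both laws give a box the product of the [nu (B i)], and boxes determine a law; repeated indices
    are removed first because the product formula asks for [uniq]. Thus the joint law depends on
    [nu] alone, and an iid family may be exchanged for any other realisation of it. *)
Lemma iid_law (A : set (seqspace R I)) : measurable A ->
  P1 [set w | A (X1^~ w)] = P2 [set w | A (X2^~ w)].
Proof.
move=> mA.
apply: (@measure_unique _ R (seqspace R I) (@cylinder R I) (fun=> setT) erefl
  cylinder_setI _ _ (law P1 m1) (law P2 m2)) => //.
- by move=> n; exists [::], (fun=> setT); split=> //; apply/seteqP; split.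
- by rewrite bigcup_const.
- move=> _ [s [B [mB ->]]].
  have us := undup_uniq s.
  have h1 := hX1.2 (undup s) B us mB; have h2 := hX2.2 (undup s) B us mB.
  transitivity (P1 [set w | forall i, i \in undup s -> B i (X1 i w)]).
    by congr (P1 _); apply/seteqP; split => w /= h i; move: (h i); rewrite mem_undup.
  rewrite h1 -h2.
  by congr (P2 _); apply/seteqP; split => w /= h i; move: (h i); rewrite mem_undup.
- move=> _; apply: (@le_lt_trans _ _ 1%E); last by rewrite ltey.
  exact: probability_le1.
Qed.

Lemma iid_integral (g : seqspace R I -> \bar R) :
  measurable_fun [set: seqspace R I] g ->
  (forall z, 0 <= g z)%E ->
  (\int[P1]_w g (X1^~ w) = \int[P2]_w g (X2^~ w))%E.
Proof.
move=> mg g0.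
rewrite -(ge0_integral_law P1 m1)// -(ge0_integral_law P2 m2)//.
apply: eq_measure_integral => A mA _; exact: iid_law.
Qed.

End law_of_iid.

Lemma iid_comp d (T : measurableType d) (P : probability T R) (I J : eqType)
    (X : I -> T -> R) nu (f : J -> I) : injective f -> iid P X nu ->
  iid P (fun j => X (f j)) nu.
Proof.
move=> fI [mX hX]; split=> [j|s B us mB]; first exact: mX.
(* The sets are transported along the injection [f]: at [f j] the intersection has the single member
   [B j], and outside the image it is empty, hence the whole line. *)
pose B' i := \bigcap_(j in f @^-1` [set i]) B j.
have B'E j : B' (f j) = B j.
  apply/seteqP; split => x; first by apply.
  by move=> Bx k /= /fI ->.
have mB' i : measurable (B' i).
  have [[j <-]|no] := pselect (exists j, f j = i); first by rewrite B'E.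
  rewrite (_ : B' i = setT)//; apply/seteqP; split=> // x _ j /= fj.
  by exfalso; apply: no; exists j.
transitivity (P [set w | forall i, i \in map f s -> B' i (X i w)]).
  congr (P _); apply/seteqP; split => w /= h.
    by move=> _ /mapP[j js ->]; rewrite B'E; exact: h.
  by move=> j js; rewrite -B'E; apply: h; rewrite mem_map.
rewrite hX ?map_inj_uniq// big_map; apply: eq_bigr => j _.
by rewrite B'E.
Qed.

Lemma iid_marginal d (T : measurableType d) (P : probability T R) (I : eqType)
    (X : I -> T -> R) nu i B : iid P X nu -> measurable B ->
  P [set w | B (X i w)] = nu B.
Proof.
move=> [mX hX] mB; have := hX [:: i] (fun=> B) erefl (fun=> mB).
rewrite big_seq1 => <-; congr (P _); apply/seteqP; split => w /=.
  by move=> h j; rewrite inE => /eqP ->.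
by apply; rewrite inE.
Qed.

Definition glue (T1 T2 I1 I2 : Type) (X1 : I1 -> T1 -> R) (X2 : I2 -> T2 -> R)
    (i : I1 + I2) (w : T1 * T2) : R :=
  match i with inl a => X1 a w.1 | inr b => X2 b w.2 end.

(** The product measure makes the two families independent of each other. This provides an
    independent copy and prepares conditioning by Fubini. *)
Lemma iid_glue d1 d2 (T1 : measurableType d1) (T2 : measurableType d2)
    (I1 I2 : eqType) (P1 : probability T1 R) (P2 : probability T2 R)
    (X1 : I1 -> T1 -> R) (X2 : I2 -> T2 -> R) (nu : set R -> \bar R) :
  iid P1 X1 nu -> iid P2 X2 nu ->
  iid (P1 \x P2)%E (glue X1 X2 : (I1 + I2)%type -> _ -> _) nu.
Proof.
move=> [mX1 h1] [mX2 h2]; split=> [[a|b]|s B us mB] /=.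
- by apply: measurableT_comp => //; exact: measurable_fst.
- by apply: measurableT_comp => //; exact: measurable_snd.
pose getl (i : I1 + I2) := if i is inl a then Some a else None.
pose getr (i : I1 + I2) := if i is inr b then Some b else None.
pose s1 := pmap getl s; pose s2 := pmap getr s.
have s1E a : (a \in s1) = (inl a \in s).
  rewrite mem_pmap; apply/mapP/idP => [[[c|c]//= cs [->]]//|h].
  by exists (inl a).
have s2E a : (a \in s2) = (inr a \in s).
  rewrite mem_pmap; apply/mapP/idP => [[[c|c]//= cs [->]]//|h].
  by exists (inr a).
have us1 : uniq s1.
  by apply: (@pmap_uniq _ _ getl inl) => //; case.
have us2 : uniq s2.
  by apply: (@pmap_uniq _ _ getr inr) => //; case.
have ps : perm_eq s (map inl s1 ++ map inr s2).
  apply: uniq_perm => //.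
    rewrite cat_uniq !map_inj_uniq ?us1 ?us2//; try by move=> ? ? [].
    by rewrite andbT/=; apply/hasPn => _ /mapP[b _ ->]; apply/mapP => -[].
  move=> [a|b]; rewrite mem_cat.
    rewrite mem_map ?s1E; last by move=> ? ? [].
    by rewrite (_ : _ \in map inr s2 = false) ?orbF//; apply/mapP => -[].
  rewrite mem_map ?s2E; last by move=> ? ? [].
  by rewrite (_ : _ \in map inl s1 = false)//; apply/mapP => -[].
rewrite (perm_big _ ps) big_cat !big_map /=.
rewrite -(h1 s1 (B \o inl))// -?(h2 s2 (B \o inr))//.
rewrite -product_measure1E//.
- congr ((P1 \x P2)%E _); apply/seteqP; split => -[w1 w2] /=.
    by move=> h; split => i; rewrite ?s1E ?s2E; exact: h.
  by move=> [k1 k2] [a|b] ins; [apply: k1; rewrite s1E|apply: k2; rewrite s2E].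
- have -> : [set w | forall i, i \in s1 -> (B \o inl) i (X1 i w)] =
      (fun w i => X1 i w) @^-1` [set z | forall i, i \in s1 -> (B \o inl) i (z i)] by [].
  rewrite -[X in measurable X]setTI.
  apply: (measurable_seq_map (f := fun w i => X1 i w)) => //.
  by apply: sub_sigma_algebra; exists s1, (B \o inl); split=> // i; exact: mB.
- have -> : [set w | forall i, i \in s2 -> (B \o inr) i (X2 i w)] =
      (fun w i => X2 i w) @^-1` [set z | forall i, i \in s2 -> (B \o inr) i (z i)] by [].
  rewrite -[X in measurable X]setTI.
  apply: (measurable_seq_map (f := fun w i => X2 i w)) => //.
  by apply: sub_sigma_algebra; exists s2, (B \o inr); split=> // i; exact: mB.
- by move=> i; exact: mB.
- by move=> i; exact: mB.
Qed.

(** Missing constraints are filled with [setT], which contributes the factor [nu setT = 1]. Brownian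
    increments can then be tested on full rectangular blocks of times and motions. *)
Lemma iid_cofinal d (T : measurableType d) (P : probability T R) (I : eqType)
    (X : I -> T -> R) (nu : set R -> \bar R) : nu setT = 1%E ->
  (forall i, measurable_fun setT (X i)) ->
  (forall s : seq I, exists s', [/\ uniq s', {subset s <= s'} &
     forall B : I -> set R, (forall i, measurable (B i)) ->
     P [set w | forall i, i \in s' -> B i (X i w)] = (\prod_(i <- s') nu (B i))%E]) ->
  iid P X nu.
Proof.
move=> nu1 mX hX; split=> // s B us mB.
have [s' [us' ss' h]] := hX s.
have mB' i : measurable (if i \in s then B i else setT) by case: ifP.
have <- : P [set w | forall i, i \in s' -> (if i \in s then B i else setT) (X i w)] =
    P [set w | forall i, i \in s -> B i (X i w)].
  congr (P _); apply/seteqP; split => w /= k i iS.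
    by have := k i (ss' _ iS); rewrite iS.
  by case: ifP => // /k.
rewrite (h (fun i => if i \in s then B i else setT))// (bigID (mem s))/= [X in (_ * X)%E]big1 ?mule1; last first.
  by move=> i /negPf ->.
rewrite -big_filter; have ps : perm_eq [seq i <- s' | i \in s] s.
  apply: uniq_perm; rewrite ?filter_uniq// => i; rewrite mem_filter.
  by case: (boolP (i \in s)) => //= /ss' ->.
rewrite (perm_big s ps)/=; apply: eq_big_seq => i ->//.
Qed.

End iid.

(** * Gaussian series *)

Section measurable_lim.
Context {R : realType} {d : measure_display} {T : measurableType d}.
Implicit Types h : nat -> T -> R.

(** Cauchy's criterion with quantifiers over [nat] only, so that a set of convergence is a countable
    combination of measurable sets. *)
Lemma cvgn_cauchyE (u : nat -> R) : cvgn u <->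
  forall i, exists m, forall n, `|u (m + n)%N - u m| < i.+1%:R^-1.
Proof.
split.
  move=> /cvg_cauchy/cauchyP h i.
  have [x /= [m _ hm]] := h (i.+1%:R^-1 / 2) ltac:(by rewrite divr_gt0).
  exists m => n; have h1 := hm (m + n)%N (leq_addr _ _); have h2 := hm m (leqnn _).
  move: h1 h2; rewrite /ball/= => h1 h2.
  rewrite (splitr i.+1%:R^-1); apply: le_lt_trans (ler_distD x _ _) _.
  by rewrite ltrD// distrC.
move=> h; apply/cauchy_cvgP/cauchy_exP => e e0.
have [i _ ie] : exists2 i : nat, True & i.+1%:R^-1 < e.
  exists (Num.truncn e^-1) => //; rewrite -[e in _ < e]invrK ltf_pV2 ?posrE ?invr_gt0//.
  exact: truncnS_gt.
have [m hm] := h i; exists (u m), m => //= n /= mn; rewrite /ball/=.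
by rewrite -(subnKC mn) distrC; exact: lt_trans (hm _) ie.
Qed.

Lemma measurable_cvgn h : (forall n, measurable_fun setT (h n)) ->
  measurable [set t | cvgn (h^~ t)].
Proof.
move=> mh.
have -> : [set t | cvgn (h^~ t)] = \bigcap_i \bigcup_m \bigcap_n
    [set t | `|h (m + n)%N t - h m t| < i.+1%:R^-1].
  apply/seteqP; split => t /=.
    by move/cvgn_cauchyE => k i _; have [m hm] := k i; exists m => // n _; exact: hm.
  move=> k; apply/cvgn_cauchyE => i; have [m _ hm] := k i I.
  by exists m => n; exact: hm.
apply: bigcap_measurable => // i _; apply: bigcup_measurable => m _.
apply: bigcap_measurable => // n _; apply: measurable_ltr_set => //.
by apply: measurableT_comp => //; exact: measurable_funB.
Qed.

(** At points of divergence [limn] is the default value [0], so it is everywhere the limit of the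
    [h n] cut off to the measurable set of convergence. *)
Lemma measurable_limn h : (forall n, measurable_fun setT (h n)) ->
  measurable_fun setT (fun t => limn (h^~ t)).
Proof.
move=> mh; have mD := measurable_cvgn mh; set D := [set _ | _] in mD.
apply: (@measurable_fun_cvg _ _ _ setT (fun n t => h n t * \1_D t)).
  by move=> n; apply: measurable_funM => //; exact: measurable_indic.
move=> t _; have [Dt|nDt] := pselect (D t).
  rewrite indicE mem_set//= (_ : (fun n => _) = h^~ t) //.
  by apply/funext => n; rewrite mulr1.
rewrite indicE memNset//= (_ : (fun n => _) = cst 0).
  by rewrite (dvgP nDt); exact: cvg_cst.
by apply/funext => n; rewrite mulr0.
Qed.

End measurable_lim.

(** * Gaussian integrals of [expR] of a negative square *)

Section gaussian_integral.
Context {R : realType}.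
Implicit Types (m s a y l : R).
Local Notation mu := (@lebesgue_measure R).

(** The change of variables goes through the Radon-Nikodym derivative, which agrees almost
    everywhere with [normal_pdf] because both have the same integrals over measurable sets. *)
Lemma ge0_integral_normal_prob m s (f : R -> \bar R) :
  measurable_fun [set: R] f -> (forall x, 0 <= f x)%E ->
  (\int[normal_prob m s]_x f x = \int[mu]_x (f x * (normal_pdf m s x)%:E))%E.
Proof.
move=> mf f0.
rewrite -(Radon_Nikodym_SigmaFinite.change_of_variables (normal_prob_dominates m s))//.
have dom := normal_prob_dominates m s.
have mpdf : measurable_fun [set: R] (fun x => (normal_pdf m s x)%:E).
  by apply/measurable_EFinP; exact: measurable_normal_pdf.
have mRN := measurable_int _ (Radon_Nikodym_SigmaFinite.f_integrable dom).
apply: ae_eq_integral => //; try exact: emeasurable_funM.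
apply: ae_eqe_mul2l; apply: integral_ae_eq => //.
  exact: Radon_Nikodym_SigmaFinite.f_integrable.
by move=> E _ mE; rewrite -Radon_Nikodym_SigmaFinite.f_integral.
Qed.

Lemma measurable_gexp l : measurable_fun [set: R] (fun x => expR (- (l * x ^+ 2))).
Proof.
apply: measurableT_comp => //; apply: measurable_funN.
by apply: measurable_funM => //; exact: measurable_funX.
Qed.

Let complete_square l s a y (x : R) : s != 0 ->
  let D := 1 + 2 * l * s ^+ 2 * a ^+ 2 in D != 0 ->
  - (l * (a * x + y) ^+ 2) + - x ^+ 2 / (s ^+ 2 *+ 2) =
  - (l * (D^-1 * y ^+ 2)) +
    - (x - - (2 * l * a * y * s ^+ 2 / D)) ^+ 2 / (s ^+ 2 / D *+ 2).
Proof. by move=> s0 D D0; rewrite /D; field; rewrite s0 andbT. Qed.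

(** Completing the square leaves a constant times the normal density of variance [s ^+ 2 / D]. The
    result has the same shape in [y], with [l / D] in place of [l], which lets one integrate out the
    variables of a sum one by one. *)
Lemma integral_gexp_normal l s a y : s != 0 -> 0 <= l ->
  (\int[normal_prob 0 s]_x (expR (- (l * (a * x + y) ^+ 2)))%:E =
  ((Num.sqrt (1 + 2 * l * s ^+ 2 * a ^+ 2))^-1 *
    expR (- (l / (1 + 2 * l * s ^+ 2 * a ^+ 2) * y ^+ 2)))%:E)%E.
Proof.
move=> s0 l0; set D := 1 + _.
have D1 : 1 <= D.
  rewrite lerDl; apply: mulr_ge0; last exact: sqr_ge0.
  by apply: mulr_ge0; [exact: mulr_ge0|exact: sqr_ge0].
have D0 : 0 < D by exact: lt_le_trans D1.
have sD0 : 0 < Num.sqrt D by rewrite sqrtr_gt0.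
have mg : measurable_fun [set: R] (fun x => expR (- (l * (a * x + y) ^+ 2))).
  apply: (measurableT_comp (measurable_gexp l)).
  by apply: measurable_funD => //; exact: measurable_funM.
have mg' : measurable_fun [set: R] (fun x => (expR (- (l * (a * x + y) ^+ 2)))%:E).
  exact/measurable_EFinP.
rewrite ge0_integral_normal_prob//.
set C := _ * expR _.
pose s' := s / Num.sqrt D; pose m' := - (2 * l * a * y * s ^+ 2 / D).
have s'0 : s' != 0 by rewrite mulf_neq0// invr_eq0 gt_eqF.
have s'2 : s' ^+ 2 = s ^+ 2 / D by rewrite exprMn exprVn sqr_sqrtr// ltW.
transitivity (\int[mu]_x (C%:E * (normal_pdf m' s' x)%:E))%E; last first.
  rewrite ge0_integralZl//.
  - by rewrite integral_normal_pdf mule1.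
  - by apply/measurable_EFinP; exact: measurable_normal_pdf.
  - by move=> x _; rewrite lee_fin normal_pdf_ge0.
  - by rewrite lee_fin mulr_ge0 ?expR_ge0// invr_ge0 ltW.
apply: eq_integral => x _; rewrite -!EFinM; congr EFin.
rewrite !normal_pdfE//.
have -> : normal_peak s = (Num.sqrt D)^-1 * normal_peak s'.
  rewrite /normal_peak -invfM -sqrtrM ?(ltW D0)// s'2; congr (Num.sqrt _)^-1.
  by field; rewrite gt_eqF.
rewrite /normal_fun /C -!mulrA; rewrite mulrCA; congr (_ * _).
rewrite !(mulrCA _ (normal_peak s')); congr (_ * _).
rewrite -!expRD; congr expR; rewrite s'2 /m' subr0.
exact: complete_square (lt0r_neq0 D0).
Qed.

End gaussian_integral.

Section fatou_bound.
Context {R : realType} {d : measure_display} {T : measurableType d}.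
Local Open Scope ereal_scope.

Lemma fatou_le (mu : {measure set T -> \bar R}) (f_ : nat -> T -> \bar R)
    (f : T -> \bar R) (C : \bar R) :
  (forall n, measurable_fun [set: T] (f_ n)) -> (forall n x, 0 <= f_ n x) ->
  (forall x, f_ n x @[n --> \oo] --> f x) ->
  (forall n, \int[mu]_x f_ n x <= C) -> \int[mu]_x f x <= C.
Proof.
move=> mf f0 ff fC.
have -> : \int[mu]_x f x = \int[mu]_x limn_einf (f_ ^~ x).
  by apply: eq_integral => x _; rewrite (cvg_limn_einf_sup (ff x)).1.
apply: (le_trans (fatou mu measurableT mf (fun n x _ => f0 n x))).
rewrite limn_einf_lim; apply: lime_le; first exact: is_cvg_einfs.
by apply: nearW => n; apply: le_trans (fC n); apply: ereal_inf_lbound; exists n => //=.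
Qed.

End fatou_bound.

Lemma integral_cst_prob {R : realType} {d : measure_display} {T : measurableType d}
  (P : probability T R) (r : \bar R) : (\int[P]__ r = r)%E.
Proof.
rewrite integral_cst//; transitivity (r * 1)%E; last by rewrite mule1.
by congr (_ * _)%E; exact: probability_setT.
Qed.

Section iid_split.
Context {R : realType} {d : measure_display} {T : measurableType d}.
Variable P : probability T R.

(** [h] distributes the indices over two independent copies of the sample space; the law is
    unchanged, and on [P \x P] Fubini conditions on one group of variables. *)
Lemma iid_split (I : eqType) (X : I -> T -> R) nu (h : I -> (I + I)%type)
    (g : seqspace R I -> \bar R) : injective h -> iid P X nu ->
  measurable_fun [set: seqspace R I] g -> (forall z, 0 <= g z)%E ->
  (\int[P]_w g (X^~ w) = \int[P \x P]_w g (fun i => glue X X (h i) w))%E.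
Proof.
move=> hI hX mg g0; apply: (iid_integral hX _ mg g0).
exact: (iid_comp hI (iid_glue hX hX)).
Qed.

Lemma iid_normal_integral (I : eqType) (X : I -> T -> R) (m s : R)
    (i : I) (f : R -> \bar R) : iid P X (normal_prob m s) ->
  measurable_fun [set: R] f -> (forall x, 0 <= f x)%E ->
  (\int[P]_w f (X i w) = \int[normal_prob m s]_x f x)%E.
Proof.
move=> hX mf f0.
have mXi : measurable_fun setT (X i : T -> g_sigma_algebraType R.-ocitv.-measurable).
  exact: hX.1.
rewrite -(ge0_integral_law P mXi)//.
apply: eq_measure_integral => A mA _.
exact: (iid_marginal i hX).
Qed.

End iid_split.

(** Peels off index [0]: it is read on the first copy, and every later index, shifted down by one,
    on the second. *)
Definition shift_index (n : nat) : nat + nat :=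
  if n is m.+1 then inr m else inl 0.

Lemma shift_index_inj : injective shift_index.
Proof. by move=> [|m] [|n] // [->]. Qed.

Section gaussian_series.
Context {R : realType}.
Implicit Types (a z : nat -> R) (l y : R).

Definition psum a (n : nat) z : R := \sum_(k < n) a k * z k.

Lemma psumS a n z :
  psum a n.+1 z = a 0%N * z 0%N + psum (a \o S) n (z \o S).
Proof. by rewrite /psum big_ord_recl. Qed.

Lemma measurable_psum d (T : measurableType d) a n (Z : nat -> T -> R) :
  (forall k, measurable_fun setT (Z k)) ->
  measurable_fun setT (fun t => psum a n (Z^~ t)).
Proof.
move=> mZ; apply: measurable_sum => k; exact: measurable_funM.
Qed.

Definition sumsq a n : R := \sum_(k < n) a k ^+ 2.

Lemma sumsq_ge0 a n : 0 <= sumsq a n.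
Proof. by apply: sumr_ge0 => k _; exact: sqr_ge0. Qed.

Lemma sumsqS a n : sumsq a n.+1 = a 0%N ^+ 2 + sumsq (a \o S) n.
Proof. by rewrite /sumsq big_ord_recl. Qed.

Lemma sumsqD a m n : sumsq a (m + n) = sumsq a m + sumsq (fun k => a (m + k)%N) n.
Proof. by rewrite /sumsq big_split_ord. Qed.

Context {d : measure_display} {T : measurableType d}.
Variables (P : probability T R) (X : nat -> T -> R) (s : R).
Hypotheses (s0 : s != 0) (hX : iid P X (normal_prob 0 s)).

Let mX k : measurable_fun setT (X k). Proof. exact: hX.1. Qed.

Let mpsumX a n : measurable_fun setT (fun w => psum a n (X^~ w)).
Proof. exact: measurable_psum. Qed.

Lemma measurable_seq_psum a n :
  measurable_fun [set: seqspace R nat] (fun z : seqspace R nat => psum a n z).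
Proof. exact: (measurable_psum a n (fun k => measurable_seq_coord k)). Qed.

(** Integrating out the first variable leaves the factor [(Num.sqrt D)^-1] and replaces [l] by
    [l / D], whence the induction over all [l] and [a]. This is the Laplace transform of the square
    of a centred normal variable of variance [s ^+ 2 * sumsq a n], reached without identifying the
    law of the sum. *)
Lemma expectation_gexp_psum n a l : 0 <= l ->
  (\int[P]_w (expR (- (l * psum a n (X^~ w) ^+ 2)))%:E =
   ((Num.sqrt (1 + 2 * l * s ^+ 2 * sumsq a n))^-1)%:E)%E.
Proof.
elim: n a l => [|n ih] a l l0.
  rewrite /sumsq big_ord0 mulr0 addr0 sqrtr1 invr1.
  under eq_integral do rewrite /psum big_ord0 expr0n mulr0 oppr0 expR0.
  exact: integral_cst_prob.
pose g (z : seqspace R nat) : \bar R := (expR (- (l * psum a n.+1 z ^+ 2)))%:E.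
have mg : measurable_fun [set: seqspace R nat] g.
  apply/measurable_EFinP/(measurableT_comp (measurable_gexp l)).
  exact: measurable_seq_psum.
have g0 z : (0 <= g z)%E by rewrite lee_fin expR_ge0.
rewrite -[LHS]/(\int[P]_w g (X^~ w))%E (iid_split shift_index_inj hX mg g0).
pose D := 1 + 2 * l * s ^+ 2 * a 0%N ^+ 2.
have D0 : 0 < D.
  rewrite ltr_pwDl//; apply: mulr_ge0; last exact: sqr_ge0.
  by apply: mulr_ge0; [exact: mulr_ge0|exact: sqr_ge0].
have mglue : measurable_fun setT
    (fun w : T * T => g (fun i => glue X X (shift_index i) w)).
  apply: (measurableT_comp mg); apply: measurable_seq_map => -[|i] /=.
    by apply: measurableT_comp => //; exact: measurable_fst.
  by apply: measurableT_comp => //; exact: measurable_snd.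
rewrite fubini_tonelli2//=.
rewrite /fubini_G.
transitivity (\int[P]_w (((Num.sqrt D)^-1)%:E *
    (expR (- (l / D * psum (a \o S) n (X^~ w) ^+ 2)))%:E))%E.
  apply: eq_integral => w2 _.
  rewrite -EFinM -(integral_gexp_normal (a 0%N) _ s0 l0).
  rewrite -(iid_normal_integral 0%N hX).
  - by apply: eq_integral => w1 _; rewrite /g psumS.
  - apply/measurable_EFinP/(measurableT_comp (measurable_gexp l)).
    by apply: measurable_funD => //; exact: measurable_funM.
  - by move=> x; rewrite lee_fin expR_ge0.
rewrite ge0_integralZl//; last first.
  exact/measurable_EFinP/(measurableT_comp (measurable_gexp _)).
rewrite ih ?divr_ge0 ?(ltW D0)// -EFinM -invfM -sqrtrM ?(ltW D0)//.
congr (Num.sqrt _)^-1%:E; rewrite sumsqS mulrDr mulr1 /D.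
by field; rewrite -/D gt_eqF.
Qed.

Lemma second_moment_psum a n :
  (\int[P]_w (psum a n (X^~ w) ^+ 2)%:E <= (2 * s ^+ 2 * sumsq a n)%:E)%E.
Proof.
(* Integrate [min(x, M) <= 2 M (1 - exp(- x / M))] at the square of the sum and
   let [M] tend to infinity. *)
have mS := mpsumX a n.
apply: (@fatou_le _ _ _ P (fun m w => (Num.min (psum a n (X^~ w) ^+ 2) m.+1%:R)%:E)).
- move=> m; apply/measurable_EFinP; apply: measurable_minr => //.
  exact: measurable_funX.
- by move=> m w; rewrite lee_fin le_min sqr_ge0 ler0n.
- move=> w; apply: cvg_near_cst; near=> m; congr EFin; apply/min_idPl.
  apply: ltW; apply: lt_le_trans (truncnS_gt _) _; rewrite ler_nat ltnS.
  by near: m; exact: nbhs_infty_ge.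
move=> m; set t := s ^+ 2 * sumsq a n.
have t0 : 0 <= t by rewrite mulr_ge0 ?sqr_ge0 ?sumsq_ge0.
set I := (\int[P]_w _)%E; pose M : R := m.+1%:R.
have M0 : 0 < M by rewrite ltr0n.
have mg : measurable_fun setT (fun w => expR (- (M^-1 * psum a n (X^~ w) ^+ 2))).
  exact: (measurableT_comp (measurable_gexp _)).
have h : (I + (2 * M / Num.sqrt (1 + 2 * (t / M)))%:E <= (2 * M)%:E)%E.
  have -> : (2 * M / Num.sqrt (1 + 2 * (t / M)))%:E =
      ((2 * M)%:E * \int[P]_w (expR (- (M^-1 * psum a n (X^~ w) ^+ 2)))%:E)%E.
    rewrite expectation_gexp_psum ?invr_ge0 ?(ltW M0)// -EFinM /t.
    by congr (_ / Num.sqrt _)%:E; ring.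
  rewrite -ge0_integralZl//; last 2 first.
  - exact/measurable_EFinP.
  - by rewrite lee_fin mulr_ge0// ltW.
  rewrite /I -ge0_integralD//; last 4 first.
  - by move=> w _; rewrite lee_fin le_min sqr_ge0 ler0n.
  - apply/measurable_EFinP; apply: measurable_minr => //; exact: measurable_funX.
  - by move=> w _; rewrite -EFinM lee_fin mulr_ge0 ?expR_ge0// mulr_ge0// ltW.
  - by apply/measurable_EFinP/measurable_funM.
  rewrite -[leRHS](integral_cst_prob P); apply: ge0_le_integral => //.
  - move=> w _; rewrite -EFinM lee_fin addr_ge0//.
      by rewrite le_min sqr_ge0 ler0n.
    by rewrite mulr_ge0 ?expR_ge0// mulr_ge0// ltW.
  - apply/measurable_EFinP/measurable_funD; last exact: measurable_funM.
    by apply: measurable_minr => //; exact: measurable_funX.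
  move=> w _; rewrite -EFinM -EFinD lee_fin -/M.
  set x := psum _ _ _ ^+ 2; have x0 : 0 <= x by exact: sqr_ge0.
  pose u := M^-1 * x; have u0 : 0 <= u by rewrite mulr_ge0// invr_ge0 ltW.
  have -> : x = M * u by rewrite /u mulrA divff ?mul1r ?gt_eqF.
  rewrite -[X in Num.min _ X]mulr1 -minr_pMr ?(ltW M0)// mulrA mulVf ?gt_eqF// mul1r.
  (* Comparing with [(1 + u)^-1] reduces the bound to rational functions. The factor 2 in [e2],
     attained at [u = 1], is why the moment bound is twice the variance. *)
  have e1 : expR (- u) <= (1 + u)^-1.
    by rewrite expRN lef_pV2 ?posrE ?expR_gt0 ?expR_ge1Dx// ltr_wpDr.
  have e2 : Num.min u 1 <= 2 * (1 - (1 + u)^-1).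
    have q0 : 0 < 1 + u by rewrite ltr_wpDr.
    have -> : 1 - (1 + u)^-1 = u / (1 + u) by field; rewrite gt_eqF.
    rewrite mulrA ler_pdivlMr//; case: (lerP u 1) => u1; nra.
  have : M * Num.min u 1 <= M * (2 * (1 - expR (- u))).
    rewrite ler_pM2l//; apply: le_trans e2 _; lra.
  lra.
have h2 : 1 - t / M <= (Num.sqrt (1 + 2 * (t / M)))^-1.
  have u0 : 0 <= t / M by rewrite divr_ge0// ltW.
  move: (t / M) u0 => u u0.
  have q0 : 0 < 1 + u by lra.
  have : Num.sqrt (1 + 2 * u) <= 1 + u.
    rewrite -[leRHS]ger0_norm ?(ltW q0)// -sqrtr_sqr ler_wsqrtr//.
    by rewrite sqrrD; have := sqr_ge0 u; lra.
  rewrite -lef_pV2 ?posrE ?sqrtr_gt0//; last by lra.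
  apply: le_trans; rewrite -(ler_pM2r q0) mulVf ?lt0r_neq0//.
  by rewrite -subr_ge0 (_ : _ - _ = u ^+ 2) ?sqr_ge0//; ring.
have If : I \is a fin_num.
  rewrite ge0_fin_numE; last first.
    by apply: integral_ge0 => w _; rewrite lee_fin le_min sqr_ge0 ler0n.
  apply: le_lt_trans (ltry (2 * M)); apply: le_trans h.
  by rewrite leeDl// lee_fin mulr_ge0 ?invr_ge0 ?sqrtr_ge0// mulr_ge0// ltW.
rewrite -(fineK If) -EFinD !lee_fin in h *.
have : 2 * M * (1 - t / M) <= 2 * M / Num.sqrt (1 + 2 * (t / M)).
  by rewrite ler_pM2l// mulr_gt0.
have -> : 2 * M * (1 - t / M) = 2 * M - 2 * t by field; rewrite gt_eqF.
have -> : 2 * s ^+ 2 * sumsq a n = 2 * t by rewrite /t mulrA.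
lra.
Unshelve. all: by end_near. Qed.

(** Markov's inequality for [expR] of minus the square, which is at least [expR (- M ^+ 2)] on the
    event. For fixed [M] the bound vanishes as the variance grows. *)
Lemma probability_psum_le_small a n (M : R) : 0 <= M ->
  (P [set w | (`|psum a n (X^~ w)| <= M)%R] <=
    (expR (M ^+ 2) / Num.sqrt (1 + 2 * s ^+ 2 * sumsq a n))%:E)%E.
Proof.
move=> M0; set A := [set _ | _].
have mA : measurable A by apply: measurable_ler_set => //; exact: measurableT_comp.
have := expectation_gexp_psum n a ler01; rewrite mulr1 EFinM => <-.
apply: (@le_trans _ _ ((expR (M ^+ 2))%:E * \int[P]_(w in A) (expR (- M ^+ 2))%:E)%E).
  rewrite integral_cst// muleA -EFinM -expRD subrr expR0 mul1e.
  exact: lexx.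
apply: lee_pmul => //.
- by apply: integral_ge0 => w _; rewrite lee_fin expR_ge0.
- apply: (@le_trans _ _ (\int[P]_(w in A) (expR (- (1 * psum a n (X^~ w) ^+ 2)))%:E)%E).
    apply: ge0_le_integral => //.
    + apply/measurable_funTS/measurable_EFinP.
      exact: (measurableT_comp (measurable_gexp 1)).
    + move=> w Aw; rewrite lee_fin ler_expR mul1r lerN2.
      by rewrite -[leLHS]real_normK ?num_real// lerXn2r ?nnegrE.
  apply: ge0_subset_integral => //.
  apply/measurable_EFinP; exact: (measurableT_comp (measurable_gexp 1)).
Qed.

(** A convergent series has bounded partial sums, and the event that all of them stay below [M] is
    contained in events of arbitrarily small probability, because [sumsq a] is unbounded. *)
Lemma psum_diverges a : ~ cvgn (sumsq a) ->
  \forall w \ae P, ~ cvgn (fun n => psum a n (X^~ w)).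
Proof.
move=> dv; pose A (M : nat) := \bigcap_n [set w | `|psum a n (X^~ w)| <= M%:R].
have mA1 (M n : nat) : measurable [set w | `|psum a n (X^~ w)| <= M%:R].
  by apply: measurable_ler_set => //; exact: measurableT_comp.
have mA M : measurable (A M) by exact: bigcap_measurable.
have nd : {homo sumsq a : m n / (m <= n)%N >-> m <= n}.
  by move=> m n /subnKC <-; rewrite sumsqD lerDl sumsq_ge0.
have unb (K : R) : exists n, K < sumsq a n.
  apply: contrapT => h; apply: dv; apply: nondecreasing_is_cvgn => //.
  exists K => _ [n _ <-]; rewrite leNgt; apply/negP => Kn; apply: h.
  by exists n.
have PA M : P (A M) = 0%E.
  apply/eqP; rewrite eq_le measure_ge0 andbT; apply/lee_addgt0Pr => e e0.
  rewrite add0e.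
  (* Solves [expR (M%:R ^+ 2) / Num.sqrt K = e]. *)
  pose K := (expR (M%:R ^+ 2) / e) ^+ 2.
  have [n Kn] := unb (K / (2 * s ^+ 2)).
  have s2 : 0 < 2 * s ^+ 2 by rewrite mulr_gt0// exprn_even_gt0.
  apply: (@le_trans _ _ (P [set w | `|psum a n (X^~ w)| <= M%:R])).
    by apply: le_measure; rewrite ?inE// => w; apply.
  apply: le_trans (probability_psum_le_small a n (ler0n _ M)) _.
  rewrite lee_fin ler_pdivrMr; last first.
    by rewrite sqrtr_gt0 ltr_pwDl// mulr_ge0 ?sumsq_ge0// ltW.
  rewrite mulrC -ler_pdivrMr// -[leLHS]ger0_norm ?divr_ge0 ?expR_ge0 ?(ltW e0)//.
  rewrite -sqrtr_sqr ler_wsqrtr// -/K.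
  move: Kn; rewrite ltr_pdivrMr// mulrC => /ltW h; apply: le_trans h _.
  by rewrite lerDr.
have : P.-negligible (\bigcup_M A M).
  apply: negligible_bigcup => M.
  exists (A M); split; [exact: mA|exact: PA|exact: subset_refl].
apply: negligibleS => w /= /contrapT cw.
have [M [_ hM]] := cvg_seq_bounded cw.
exists (Num.truncn (M + 1)).+1 => // n _ /=.
have /= := hM (M + 1) ltac:(by rewrite ltrDl) n I.
by move/le_trans; apply; rewrite ltW// truncnS_gt.
Qed.

End gaussian_series.

(** * Maximal inequality for partial sums *)

Section maximal_inequality.
Context {R : realType}.
Implicit Types (a z : nat -> R) (c y : R).

Lemma measurable_bool_natr d (T : measurableType d) (B : T -> bool) :
  measurable_fun setT B -> measurable_fun setT (fun t => (B t)%:R : R).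
Proof.
move=> mB; rewrite (_ : (fun t => _) = fun t => if B t then 1 else 0).
  exact: measurable_fun_ifT.
by apply/funext => t; case: (B t).
Qed.

(** Recursive in the first summand, which moves the starting point [y]: this is the shape on which
    [ottaviani] conditions. It is boolean so that probabilities are integrals of [0] or [1]. *)
Fixpoint exceeds c (n : nat) y a z : bool :=
  (c < `|y|) ||
  (if n is n'.+1 then exceeds c n' (y + a 0%N * z 0%N) (a \o S) (z \o S)
   else false).

Lemma exceedsP c n y a z :
  reflect (exists2 k, (k <= n)%N & c < `|y + psum a k z|) (exceeds c n y a z).
Proof.
elim: n y a z => [|n ih] y a z /=.
  rewrite orbF; apply: (iffP idP) => [h|[k]]; last first.
    by rewrite leqn0 => /eqP ->; rewrite /psum big_ord0 addr0.
  by exists 0%N => //; rewrite /psum big_ord0 addr0.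
apply: (iffP orP) => [[h|/ih[k kn]]|[[|k] kn]].
- by exists 0%N => //; rewrite /psum big_ord0 addr0.
- by move=> h; exists k.+1 => //; rewrite psumS addrA.
- by rewrite /psum big_ord0 addr0; left.
- by rewrite psumS addrA => h; right; apply/ih; exists k.
Qed.

Lemma measurable_exceeds d (T : measurableType d) c n (f : T -> R) a
    (Z : nat -> T -> R) : measurable_fun setT f ->
  (forall k, measurable_fun setT (Z k)) ->
  measurable_fun setT (fun t => exceeds c n (f t) a (Z^~ t)).
Proof.
move=> mf mZ; elim: n f a Z mf mZ => [|n ih] f a Z mf mZ /=.
  apply: measurable_or => //; apply: measurable_fun_ltr => //.
  exact: measurableT_comp.
apply: measurable_or.
  by apply: measurable_fun_ltr => //; exact: measurableT_comp.
apply: (ih (fun t => f t + a 0%N * Z 0%N t) (a \o S) (Z \o S)).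
  by apply: measurable_funD => //; exact: measurable_funM.
by move=> k; exact: mZ.
Qed.

Context {d : measure_display} {T : measurableType d}.
Variables (P : probability T R) (X : nat -> T -> R) (s : R).
Hypotheses (s0 : s != 0) (hX : iid P X (normal_prob 0 s)).

Let mX k : measurable_fun setT (X k). Proof. exact: hX.1. Qed.

Let mpsumX a n : measurable_fun setT (fun w => psum a n (X^~ w)).
Proof. exact: measurable_psum. Qed.

Let mgt d' (T' : measurableType d') (f : T' -> R) c : measurable_fun setT f ->
  measurable_fun setT (fun w => ((c < `|f w|)%R%:R : R)).
Proof.
move=> mf; apply: measurable_bool_natr; apply: measurable_fun_ltr => //.
exact: measurableT_comp.
Qed.

Lemma chebyshev_psum a n c : 0 < c ->
  (\int[P]_w ((c < `|psum a n (X^~ w)|)%R%:R)%:E <=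
   (2 * s ^+ 2 * sumsq a n / c ^+ 2)%:E)%E.
Proof.
move=> c0; have c2 : 0 <= (c ^+ 2)^-1 by rewrite invr_ge0 sqr_ge0.
have mS : measurable_fun setT (fun w => (psum a n (X^~ w) ^+ 2)%:E).
  by apply/measurable_EFinP/measurable_funX.
apply: (@le_trans _ _ ((c ^+ 2)^-1%:E * \int[P]_w (psum a n (X^~ w) ^+ 2)%:E)%E); last first.
  by rewrite mulrC EFinM lee_wpmul2l ?lee_fin// (second_moment_psum s0 hX).
rewrite -ge0_integralZl//; last by move=> w _; rewrite lee_fin sqr_ge0.
apply: ge0_le_integral => //.
- by apply/measurable_EFinP; exact: mgt.
- exact: emeasurable_funM.
move=> w _; rewrite -EFinM lee_fin; case: ltP => [cw|_] /=; last first.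
  by rewrite mulr_ge0 ?sqr_ge0.
rewrite mulrC ler_pdivlMr ?exprn_gt0// mul1r -[leRHS]real_normK ?num_real//.
by rewrite lerXn2r ?nnegrE ?normr_ge0 ?(ltW c0) ?(ltW cw).
Qed.

(* Ottaviani's inequality; conditioning on the first summand turns the usual
   stopping-time argument into an induction on [n]. *)
Lemma ottaviani n y a c : 0 < c -> 2 * s ^+ 2 * sumsq a n / c ^+ 2 <= 2^-1 ->
  (\int[P]_w ((exceeds (2 * c) n y a (X^~ w))%:R)%:E <=
   2%:E * \int[P]_w ((c < `|y + psum a n (X^~ w)|)%R%:R)%:E)%E.
Proof.
move=> c0; elim: n y a => [|n ih] y a hv.
  rewrite -ge0_integralZl//; last first.
    by apply/measurable_EFinP; apply: mgt; exact: measurable_funD.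
  apply: ge0_le_integral => //.
  - apply/measurable_EFinP; apply: measurable_bool_natr.
    exact: measurable_exceeds.
  - apply/measurable_EFinP/measurable_funM => //.
    by apply: mgt; exact: measurable_funD.
  move=> w _; rewrite -EFinM lee_fin /= orbF /psum big_ord0 addr0.
  have [h|_] := ltP (2 * c) `|y|; last by rewrite mulr_ge0.
  by rewrite (_ : c < `|y|) ?mulr1 ?ler1n//; lra.
(* A walk that starts beyond [2 * c] ends within [c] only if the whole sum exceeds [c], which has
   probability at most one half by Chebyshev; so the right-hand side is at least [1]. *)
have [hy|hy] := ltP (2 * c) `|y|.
  apply: (@le_trans _ _ 1%E).
    rewrite -[leRHS](integral_cst_prob P); apply: ge0_le_integral => //.
    - apply/measurable_EFinP; apply: measurable_bool_natr.
      exact: measurable_exceeds.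
    - by move=> w _; rewrite lee_fin lern1 leq_b1.
  have cheb := chebyshev_psum a n.+1 c0.
  set J := (\int[P]_w _)%E; set I := (\int[P]_w _)%E in cheb.
  have h : (1 <= J + I)%E.
    rewrite /J /I -ge0_integralD//; last 2 first.
    - by apply/measurable_EFinP; apply: mgt; exact: measurable_funD.
    - by apply/measurable_EFinP; exact: mgt.
    rewrite -[leLHS](integral_cst_prob P); apply: ge0_le_integral => //.
    - apply/measurable_EFinP/measurable_funD; last exact: mgt.
      by apply: mgt; exact: measurable_funD.
    move=> w _; rewrite -EFinD lee_fin.
    have [h1|h1] := ltP c `|y + psum a n.+1 (X^~ w)|; first by rewrite lerDl.
    have [h2|h2] := ltP c `|psum a n.+1 (X^~ w)|; first by rewrite lerDr.
    exfalso; have := ler_normB (y + psum a n.+1 (X^~ w)) (psum a n.+1 (X^~ w)).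
    rewrite addrK; lra.
  have {}cheb : (I <= (2^-1)%:E)%E by apply: le_trans cheb _; rewrite lee_fin.
  have J0 : (0 <= J)%E by apply: integral_ge0 => w _; rewrite lee_fin.
  have I0 : (0 <= I)%E by apply: integral_ge0 => w _; rewrite lee_fin.
  case: J J0 h => [j| |] // _ h; last by rewrite gt0_muley ?leey ?lte_fin.
  move: I I0 cheb h => [i| |] // _; rewrite -EFinM !lee_fin; lra.
pose g (z : seqspace R nat) : \bar R := ((exceeds (2 * c) n.+1 y a z)%:R)%:E.
have mg : measurable_fun [set: seqspace R nat] g.
  apply/measurable_EFinP; apply: measurable_bool_natr.
  by apply: measurable_exceeds => // k; exact: measurable_seq_coord.
have g0 z : (0 <= g z)%E by rewrite lee_fin.
pose f (z : seqspace R nat) : \bar R := ((c < `|y + psum a n.+1 z|)%R%:R)%:E.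
have mf : measurable_fun [set: seqspace R nat] f.
  apply/measurable_EFinP; apply: mgt; apply: measurable_funD => //.
  exact: measurable_seq_psum.
have f0 z : (0 <= f z)%E by rewrite lee_fin.
have mZ : measurable_fun setT
    ((fun w i => glue X X (shift_index i) w) : T * T -> seqspace R nat).
  apply: measurable_seq_map => -[|i] /=.
    by apply: measurableT_comp => //; exact: measurable_fst.
  by apply: measurableT_comp => //; exact: measurable_snd.
rewrite -[(\int[P]_w ((exceeds _ _ _ _ _)%:R)%:E)%E]/(\int[P]_w g (X^~ w))%E.
rewrite -[(\int[P]_w ((_ < _)%R%:R)%:E)%E]/(\int[P]_w f (X^~ w))%E.
rewrite !(iid_split shift_index_inj hX)//.
have mgZ := measurableT_comp mg mZ.
have mfZ := measurableT_comp mf mZ.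
rewrite !fubini_tonelli1//=.
rewrite -ge0_integralZl//; last first.
- by move=> w _; apply: integral_ge0 => v _; exact: f0.
- by apply: measurable_fun_fubini_tonelli_F.
apply: ge0_le_integral => //.
- by move=> w _; apply: integral_ge0 => v _; exact: g0.
- by apply: measurable_fun_fubini_tonelli_F.
- apply: emeasurable_funM => //.
  by apply: measurable_fun_fubini_tonelli_F.
move=> w _; rewrite /fubini_F.
have -> : (\int[P]_v g (fun i => glue X X (shift_index i) (w, v)) =
    \int[P]_v ((exceeds (2 * c) n (y + a 0%N * X 0%N w) (a \o S) (X^~ v))%:R)%:E)%E.
  by apply: eq_integral => v _; rewrite /g /= ltNge hy.
have -> : (\int[P]_v f (fun i => glue X X (shift_index i) (w, v)) =
    \int[P]_v ((c < `|y + a 0%N * X 0%N w + psum (a \o S) n (X^~ v)|)%R%:R)%:E)%E.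
  by apply: eq_integral => v _; rewrite /f psumS addrA.
apply: ih; apply: le_trans hv.
rewrite ler_pM2r ?invr_gt0 ?exprn_gt0// ler_pM2l; last first.
  by rewrite mulr_gt0// exprn_even_gt0.
by rewrite sumsqS lerDr sqr_ge0.
Qed.

End maximal_inequality.

Section gaussian_series_limit.
Context {R : realType}.

Lemma psum_shift (a z : nat -> R) m n :
  psum a (m + n) z - psum a m z =
  psum (fun k => a (m + k)%N) n (fun k => z (m + k)%N).
Proof. by rewrite /psum big_split_ord/= [X in X - _]addrC addrK. Qed.

Context {d : measure_display} {T : measurableType d}.
Variables (P : probability T R) (s : R).
Hypothesis (s0 : s != 0).

Lemma integral_bool (B : T -> bool) : measurable_fun setT B ->
  (\int[P]_w ((B w)%:R)%:E = P [set w | B w])%E.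
Proof.
move=> mB; have mA : measurable [set w | B w].
  by rewrite -[X in measurable X]setTI; exact: (mB measurableT [set true]).
rewrite -[in RHS](setIT [set w | B w]) -integral_indic//.
apply: eq_integral => w _; rewrite indicE; congr ((nat_of_bool _)%:R%:E).
by apply/idP/idP; rewrite inE.
Qed.

(** Continuity from below in the horizon [n]. The constant is the factor 2 of [ottaviani] times the
    factor 2 of [chebyshev_psum]. *)
Lemma probability_psum_sup (X : nat -> T -> R) a c V :
  iid P X (normal_prob 0 s) -> 0 < c ->
  (forall n, sumsq a n <= V) -> 2 * s ^+ 2 * V / c ^+ 2 <= 2^-1 ->
  (P [set w | exists n, (2 * c < `|psum a n (X^~ w)|)%R] <=
   (4 * s ^+ 2 * V / c ^+ 2)%:E)%E.
Proof.
move=> hX c0 hV hc; have mX := hX.1.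
pose A n := [set w | exceeds (2 * c) n 0 a (X^~ w)].
have mE n : measurable_fun setT (fun w => exceeds (2 * c) n 0 a (X^~ w)).
  exact: measurable_exceeds.
have mA n : measurable (A n).
  by rewrite -[X in measurable X]setTI; exact: (mE n measurableT [set true]).
have -> : [set w | exists n, (2 * c < `|psum a n (X^~ w)|)%R] = \bigcup_n A n.
  apply/seteqP; split => w /=.
    by move=> [n hn]; exists n => //; apply/exceedsP; exists n; rewrite ?add0r.
  by move=> [n _ /exceedsP[k _ hk]]; exists k; rewrite -[psum _ _ _]add0r.
have ndA : {homo A : m n / (m <= n)%N >-> (m <= n)%O}.
  move=> m n mn; apply/subsetPset => w /exceedsP[k km hk]; apply/exceedsP.
  by exists k => //; exact: leq_trans mn.
have cvgA := nondecreasing_cvg_mu (mu := P) mA (bigcup_measurable (fun k _ => mA k)) ndA.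
rewrite -(cvg_lim _ cvgA)//; apply: lime_le; first by apply/cvg_ex; eexists; exact: cvgA.
apply: nearW => n /=; rewrite -integral_bool//.
have s2 : 0 < 2 * s ^+ 2 by rewrite mulr_gt0// exprn_even_gt0.
have c2 : 0 < c ^+ 2 by rewrite exprn_gt0.
have hvn : 2 * s ^+ 2 * sumsq a n / c ^+ 2 <= 2 * s ^+ 2 * V / c ^+ 2.
  by rewrite ler_pM2r ?invr_gt0// ler_pM2l.
apply: le_trans (ottaviani s0 hX 0 c0 (le_trans hvn hc)) _.
apply: (@le_trans _ _ (2%:E * (2 * s ^+ 2 * sumsq a n / c ^+ 2)%:E)%E).
  apply: lee_pmul => //; first by apply: integral_ge0 => w _; rewrite lee_fin.
  by under eq_integral do rewrite add0r; exact: chebyshev_psum.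
rewrite -EFinM lee_fin.
have -> : 4 * s ^+ 2 * V / c ^+ 2 = 2 * (2 * s ^+ 2 * V / c ^+ 2) by ring.
by rewrite ler_pM2l.
Qed.

(** The maximal inequality, applied to the sums that start at [m], makes a fixed oscillation after
    [m] unlikely once the tail of [sumsq a] is small. Hence the Cauchy criterion fails only on a
    null set. *)
Lemma psum_converges (X : nat -> T -> R) a : iid P X (normal_prob 0 s) ->
  cvgn (sumsq a) -> \forall w \ae P, cvgn (fun n => psum a n (X^~ w)).
Proof.
move=> hX cv; have mX := hX.1.
pose E (i m : nat) := [set w | exists n,
  (2 * (4 * i.+1%:R)^-1 < `|psum (fun k => a (m + k)%N) n (fun k => X (m + k)%N w)|)%R].
have mE i m : measurable (E i m).
  have -> : E i m = \bigcup_n [set w | (2 * (4 * i.+1%:R)^-1 <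
      `|psum (fun k => a (m + k)%N) n (fun k => X (m + k)%N w)|)%R].
    by apply/seteqP; split => w /= [n]; [exists n|move=> _; exists n].
  apply: bigcup_measurable => n _; apply: measurable_ltr_set => //.
  by apply: measurableT_comp => //; exact: (measurable_psum _ _ (fun k => mX (m + k)%N)).
have PE i : P (\bigcap_m E i m) = 0%E.
  apply/eqP; rewrite eq_le measure_ge0 andbT; apply/lee_addgt0Pr => e e0; rewrite add0e.
  (* The threshold [2 * c] of the maximal inequality is half of the [i.+1%:R^-1] of the Cauchy
     criterion, which leaves room for a strict inequality. *)
  pose c : R := (4 * i.+1%:R)^-1.
  have c0 : 0 < c by rewrite invr_gt0 mulr_gt0.
  have s2 : 0 < 4 * s ^+ 2 by rewrite mulr_gt0// exprn_even_gt0.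
  have c2 : 0 < c ^+ 2 by rewrite exprn_gt0.
  (* The cap guarantees the smallness condition of the maximal inequality; [V] is then solved from
     [4 * s ^+ 2 * V / c ^+ 2 = e']. *)
  pose e' := Num.min e 2^-1.
  have e'0 : 0 < e' by rewrite lt_min e0 invr_gt0 ltr0n.
  pose V := e' * c ^+ 2 / (4 * s ^+ 2).
  have V0 : 0 < V by rewrite divr_gt0// mulr_gt0.
  have VE : 4 * s ^+ 2 * V / c ^+ 2 = e'.
    by rewrite /V; field; rewrite s0 lt0r_neq0.
  have [m _ hm] : exists2 m, True & forall n, sumsq (fun k => a (m + k)%N) n <= V.
    have nd : {homo sumsq a : m n / (m <= n)%N >-> m <= n}.
      by move=> ? n /subnKC <-; rewrite sumsqD lerDl sumsq_ge0.
    have /cvgrPdist_lt /(_ V V0)[m _ hm] : sumsq a @ \oo --> limn (sumsq a) by [].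
    exists m => // n; have := hm m (leqnn _).
    have := nondecreasing_cvgn_le nd cv (m + n)%N; rewrite sumsqD.
    by move=> h1 /ltW /(le_trans (ler_norm _)) h2; lra.
  apply: (@le_trans _ _ (P (E i m))).
    apply: le_measure; rewrite ?inE//; last by move=> w; exact.
    by apply: bigcap_measurable => // k _.
  have hXm : iid P (fun k => X (m + k)%N) (normal_prob 0 s).
    by apply: (iid_comp _ hX); exact: addnI.
  apply: le_trans (probability_psum_sup hXm c0 hm _) _.
    have -> : 2 * s ^+ 2 * V / c ^+ 2 = e' / 2 by rewrite -VE; field; rewrite lt0r_neq0.
    by have : e' <= 2^-1 by [rewrite ge_min lexx orbT]; have := e'0; lra.
  by rewrite VE lee_fin ge_min lexx.
have : P.-negligible (\bigcup_i \bigcap_m E i m).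
  apply: negligible_bigcup => i; exists (\bigcap_m E i m); split => //.
    exact: bigcap_measurable.
  exact: PE.
apply: negligibleS => w /= ncv; apply: contrapT => nE; apply: ncv.
apply/cvgn_cauchyE => i; apply: contrapT => h; apply: nE.
exists i => // m _ /=; apply: contrapT => h'; apply: h; exists m => n.
rewrite psum_shift ltNge; apply/negP => h''; apply: h'; exists n.
apply: lt_le_trans h''; rewrite invfM mulrA -[ltRHS]mul1r.
by rewrite ltr_pM2r ?invr_gt0 ?ltr0n//; lra.
Qed.

(** Fatou's lemma passes the uniform second moment bound to the limit, and [x <= 1 + x ^+ 2] gives
    the first moment. *)
Lemma first_moment_limn_psum (X : nat -> T -> R) a : iid P X (normal_prob 0 s) ->
  cvgn (sumsq a) ->
  (\int[P]_w (`|limn (fun n => psum a n (X^~ w))|)%:E < +oo)%E.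
Proof.
move=> hX cv; have mX := hX.1.
have mS n : measurable_fun setT (fun w => psum a n (X^~ w)) by exact: measurable_psum.
have mL : measurable_fun setT (fun w => limn (fun n => psum a n (X^~ w))).
  exact: (measurable_limn mS).
have mD := measurable_cvgn mS; set D := [set _ | _] in mD.
have [V hV] : exists V, forall n, sumsq a n <= V.
  have [M [_ hM]] := cvg_seq_bounded cv; exists (M + 1) => n.
  by apply: le_trans (ler_norm _) _; apply: (hM (M + 1)); rewrite ?ltrDl.
have hL2 : (\int[P]_w (limn (fun n => psum a n (X^~ w)) ^+ 2)%:E <= (2 * s ^+ 2 * V)%:E)%E.
  (* With the indicator of [D] the squares converge at every point, to [0] off [D] in agreement with
     the default value of [limn]. *)
  apply: (@fatou_le _ _ _ P (fun n w => ((psum a n (X^~ w) * \1_D w) ^+ 2)%:E)).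
  - move=> n; apply/measurable_EFinP/measurable_funX/measurable_funM => //.
  - by move=> n w; rewrite lee_fin sqr_ge0.
  - move=> w; apply: cvg_EFin; first exact: nearW.
    rewrite /comp/=.
    have [Dw|nDw] := pselect (D w).
      rewrite expr2 (_ : (fun n => _) = fun n => psum a n (X^~ w) * psum a n (X^~ w)).
        exact: cvgM.
      by apply/funext => n; rewrite indicE mem_set// mulr1 expr2.
    rewrite indicE memNset//= (_ : (fun n => _) = cst 0).
      by rewrite (dvgP nDw) expr0n; exact: cvg_cst.
    by apply/funext => n; rewrite mulr0 expr0n.
  - move=> n; apply: (@le_trans _ _ (\int[P]_w (psum a n (X^~ w) ^+ 2)%:E)%E).
      apply: ge0_le_integral => //.
      + by move=> w _; rewrite lee_fin sqr_ge0.
      + by apply/measurable_EFinP/measurable_funX/measurable_funM.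
      + exact/measurable_EFinP/measurable_funX.
      move=> w _; rewrite lee_fin exprMn.
      have h1 : (\1_D w : R) ^+ 2 <= 1.
        by rewrite indicE; case: (_ \in _); rewrite ?expr1n ?expr0n.
      by rewrite ler_piMr ?sqr_ge0.
    apply: le_trans (second_moment_psum s0 hX a n) _; rewrite lee_fin ler_wpM2l//.
    by rewrite mulr_ge0// sqr_ge0.
apply: (@le_lt_trans _ _ (1 + (2 * s ^+ 2 * V)%:E)%E); last by rewrite -EFinD ltey.
apply: le_trans (leeD (lexx _) hL2).
rewrite -[X in (X + _)%E](integral_cst_prob P) -ge0_integralD//; last 2 first.
- by move=> w _; rewrite lee_fin sqr_ge0.
- exact/measurable_EFinP/measurable_funX.
apply: ge0_le_integral => //.
- by apply/measurable_EFinP; exact: measurableT_comp.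
- by apply/measurable_EFinP/measurable_funD => //; exact: measurable_funX.
move=> w _; rewrite -EFinD lee_fin -[X in _ <= 1 + X]real_normK ?num_real//.
set x := `| _ |; have x0 : 0 <= x by exact: normr_ge0.
by have := sqr_ge0 (x - 1); rewrite sqrrB1; have := sqr_ge0 x; lra.
Qed.

End gaussian_series_limit.

(** * Brownian increments *)

Section brownian_increments.
Context {R : realType} {d : measure_display} {Omega : measurableType d}.
Variables (P : probability Omega R) (F : R -> set (set Omega)).
Hypothesis hF : filtration F.

Definition increment (beta : R -> Omega -> R) (dt : R) (n : nat) (w : Omega) : R :=
  beta (n.+1%:R * dt) w - beta (n%:R * dt) w.

Section one_motion.
Variables (beta : R -> Omega -> R) (hb : brownian_motion P F beta).
Variables (dt : R) (dt0 : 0 < dt).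

Let time_ge0 n : 0 <= n%:R * dt. Proof. by rewrite mulr_ge0// ltW. Qed.

Lemma brownian_adapted s t B : 0 <= s -> s <= t -> measurable B ->
  F t (beta s @^-1` B).
Proof. by case: hb => _ ad _ _ _ s0 st mB; apply: (hF.2 _ _ s0 st); exact: ad. Qed.

(* [F t] as the sigma-algebra of a measurable space, so that the closure of
   measurable functions under subtraction applies to it. *)
Lemma brownian_increment_adapted t n B : n.+1%:R * dt <= t -> measurable B ->
  F t (increment beta dt n @^-1` B).
Proof.
move=> nt mB.
have t0 : 0 <= t by apply: le_trans nt.
have sF : sigma_algebra setT (F t) := (hF.1 t t0).1.
have FE : <<s F t >> = F t by exact: sigma_algebra_id.
pose T := g_sigma_algebraType (F t).
have mb s : 0 <= s -> s <= t -> measurable_fun [set: T] (beta s : T -> R).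
  move=> s0 st _ C mC; rewrite setTI; change (<<s F t >> (beta s @^-1` C)).
  by rewrite FE; exact: brownian_adapted.
have n1t : n%:R * dt <= t.
  by apply: le_trans nt; rewrite ler_wpM2r ?ler_nat// ltW.
have := measurable_funB (mb _ (time_ge0 n.+1) nt) (mb _ (time_ge0 n) n1t).
move=> /(_ measurableT B mB); rewrite setTI => h.
by rewrite -FE; exact: h.
Qed.

Lemma measurable_brownian t : 0 <= t -> measurable_fun setT (beta t).
Proof.
move=> t0 _ B mB; rewrite setTI.
by apply: (hF.1 t t0).2; exact: brownian_adapted.
Qed.

Lemma measurable_increment n : measurable_fun setT (increment beta dt n).
Proof. by apply: measurable_funB; exact: measurable_brownian. Qed.

Lemma increment_law n B : measurable B ->
  P (increment beta dt n @^-1` B) = normal_prob 0 (Num.sqrt dt) B.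
Proof.
move=> mB; case: hb => _ _ nm _ _.
have lt : n%:R * dt < n.+1%:R * dt by rewrite ltr_pM2r// ltr_nat.
have E : n.+1%:R * dt - n%:R * dt = dt by rewrite -mulrBl -natrB// subSnn mul1r.
by have := nm _ _ (time_ge0 n) lt _ mB; rewrite E.
Qed.

(** The two conjuncts support each other in the induction: the next increment is independent of the
    earlier ones because their event belongs to the filtration at time [N%:R * dt]. *)
Lemma increments_independent (N : nat) (B : nat -> set R) :
  (forall n, measurable (B n)) ->
  F (N%:R * dt) [set w | forall n, (n < N)%N -> B n (increment beta dt n w)] /\
  P [set w | forall n, (n < N)%N -> B n (increment beta dt n w)] =
  (\prod_(n < N) normal_prob 0 (Num.sqrt dt) (B n))%E.
Proof.
move=> mB; elim: N => [|N [ihF ihP]].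
  have -> : [set w | forall n, (n < 0)%N -> B n (increment beta dt n w)] = setT.
    by apply/seteqP; split.
  rewrite big_ord0; split; last exact: probability_setT.
  have [[h0 hC _] _] := hF.1 _ (time_ge0 0).
  by have := hC _ h0; rewrite setD0.
set A := [set w | _] in ihF ihP.
have -> : [set w | forall n, (n < N.+1)%N -> B n (increment beta dt n w)] =
    A `&` (increment beta dt N @^-1` B N).
  apply/seteqP; split => w /=.
    by move=> h; split=> [n nN|]; apply: h => //; exact: ltnW.
  by move=> [h1 h2] n; rewrite ltnS leq_eqVlt => /orP[/eqP->//|]; exact: h1.
split.
  have le : N%:R * dt <= N.+1%:R * dt by rewrite ler_pM2r// ler_nat.
  have FA := (hF.2 _ _ (time_ge0 N) le) _ ihF.
  have FB := brownian_increment_adapted (lexx (N.+1%:R * dt)) (mB N).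
  have sF : sigma_algebra setT (F (N.+1%:R * dt)) := (hF.1 _ (time_ge0 _)).1.
  have FE : <<s F (N.+1%:R * dt) >> = F (N.+1%:R * dt) by exact: sigma_algebra_id.
  rewrite -FE; apply: (@measurableI _ (g_sigma_algebraType (F (N.+1%:R * dt)))).
    by change (<<s F (N.+1%:R * dt) >> A); rewrite FE.
  by change (<<s F (N.+1%:R * dt) >> (increment beta dt N @^-1` B N)); rewrite FE.
rewrite big_ord_recr/= -ihP -(increment_law N (mB N)).
case: hb => _ _ _ ind _.
have lt : N%:R * dt < N.+1%:R * dt by rewrite ltr_pM2r// ltr_nat.
exact: (ind _ _ (time_ge0 N) lt _ _ ihF (mB N)).
Qed.

(** Independence of different motions is stated for the events generated by each path, so the
    increment events must be placed among those. *)
Lemma process_events_increment n B : measurable B ->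
  process_events beta (increment beta dt n @^-1` B).
Proof.
move=> mB; pose G := [set A | exists t B, [/\ 0 <= t, measurable B & A = beta t @^-1` B]].
pose T := g_sigma_algebraType G.
have mb s : 0 <= s -> measurable_fun [set: T] (beta s : T -> R).
  move=> s0 _ C mC; rewrite setTI; apply: sub_sigma_algebra.
  by exists s, C.
have := measurable_funB (mb _ (time_ge0 n.+1)) (mb _ (time_ge0 n)).
by move=> /(_ measurableT B mB); rewrite setTI.
Qed.

Lemma process_events_increments (N : nat) (B : nat -> set R) :
  (forall n, measurable (B n)) ->
  process_events beta [set w | forall n, (n < N)%N -> B n (increment beta dt n w)].
Proof.
move=> mB; pose G := [set A | exists t B, [/\ 0 <= t, measurable B & A = beta t @^-1` B]].
have -> : [set w | forall n, (n < N)%N -> B n (increment beta dt n w)] =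
    \bigcap_(n in [set n | (n < N)%N]) (increment beta dt n @^-1` B n).
  by [].
apply: (@bigcap_measurableType _ (g_sigma_algebraType G)) => n _.
exact: process_events_increment.
Qed.

End one_motion.

Variables (K : eqType) (beta : K -> R -> Omega -> R).
Hypothesis hb : forall k, brownian_motion P F (beta k).
Hypothesis hind : independent_processes P beta.

(** On a block of the first [N] times and finitely many motions, [hind] separates the motions and
    the filtration separates the times of each motion; such blocks are cofinal among finite index
    lists. *)
Lemma brownian_increments_iid dt : 0 < dt ->
  iid P (fun ik : nat * K => increment (beta ik.2) dt ik.1)
        (normal_prob 0 (Num.sqrt dt)).
Proof.
move=> dt0; apply: iid_cofinal.
- exact: probability_setT.
- by move=> [n k]; exact: (measurable_increment (hb k) dt0).
move=> s; pose N := (\max_(x <- s) x.1).+1; pose ks := undup (map snd s).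
exists [seq (n, k) | k <- ks, n <- iota 0 N]; split.
- rewrite allpairs_uniq ?iota_uniq ?undup_uniq// => -[? ?] [? ?] _ _ /= [-> ->] //.
- move=> [n k] sk; apply/allpairsP; exists (k, n); split=> //.
    by rewrite mem_undup; apply/mapP; exists (n, k).
  rewrite mem_iota/= add0n ltnS.
  exact: (@leq_bigmax_seq _ s (fun=> true) (fun x => x.1) (n, k)).
move=> B mB.
pose A k := [set w | forall n, (n < N)%N -> B (n, k) (increment (beta k) dt n w)].
have -> : [set w | forall i, i \in [seq (n, k) | k <- ks, n <- iota 0 N] ->
    B i (increment (beta i.2) dt i.1 w)] = \big[setI/setT]_(k <- ks) A k.
  have -> : \big[setI/setT]_(k <- ks) A k = [set w | forall k, k \in ks -> A k w].
    elim: ks => [|k l ih]; first by rewrite big_nil; apply/seteqP; split.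
    rewrite big_cons ih; apply/seteqP; split => w /=.
      by move=> [Ak h] j; rewrite inE => /orP[/eqP ->//|]; exact: h.
    by move=> h; split=> [|j jl]; apply: h; rewrite inE ?eqxx// jl orbT.
  apply/seteqP; split => w h.
    move=> k kks n nN; apply: (h (n, k)); apply/allpairsP; exists (k, n).
    by split=> //; rewrite mem_iota.
  move=> _ /allpairsP[[k n] [kks nN ->]]; apply: (h k kks n).
  by move: nN; rewrite mem_iota.
rewrite hind ?undup_uniq//; last first.
  by move=> k; exact: (process_events_increments (beta := beta k) dt0 N (fun n => mB (n, k))).
rewrite big_allpairs_dep; apply: eq_bigr => k _.
rewrite (increments_independent (hb k) dt0 N (fun n => mB (n, k))).2.
by rewrite -[iota 0 N]/(index_iota 0 N) big_mkord.
Qed.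

End brownian_increments.

(** * Stationary states of random contractions *)

Section random_iteration.
Context {R : realType} {N : nat}.
Context {dW dS : measure_display} {W : measurableType dW} {S : measurableType dS}.
Variables (mu : probability W R) (PP : probability S R).
Variables (z0 : S -> W) (th : S -> S).
Hypotheses (mz0 : measurable_fun setT z0) (mth : measurable_fun setT th).
(** An iid noise sequence seen through its shift: under [PP] the head [z0 s] has law [mu] and is
    independent of the tail [th s], which again has law [PP]. *)
Hypothesis shiftE : forall g : W * S -> \bar R, measurable_fun [set: W * S] g ->
  (forall x, 0 <= g x)%E ->
  (\int[PP]_s g (z0 s, th s) = \int[mu \x PP]_x g x)%E.
Variable F : 'rV[R]_N -> W -> 'rV[R]_N.
Hypothesis mF : measurable_fun [set: borel_space R N * W]
  (fun p : borel_space R N * W => F p.1 p.2 : borel_space R N).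
Variable r : R.
Hypotheses (r0 : 0 < r) (r1 : r < 1).
Hypothesis contractF : forall w x y, norm2 (F x w - F y w) <= r * norm2 (x - y).
Hypothesis momentF : (\int[mu]_w (norm2 (F 0 w))%:E < +oo)%E.

Notation V := (borel_space R N).

Fixpoint iterates (n : nat) (x : 'rV[R]_N) (s : S) : 'rV[R]_N :=
  if n is n'.+1 then iterates n' (F x (z0 s)) (th s) else x.

Lemma iteratesSr n x s : iterates n.+1 x s = F (iterates n x s) (z0 (iter n th s)).
Proof.
elim: n x s => [|n ih] x s //.
by rewrite -[LHS]/(iterates n.+1 (F x (z0 s)) (th s)) ih -iterSr.
Qed.

Let measurableF d (T : measurableType d) (f : T -> V) (g : T -> W) :
  measurable_fun setT f -> measurable_fun setT g ->
  measurable_fun setT (fun t => F (f t) (g t) : V).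
Proof. by move=> mf mg; exact: (measurableT_comp mF (measurable_fun_pair mf mg)). Qed.

Lemma measurable_iterates n :
  measurable_fun [set: V * S] (fun p : V * S => iterates n p.1 p.2 : V).
Proof.
elim: n => [|n ih] /=; first exact: measurable_fst.
have m1 : measurable_fun [set: V * S] (fun p : V * S => F p.1 (z0 p.2) : V).
  apply: measurableF; first exact: measurable_fst.
  by apply: measurableT_comp => //; exact: measurable_snd.
apply: (measurableT_comp ih (measurable_fun_pair m1 _)).
by apply: measurableT_comp => //; exact: measurable_snd.
Qed.

Let measurable_iter d (T : measurableType d) n (f : T -> V) (g : T -> S) :
  measurable_fun setT f -> measurable_fun setT g ->
  measurable_fun setT (fun t => iterates n (f t) (g t) : V).
Proof.
move=> mf mg; exact: (measurableT_comp (measurable_iterates n) (measurable_fun_pair mf mg)).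
Qed.

Lemma iterates_contract n x y s :
  norm2 (iterates n x s - iterates n y s) <= r ^+ n * norm2 (x - y).
Proof.
elim: n x y s => [|n ih] x y s /=; first by rewrite mul1r.
apply: le_trans (ih _ _ _) _; rewrite exprSr -mulrA ler_wpM2l//.
by rewrite exprn_ge0// ltW.
Qed.

Lemma integral_z0 (f : W -> \bar R) : measurable_fun [set: W] f ->
  (forall x, 0 <= f x)%E -> (\int[PP]_s f (z0 s) = \int[mu]_w f w)%E.
Proof.
move=> mf f0; have mg : measurable_fun [set: W * S] (fun p : W * S => f p.1).
  by apply: measurableT_comp => //; exact: measurable_fst.
rewrite (shiftE mg)// fubini_tonelli1//.
by apply: eq_integral => w _; rewrite /fubini_F/= integral_cst_prob.
Qed.

Lemma integral_shift (f : S -> \bar R) : measurable_fun [set: S] f ->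
  (forall x, 0 <= f x)%E -> (\int[PP]_s f (th s) = \int[PP]_s f s)%E.
Proof.
move=> mf f0; have mg : measurable_fun [set: W * S] (fun p : W * S => f p.2).
  by apply: measurableT_comp => //; exact: measurable_snd.
rewrite (shiftE mg)// fubini_tonelli2//.
by apply: eq_integral => w _; rewrite /fubini_G/= integral_cst_prob.
Qed.

(** The head noise is applied last. Passing from [n] to [n.+1] only changes the innermost argument,
    whose effect is damped [n] times, so this sequence converges pathwise, whereas fresh noise keeps
    moving the forward iterates. *)
Fixpoint backward (n : nat) (s : S) : 'rV[R]_N :=
  if n is n'.+1 then F (backward n' (th s)) (z0 s) else 0.

Lemma measurable_backward n : measurable_fun [set: S] (backward n : S -> V).
Proof.
elim: n => [|n ih] /=; first exact: measurable_cst.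
by apply: measurableF => //; exact: measurableT_comp.
Qed.

Definition jump (n : nat) (s : S) : R := r ^+ n * norm2 (F 0 (z0 (iter n th s))).

Lemma jump_ge0 n s : 0 <= jump n s.
Proof. by rewrite mulr_ge0 ?norm2_ge0// exprn_ge0// ltW. Qed.

Lemma backward_step n s :
  norm2 (backward n.+1 s - backward n s) <= jump n s.
Proof.
elim: n s => [|n ih] s; first by rewrite /jump /= subr0 mul1r.
apply: le_trans (contractF _ _ _) _.
apply: le_trans (_ : _ <= r * jump n (th s)) _; first by rewrite ler_pM2l//; exact: ih.
by rewrite /jump mulrA -exprS -iterSr.
Qed.

Lemma measurable_jump n : measurable_fun [set: S] (jump n).
Proof.
apply: measurable_funM => //.
have mi : measurable_fun [set: S] (iter n th).
  by elim: n => [|n ih] /=; [exact: measurable_id|exact: measurableT_comp].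
have mFz : measurable_fun [set: S] (fun s => F 0 (z0 (iter n th s)) : V).
  by apply: measurableF; [exact: measurable_cst|exact: measurableT_comp].
exact: (measurableT_comp measurable_norm2 mFz).
Qed.

Definition total_jump (s : S) : \bar R := (\sum_(n <oo) (jump n s)%:E)%E.

Lemma measurable_total_jump : measurable_fun [set: S] total_jump.
Proof.
apply: ge0_emeasurable_sum => [n s _ _|n _]; first by rewrite lee_fin jump_ge0.
exact/measurable_EFinP/measurable_jump.
Qed.

Lemma total_jump_ge0 s : (0 <= total_jump s)%E.
Proof. by apply: nneseries_ge0 => n _ _; rewrite lee_fin jump_ge0. Qed.

(** The shift preserves [PP], so each noise contributes the same moment and the expected jumps are
    geometric. *)
Lemma integral_jump n :
  (\int[PP]_s (jump n s)%:E = (r ^+ n)%:E * \int[mu]_w (norm2 (F 0 w))%:E)%E.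
Proof.
have mn : measurable_fun [set: W] (fun w => (norm2 (F 0 w))%:E).
  have mF0 : measurable_fun [set: W] (fun w => F 0 w : V).
    by apply: measurableF; [exact: measurable_cst|exact: measurable_id].
  by apply/measurable_EFinP; exact: (measurableT_comp measurable_norm2 mF0).
have n0 w : (0 <= (norm2 (F 0 w))%:E)%E by rewrite lee_fin norm2_ge0.
elim: n => [|n ih].
  rewrite expr0 mul1e -integral_z0//.
  by apply: eq_integral => s _; rewrite /jump/= mul1r.
have mj : measurable_fun [set: S] (EFin \o jump n).
  exact/measurable_EFinP/measurable_jump.
have j0 s : (0 <= (jump n s)%:E)%E by rewrite lee_fin jump_ge0.
have rE : (0 <= r%:E)%E by rewrite lee_fin ltW.
rewrite exprS EFinM -muleA -ih -(integral_shift mj j0).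
rewrite -(ge0_integralZl PP measurableT (measurableT_comp mj mth) (fun s _ => j0 _) rE).
apply: eq_integral => s _; rewrite -EFinM; congr EFin.
by rewrite /jump mulrA -exprS -iterSr.
Qed.

Lemma integral_total_jump : (\int[PP]_s total_jump s < +oo)%E.
Proof.
rewrite /total_jump integral_nneseries//; last 2 first.
- by move=> n; exact/measurable_EFinP/measurable_jump.
- by move=> n s _; rewrite lee_fin jump_ge0.
under eq_eseriesr do rewrite integral_jump.
set m := (\int[mu]_w _)%E.
have m0 : (0 <= m)%E by apply: integral_ge0 => w _; rewrite lee_fin norm2_ge0.
have mfin : m \is a fin_num by rewrite ge0_fin_numE.
rewrite -(fineK mfin).
under eq_eseriesr do rewrite -EFinM.
have cg : cvgn (series (fun n => r ^+ n * fine m)).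
  rewrite (_ : (fun n => _) = geometric (fine m) r); last first.
    by apply/funext => n; rewrite /geometric/= mulrC.
  by apply: is_cvg_geometric_series; rewrite ger0_norm// ltW.
rewrite (_ : (fun n => _) = EFin \o series (fun n => r ^+ n * fine m)); last first.
  by apply/funext => n; rewrite /series/= sumEFin.
by rewrite EFin_lim// ltry.
Qed.

Lemma backward_cvg s a : (total_jump s < +oo)%E -> cvgn (fun n => backward n s 0 a).
Proof.
move=> hs; rewrite (_ : (fun n => _) =
    series (fun n => backward n.+1 s 0 a - backward n s 0 a)); last first.
  apply/funext => n; rewrite /series/=; elim: n => [|n ih].
    by rewrite big_geq// mxE.
  by rewrite big_nat_recr//= -ih addrC subrK.
apply: normed_cvg; apply: (@series_le_cvg _ _ (jump^~ s)).
- by move=> n; exact: normr_ge0.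
- by move=> n; exact: jump_ge0.
- move=> n; apply: le_trans (backward_step n s).
  by apply: le_trans (norm2_coord _ a); rewrite !mxE.
apply: nondecreasing_is_cvgn.
  apply/nondecreasing_seqP => n; rewrite /series/= big_nat_recr//= lerDl.
  exact: jump_ge0.
exists (fine (total_jump s)) => _ [n _ <-].
rewrite -lee_fin fineK; last by rewrite ge0_fin_numE// total_jump_ge0.
rewrite /series/= -sumEFin; apply: nneseries_lim_ge => k _ _.
by rewrite lee_fin jump_ge0.
Qed.

Lemma backward_bound n s : ((norm2 (backward n s))%:E <= total_jump s)%E.
Proof.
apply: (@le_trans _ _ (\sum_(0 <= k < n) (jump k s)%:E)%E); last first.
  by apply: nneseries_lim_ge => k _ _; rewrite lee_fin jump_ge0.
rewrite sumEFin lee_fin; elim: n => [|n ih]; first by rewrite big_geq// norm2_0.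
rewrite big_nat_recr// -[backward n.+1 s](subrK (backward n s)) addrC.
apply: le_trans (norm2D _ _) _; apply: lerD => //; exact: backward_step.
Qed.

Definition stationary (s : S) : 'rV[R]_N := \row_a limn (fun n => backward n s 0 a).

Lemma measurable_stationary : measurable_fun [set: S] (stationary : S -> V).
Proof.
apply: measurable_borel_coord => a.
rewrite (_ : (fun s => _) = fun s => limn (fun n => backward n s 0 a)); last first.
  by apply/funext => s; rewrite mxE.
apply: measurable_limn => n.
exact: (measurableT_comp (measurable_coord a) (measurable_backward n)).
Qed.

Lemma stationary_bound s a : ((`|stationary s 0 a|)%:E <= total_jump s)%E.
Proof.
have [hs|] := ltP (total_jump s) +oo%E; last by rewrite leye_eq => /eqP ->; rewrite leey.
have hf : total_jump s \is a fin_num by rewrite ge0_fin_numE// total_jump_ge0.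
rewrite -(fineK hf) lee_fin mxE.
have cv := backward_cvg (a := a) hs.
rewrite -lim_norm//; apply: limr_le; first exact: is_cvg_norm.
apply: nearW => n; rewrite -lee_fin (fineK hf); apply: le_trans (backward_bound n s).
by rewrite lee_fin norm2_coord.
Qed.

Lemma integral_stationary : (\int[PP]_s (norm2 (stationary s))%:E < +oo)%E.
Proof.
have mY := measurable_stationary.
apply: (@le_lt_trans _ _ (N%:R%:E * \int[PP]_s total_jump s)%E); last first.
  by rewrite lte_mul_pinfty// ?lee_fin// integral_total_jump.
rewrite -ge0_integralZl//; last 2 first.
- exact: measurable_total_jump.
- by move=> s _; exact: total_jump_ge0.
apply: ge0_le_integral => //.
- by move=> s _; rewrite lee_fin norm2_ge0.
- by apply/measurable_EFinP; exact: (measurableT_comp measurable_norm2 mY).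
- by apply: emeasurable_funM => //; exact: measurable_total_jump.
move=> s _; apply: (@le_trans _ _ (\sum_(a < N) (`|stationary s 0 a|)%:E)%E).
  by rewrite sumEFin lee_fin norm2_le_sum.
apply: (@le_trans _ _ (\sum_(a < N) total_jump s)%E).
  by apply: lee_sum => a _; exact: stationary_bound.
by rewrite sumr_const card_ord mule_natl.
Qed.

(** [backward n.+1 s] is [F] applied to [backward n (th s)]; the contraction makes [F] continuous in
    the state, and the limit may be taken wherever [total_jump (th s)] is finite. *)
Lemma stationary_fixpoint :
  \forall s \ae PP, stationary s = F (stationary (th s)) (z0 s).
Proof.
pose D := [set s | total_jump s = +oo%E].
have mT : measurable [set +oo%E : \bar R] by exact: emeasurable_set1.
have mD : measurable D.
  by rewrite -[X in measurable X]setTI; exact: (measurable_total_jump measurableT mT).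
have PD : PP D = 0%E.
  apply/eqP; rewrite eq_le measure_ge0 andbT; apply/negPn/negP; rewrite -ltNge => PD0.
  have := integral_total_jump; apply/negP; rewrite -leNgt leye_eq; apply/eqP.
  have : (\int[PP]_(s in D) total_jump s <= \int[PP]_s total_jump s)%E.
    apply: ge0_subset_integral => //; first exact: measurable_total_jump.
    by move=> s _; exact: total_jump_ge0.
  rewrite (eq_integral (cst +oo%E)); last by move=> s; rewrite inE.
  rewrite integral_cst// gt0_mulye// leye_eq => /eqP; exact.
(* Convergence is used at [th s] rather than at [s], so the null set has to be pulled back by the
   measure-preserving shift. *)
have PthD : PP (th @^-1` D) = 0%E.
  have mD1 : measurable (th @^-1` D) by rewrite -[X in measurable X]setTI; exact: mth.
  have mI : measurable_fun [set: S] (fun s => (\1_D s)%:E : \bar R).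
    exact/measurable_EFinP/measurable_indic.
  have eD : (\int[PP]_s (\1_D s)%:E = PP D)%E by rewrite integral_indic// setIT.
  have ethD : (\int[PP]_s (\1_(th @^-1` D) s)%:E = PP (th @^-1` D))%E.
    by rewrite integral_indic// setIT.
  rewrite -PD -eD -ethD -(integral_shift mI)//.
exists (th @^-1` D); split => //.
  by rewrite -[X in measurable X]setTI; exact: mth.
move=> s /= ne; apply: contrapT => thD; apply: ne.
have hth : (total_jump (th s) < +oo)%E.
  by rewrite ltey; apply/eqP => h; apply: thD.
apply/rowP => a; rewrite mxE.
suff : (fun n => backward n s 0 a) @ \oo --> F (stationary (th s)) (z0 s) 0 a.
  by move/cvg_lim; exact.
rewrite -(cvg_shiftS (fun n => backward n s 0 a)) /=.
apply/cvgrPdist_lt => e e0.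
have hb b : (fun n => `|stationary (th s) 0 b - backward n (th s) 0 b|) @ \oo --> (0 : R).
  have cv := backward_cvg (a := b) hth.
  rewrite -(normr0 R) -(subrr (stationary (th s) 0 b)); apply: cvg_norm.
  by apply: cvgB; [exact: cvg_cst|rewrite mxE].
have : (fun n => \sum_b `|stationary (th s) 0 b - backward n (th s) 0 b|) @ \oo -->
    \sum_(b < N) (0 : R).
  elim: (index_enum _) => [|b l ih].
    rewrite big_nil (_ : (fun n => _) = cst 0); first exact: cvg_cst.
    by apply/funext => n; rewrite big_nil.
  rewrite big_cons (_ : (fun n => _) = (fun n => `|stationary (th s) 0 b -
      backward n (th s) 0 b| + \sum_(c <- l) `|stationary (th s) 0 c -
      backward n (th s) 0 c|)); first exact: cvgD.
  by apply/funext => n; rewrite big_cons.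
rewrite big1// => /cvgrPdist_lt/(_ _ e0).
apply: filterS => n; rewrite sub0r normrN ger0_norm ?sumr_ge0// => hn.
apply: le_lt_trans hn.
have := norm2_coord (F (stationary (th s)) (z0 s) - F (backward n (th s)) (z0 s)) a.
rewrite !mxE => /le_trans; apply; apply: le_trans (contractF _ _ _) _.
apply: (@le_trans _ _ (norm2 (stationary (th s) - backward n (th s)))).
  by rewrite ler_piMl ?norm2_ge0// ltW.
apply: le_trans (norm2_le_sum _) _; apply: ler_sum => b _.
by rewrite !mxE.
Qed.

Definition stationary_law : probability V R := law PP measurable_stationary.

Lemma measurable_step_integral (f : V -> \bar R) : measurable_fun [set: V] f ->
  (forall x, 0 <= f x)%E ->
  measurable_fun [set: V] (fun x : V => \int[mu]_w f (F x w))%E.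
Proof.
move=> mf f0.
exact: (measurable_fun_fubini_tonelli_F (m2 := mu) (fun p : V * W => f (F p.1 p.2))
  (measurableT_comp mf mF) (fun p => f0 _)).
Qed.

Lemma measurable_iterates_integral n (f : V -> \bar R) : measurable_fun [set: V] f ->
  (forall x, 0 <= f x)%E ->
  measurable_fun [set: V] (fun x : V => \int[PP]_s f (iterates n x s))%E.
Proof.
move=> mf f0.
exact: (measurable_fun_fubini_tonelli_F (m2 := PP) (fun p : V * S => f (iterates n p.1 p.2))
  (measurableT_comp mf (measurable_iterates n)) (fun p => f0 _)).
Qed.

(** In the fixpoint equation [stationary (th s)] has the stationary law and is independent of the
    noise [z0 s]; so one step started from that law returns it. *)
Lemma stationary_law_step (f : V -> \bar R) : measurable_fun [set: V] f ->
  (forall x, 0 <= f x)%E ->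
  (\int[stationary_law]_x \int[mu]_w f (F x w) = \int[stationary_law]_x f x)%E.
Proof.
move=> mf f0.
have mY := measurable_stationary.
have mYth : measurable_fun [set: S] (fun s => F (stationary (th s)) (z0 s) : V).
  by apply: measurableF => //; exact: measurableT_comp.
have mg : measurable_fun [set: W * S] (fun p : W * S => f (F (stationary p.2) p.1)).
  apply: (measurableT_comp mf); apply: measurableF; last exact: measurable_fst.
  by apply: measurableT_comp => //; exact: measurable_snd.
rewrite ge0_integral_law//; last 2 first.
- exact: measurable_step_integral.
- by move=> x; apply: integral_ge0 => w _; exact: f0.
rewrite (ge0_integral_law PP mY mf f0).
transitivity (\int[PP]_s f (F (stationary (th s)) (z0 s)))%E; last first.
  apply: ge0_ae_eq_integral => //.
  - exact: (measurableT_comp mf mYth).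
  - exact: (measurableT_comp mf mY).
  - by apply: filterS stationary_fixpoint => s /= <-.
rewrite (shiftE mg)// fubini_tonelli2//.
Qed.

Lemma iterates_integralS n (f : V -> \bar R) x : measurable_fun [set: V] f ->
  (forall x, 0 <= f x)%E ->
  (\int[PP]_s f (iterates n.+1 x s) =
   \int[mu]_w \int[PP]_s f (iterates n (F x w) s))%E.
Proof.
move=> mf f0.
have mg : measurable_fun [set: W * S] (fun p : W * S => f (iterates n (F x p.1) p.2)).
  apply: (measurableT_comp mf); apply: measurable_iter; last exact: measurable_snd.
  by apply: measurableF; [exact: measurable_cst|exact: measurable_fst].
rewrite /= (shiftE mg)// fubini_tonelli1//.
Qed.

Lemma stationary_law_iterates n (f : V -> \bar R) : measurable_fun [set: V] f ->
  (forall x, 0 <= f x)%E ->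
  (\int[stationary_law]_x \int[PP]_s f (iterates n x s) =
   \int[stationary_law]_x f x)%E.
Proof.
move=> mf f0; elim: n => [|n ih].
  by apply: eq_integral => x _; rewrite /= integral_cst_prob.
under eq_integral do rewrite iterates_integralS//.
rewrite (stationary_law_step (f := fun y => \int[PP]_s f (iterates n y s))%E)//.
- exact: measurable_iterates_integral.
- by move=> x; apply: integral_ge0 => s _; exact: f0.
Qed.

Lemma moment_stationary_law : (\int[stationary_law]_x (norm2 x)%:E < +oo)%E.
Proof.
rewrite ge0_integral_law; first exact: integral_stationary.
- by apply/measurable_EFinP; exact: measurable_norm2.
- by move=> x; rewrite lee_fin norm2_ge0.
Qed.

End random_iteration.

(** * Bounded Lipschitz functions *)

Lemma bounded_integrable d (T : measurableType d) (R : realType) (Q : probability T R)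
    (phi : T -> R) (M : R) :
  measurable_fun [set: T] phi -> (forall x, `|phi x| <= M) ->
  Q.-integrable [set: T] (EFin \o phi).
Proof.
move=> mphi hM; apply: measurable_bounded_integrable => //.
  by apply: le_lt_trans (probability_le1 _ _) _ => //; rewrite ltry.
exists M; split; first exact: num_real.
by move=> M' MM' x _ /=; apply: le_trans (hM x) _; exact: ltW.
Qed.

Lemma integrable_EFin_cst d (T : measurableType d) (R : realType) (Q : probability T R)
  (c : R) : Q.-integrable [set: T] (EFin \o (fun=> c)).
Proof. by apply: (@bounded_integrable _ _ _ Q _ `|c|). Qed.

Section orthants.
Context {R : realType} {N : nat}.
Notation V := (borel_space R N).

(** Closed lower orthants are stable under intersection, generate the Borel sets, and have
    indicators that are pointwise limits of Lipschitz functions. *)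
Definition orthant (c : 'I_N -> R) : set V := [set x : 'rV[R]_N | forall a, x 0 a <= c a].
Definition orthants : set (set V) := range orthant.

Lemma orthants_setI : setI_closed orthants.
Proof.
move=> _ _ [c _ <-] [c' _ <-]; exists (fun a => Num.min (c a) (c' a)) => //.
apply/seteqP; split => x /=.
  by move=> h; split=> a; have := h a; rewrite le_min => /andP[].
by move=> [h h'] a; rewrite le_min h h'.
Qed.

Lemma bigcup_orthant : \bigcup_n orthant (fun=> n%:R) = [set: V].
Proof.
apply/seteqP; split => // x _.
exists (Num.truncn (norm2 (x : 'rV[R]_N))).+1 => // a /=.
apply: le_trans (ler_norm _) _; apply: le_trans (norm2_coord _ _) _.
by apply/ltW/truncnS_gt.
Qed.

Lemma measurable_orthant c : measurable (orthant c).
Proof.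
have -> : orthant c = \bigcap_(a in [set: 'I_N])
    ((fun x : V => (x : 'rV[R]_N) 0 a) @^-1` `]-oo, c a]).
  by apply/seteqP; split => x h a; have := h a; rewrite /= in_itv/=; [move=> ->|apply].
apply: fin_bigcap_measurable => // a _; rewrite -[X in measurable X]setTI.
by apply: measurable_coord => //; exact: measurable_itv.
Qed.

(** It suffices that coordinates are measurable for the orthants: an open half-space [x 0 a < t] is
    the countable union of orthants with bound [t - n.+1%:R^-1] on coordinate [a] and [m%:R] on the
    others. *)
Lemma measurable_orthantsE : @measurable _ V = <<s orthants >>.
Proof.
apply/seteqP; split; last first.
  apply: smallest_sub; first exact: sigma_algebra_measurable.
  by move=> _ [c _ <-]; exact: measurable_orthant.
pose T := g_sigma_algebraType orthants.
have mid : measurable_fun [set: T] (id : T -> V).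
  apply: (measurable_borel_coord (f := id : T -> 'rV[R]_N)) => a.
  apply: (measurability _ (RGenInftyO.measurableE R)) => _ [_ [t ->] <-].
  rewrite setTI; have -> : (fun x : T => (x : 'rV[R]_N) 0 a) @^-1` `]-oo, t[ =
      \bigcup_n \bigcup_m orthant (fun b => if b == a then t - n.+1%:R^-1 else m%:R).
    apply/seteqP; split => x /=.
      rewrite in_itv/= => xt.
      have tx : 0 < t - (x : 'rV[R]_N) 0 a by rewrite subr_gt0.
      exists (Num.truncn (t - (x : 'rV[R]_N) 0 a)^-1) => //.
      exists (Num.truncn (norm2 (x : 'rV[R]_N))).+1 => // b /=.
      have [->|_] := eqVneq b a.
        rewrite lerBrDl -lerBrDr -[leRHS]invrK lef_pV2 ?posrE ?invr_gt0//.
        exact/ltW/truncnS_gt.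
      apply: le_trans (ler_norm _) _; apply: le_trans (norm2_coord _ _) _.
      by apply/ltW/truncnS_gt.
    move=> [n _ [m _ /(_ a)]]; rewrite eqxx in_itv/= => /le_lt_trans; apply.
    by rewrite ltrBlDr ltrDl invr_gt0.
  apply: bigcup_measurable => n _; apply: bigcup_measurable => m _.
  apply: sub_sigma_algebra.
  by exists (fun b => if b == a then t - n.+1%:R^-1 else m%:R).
by move=> A mA; have := mid measurableT A mA; rewrite setTI.
Qed.

(** The sum is the [l^1] distance from [x] to the orthant; the function is [1] on the orthant and
    decreases with slope [k] in that distance. *)
Definition ramp (c : 'I_N -> R) (k : nat) (x : 'rV[R]_N) : R :=
  Num.max 0 (1 - k%:R * \sum_a Num.max 0 (x 0 a - c a)).

Lemma ramp_bounds c k x : 0 <= ramp c k x <= 1.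
Proof.
rewrite le_max lexx ge_max ler01/= gerBl mulr_ge0 ?sumr_ge0// => a _.
by rewrite le_max lexx.
Qed.

Let max0_lip (u v : R) : `|Num.max 0 u - Num.max 0 v| <= `|u - v|.
Proof.
have h1 := ler_norm (u - v); have h2 := ler_norm (v - u); rewrite distrC in h2.
case: (lerP 0 u) => hu; case: (lerP 0 v) => hv; rewrite ?subrr ?normr0 ?normr_ge0// ler_norml;
  apply/andP; split; lra.
Qed.

Lemma ramp_lipschitz c k : lipschitz_const (k%:R * N%:R) (ramp c k).
Proof.
split=> [|x y]; first by rewrite mulr_ge0.
apply: le_trans (max0_lip _ _) _.
set sx := \sum_a Num.max 0 (x 0 a - c a); set sy := \sum_a Num.max 0 (y 0 a - c a).
have -> : 1 - k%:R * sx - (1 - k%:R * sy) = k%:R * (sy - sx) by ring.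
rewrite normrM ger0_norm// -mulrA ler_wpM2l// distrC.
rewrite -sumrB; apply: le_trans (ler_norm_sum _ _ _) _.
apply: (@le_trans _ _ (\sum_(a < N) norm2 (x - y))); last first.
  by rewrite sumr_const card_ord mulr_natl.
apply: ler_sum => a _; apply: le_trans (max0_lip _ _) _.
have -> : x 0 a - c a - (y 0 a - c a) = (x - y) 0 a by rewrite !mxE; ring.
exact: norm2_coord.
Qed.

Lemma ramp_cvg c x : ramp c ^~ x @ \oo --> (\1_(orthant c) (x : V) : R).
Proof.
pose q := \sum_a Num.max 0 (x 0 a - c a).
have q0 : 0 <= q by apply: sumr_ge0 => a _; rewrite le_max lexx.
have [xc|nxc] := pselect (orthant c x).
  rewrite indicE mem_set//= (_ : ramp c ^~ x = cst 1); first exact: cvg_cst.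
  apply/funext => k; rewrite /ramp big1 ?mulr0 ?subr0 => [|a _].
    by apply/max_idPr.
  by apply/max_idPl; rewrite subr_le0; exact: xc.
rewrite indicE memNset//=; apply: cvg_near_cst.
have qp : 0 < q.
  rewrite lt_neqAle q0 andbT eq_sym; apply/eqP => q00; apply: nxc => a.
  rewrite -subr_le0; have := q00; rewrite /q => /eqP; rewrite psumr_eq0 => [|b _]; last first.
    by rewrite le_max lexx.
  by move=> /allP/(_ a (mem_index_enum _))/implyP/(_ isT)/eqP <-; rewrite le_max lexx orbT.
near=> k; apply/max_idPl; rewrite subr_le0 -ler_pdivrMr// mul1r.
apply: (le_trans (ltW (truncnS_gt q^-1))); rewrite ler_nat.
by near: k; exact: nbhs_infty_ge.
Unshelve. all: by end_near. Qed.

End orthants.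

Definition bounded_lipschitz {R : realType} {N : nat} (psi : 'rV[R]_N -> R) :=
  Defs.bounded_fun psi /\ exists L, lipschitz_const L psi.

Section bounded_lipschitz_theory.
Context {R : realType} {N : nat}.
Notation V := (borel_space R N).
Implicit Types psi phi : 'rV[R]_N -> R.

Lemma bounded_lipschitz_measurable psi : bounded_lipschitz psi ->
  measurable_fun [set: V] (psi : V -> R).
Proof. by move=> [_ [L /measurable_lipschitz]]. Qed.

Lemma bounded_lipschitz_cst (c : R) :
  bounded_lipschitz ((fun=> c) : 'rV[R]_N -> R).
Proof.
split; first by exists `|c| => x.
by exists 0; split=> // x y; rewrite subrr normr0 mul0r.
Qed.

Lemma bounded_lipschitzD phi psi : bounded_lipschitz phi -> bounded_lipschitz psi ->
  bounded_lipschitz (fun x => phi x + psi x).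
Proof.
move=> [[M hM] [L [L0 hL]]] [[M' hM'] [L' [L'0 hL']]]; split.
  by exists (M + M') => x; apply: le_trans (ler_normD _ _) _; exact: lerD.
exists (L + L'); split=> [|x y]; first exact: addr_ge0.
rewrite opprD addrACA mulrDl; apply: le_trans (ler_normD _ _) _.
by apply: lerD; [exact: hL|exact: hL'].
Qed.

Lemma bounded_lipschitzZ (c : R) psi : bounded_lipschitz psi ->
  bounded_lipschitz (fun x => c * psi x).
Proof.
move=> [[M hM] [L [L0 hL]]]; split.
  by exists (`|c| * M) => x; rewrite normrM ler_wpM2l.
exists (`|c| * L); split=> [|x y]; first by rewrite mulr_ge0.
by rewrite -mulrBr normrM -mulrA ler_wpM2l.
Qed.

Lemma bounded_lipschitz_ramp c k : bounded_lipschitz (@ramp R N c k).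
Proof.
split; last by exists (k%:R * N%:R); exact: ramp_lipschitz.
by exists 1 => x; have /andP[h0 h1] := ramp_bounds c k x; rewrite ger0_norm.
Qed.

Lemma bounded_lipschitz_determines (pi pi' : probability V R) :
  (forall psi, bounded_lipschitz psi -> mean pi' psi = mean pi psi) ->
  forall A, measurable A -> pi' A = pi A.
Proof.
move=> h; have cvgO (nu : probability V R) c :
    (\int[nu]_x (ramp c k x)%:E)%E @[k --> \oo] --> nu (orthant c).
  have mr k : measurable_fun [set: V] (ramp c k : V -> R).
    exact: bounded_lipschitz_measurable (bounded_lipschitz_ramp c k).
  have mO := measurable_orthant c.
  rewrite -[X in _ --> nu X]setIT -integral_indic//.
  have [] // := @dominated_convergence _ V R nu setT measurableT
    (fun k x => (ramp c k x)%:E) (fun x => (\1_(orthant c) x)%:E) (cst 1%E).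
  - by move=> k; exact/measurable_EFinP.
  - exact/measurable_EFinP/measurable_indic.
  - by apply: aeW => x _; apply: cvg_EFin; [exact: nearW|exact: ramp_cvg].
  - by apply: (@bounded_integrable _ _ _ nu (cst 1) 1) => // x; rewrite normr1.
  - apply: aeW => x k _; rewrite lee_fin.
    by have /andP[h0 h1] := ramp_bounds c k x; rewrite ger0_norm.
move=> A mA.
apply: (@measure_unique _ R V orthants (fun n => orthant (fun=> n%:R))
  measurable_orthantsE orthants_setI _ bigcup_orthant pi' pi) => //.
- by move=> n; exists (fun=> n%:R).
- move=> _ [c _ <-].
  have e k : (\int[pi']_x (ramp c k x)%:E = \int[pi]_x (ramp c k x)%:E)%E.
    have ir (nu : probability V R) : nu.-integrable [set: V] (EFin \o (ramp c k : V -> R)).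
      apply: (@bounded_integrable _ _ _ nu _ 1).
        exact: bounded_lipschitz_measurable (bounded_lipschitz_ramp c k).
      by move=> x; have /andP[h0 h1] := ramp_bounds c k x; rewrite ger0_norm.
    have := congr1 EFin (h _ (bounded_lipschitz_ramp c k)); rewrite /mean /Rintegral.
    by rewrite !fineK// integrable_fin_num//; exact: ir.
  have := cvgO pi' c; rewrite (_ : (fun k => _) = fun k => \int[pi]_x (ramp c k x)%:E)%E.
    by move=> h'; apply: (cvg_unique _ h' (cvgO pi c)).
  by apply/funext => k; exact: e.
- by move=> n; apply: le_lt_trans (probability_le1 _ _) _; [exact: measurable_orthant|rewrite ltry].
Qed.

End bounded_lipschitz_theory.

Import HBSimple HBNNSimple.

(** * Density of bounded Lipschitz functions in the square integrable ones *)

Section density.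
Context {R : realType} {N : nat}.
Notation V := (borel_space R N).
Notation measurableV phi := (measurable_fun [set: V] (phi : V -> R)).
Variable pi : probability V R.
Implicit Types phi psi chi : 'rV[R]_N -> R.

Definition sqdist phi psi : \bar R := (\int[pi]_x ((phi x - psi x) ^+ 2)%:E)%E.

Definition approximable phi := forall e : R, 0 < e ->
  exists2 psi, bounded_lipschitz psi & (sqdist phi psi <= e%:E)%E.

Lemma measurable_sqr_diff phi psi :
  measurableV phi -> measurableV psi ->
  measurable_fun [set: V] (fun x : V => ((phi x - psi x) ^+ 2)%:E).
Proof.
by move=> mf mg; apply/measurable_EFinP; apply: measurable_funX; exact: measurable_funB.
Qed.

(** Replaces the triangle inequality of [L^2] by [(a + b)^2 <= 2 a^2 + 2 b^2], whence tolerances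
    such as [e / 4] below. *)
Lemma integral_sqrD phi psi :
  measurableV phi -> measurableV psi ->
  (\int[pi]_x ((phi x + psi x) ^+ 2)%:E <=
   2%:E * \int[pi]_x (phi x ^+ 2)%:E + 2%:E * \int[pi]_x (psi x ^+ 2)%:E)%E.
Proof.
move=> mf mg.
have ms (f : V -> R) : measurable_fun setT f -> measurable_fun setT (fun x => (f x ^+ 2)%:E).
  by move=> h; apply/measurable_EFinP; exact: measurable_funX.
have s0 (f : V -> R) x : (0 <= (f x ^+ 2)%:E)%E by rewrite lee_fin sqr_ge0.
rewrite -!ge0_integralZl//; try exact: ms; try by rewrite lee_fin.
rewrite -ge0_integralD//; last 4 first.
- by move=> x _; rewrite mule_ge0// ?lee_fin.
- by apply: emeasurable_funM => //; exact: ms.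
- by move=> x _; rewrite mule_ge0// ?lee_fin.
- by apply: emeasurable_funM => //; exact: ms.
apply: ge0_le_integral => //.
- by move=> x _; exact: (s0 (fun x : V => phi x + psi x)).
- by apply: (ms (fun x : V => phi x + psi x)); exact: measurable_funD.
- by apply: emeasurable_funD; apply: emeasurable_funM => //; exact: ms.
move=> x _; rewrite -!EFinM -EFinD lee_fin.
have := sqr_ge0 (phi x - psi x); rewrite sqrrB sqrrD; lra.
Qed.

Lemma approximable_bounded_lipschitz psi : bounded_lipschitz psi -> approximable psi.
Proof.
move=> h e e0; exists psi => //; rewrite /sqdist.
under eq_integral do rewrite subrr expr0n/=.
by rewrite integral0 lee_fin ltW.
Qed.

Lemma approximableD phi chi :
  measurableV phi -> measurableV chi ->
  approximable phi -> approximable chi -> approximable (fun x => phi x + chi x).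
Proof.
move=> mf mg hf hg e e0; have e4 : 0 < e / 4 by rewrite divr_gt0.
have [psi hpsi dpsi] := hf _ e4; have [psi' hpsi' dpsi'] := hg _ e4.
exists (fun x => psi x + psi' x); first exact: bounded_lipschitzD.
rewrite /sqdist (_ : (fun x => _) = fun x => ((phi x - psi x + (chi x - psi' x)) ^+ 2)%:E).
  apply: le_trans (integral_sqrD _ _) _.
  - by apply: measurable_funB => //; exact: bounded_lipschitz_measurable.
  - by apply: measurable_funB => //; exact: bounded_lipschitz_measurable.
  apply: (@le_trans _ _ (2%:E * (e / 4)%:E + 2%:E * (e / 4)%:E)%E).
    by apply: leeD; rewrite lee_pmul2l// lte_fin.
  by rewrite -!EFinM -EFinD lee_fin; lra.
by apply/funext => x; congr EFin; congr (_ ^+ 2); ring.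
Qed.

Lemma approximableZ c phi : measurableV phi ->
  approximable phi -> approximable (fun x => c * phi x).
Proof.
move=> mf hf e e0.
have c0 : 0 < c ^+ 2 + 1 by rewrite ltr_wpDl// sqr_ge0.
have [psi hpsi dpsi] := hf _ (divr_gt0 e0 c0).
exists (fun x => c * psi x); first exact: bounded_lipschitzZ.
rewrite /sqdist (_ : (fun x => _) = fun x => ((c ^+ 2)%:E * ((phi x - psi x) ^+ 2)%:E)%E).
  rewrite ge0_integralZl//; last 3 first.
  - by apply: measurable_sqr_diff => //; exact: bounded_lipschitz_measurable.
  - by move=> x _; rewrite lee_fin sqr_ge0.
  - by rewrite lee_fin sqr_ge0.
  apply: (@le_trans _ _ ((c ^+ 2)%:E * (e / (c ^+ 2 + 1))%:E)%E).
    by rewrite lee_wpmul2l// lee_fin sqr_ge0.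
  rewrite -EFinM lee_fin mulrA ler_pdivrMr// mulrC ler_pM2l//; lra.
by apply/funext => x; rewrite -EFinM; congr EFin; ring.
Qed.

Lemma approximable_sum (I : Type) (s : seq I) (f : I -> 'rV[R]_N -> R) :
  (forall i, measurable_fun [set: V] (f i : V -> R)) -> (forall i, approximable (f i)) ->
  approximable (fun x => \sum_(i <- s) f i x).
Proof.
move=> mf hf; elim: s => [|i s ih].
  under eq_fun do rewrite big_nil.
  exact/approximable_bounded_lipschitz/bounded_lipschitz_cst.
under eq_fun do rewrite big_cons.
by apply: approximableD => //; exact: measurable_sum.
Qed.

Lemma approximable_lim (s : nat -> 'rV[R]_N -> R) phi (g : 'rV[R]_N -> R) :
  (forall n, measurable_fun [set: V] (s n : V -> R)) ->
  (forall n, approximable (s n)) -> (forall x, s ^~ x @ \oo --> phi x) ->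
  measurableV phi ->
  pi.-integrable [set: V] (fun x => (g x)%:E) ->
  (forall n x, (phi x - s n x) ^+ 2 <= g x) -> approximable phi.
Proof.
move=> ms hs cs mphi ig hg e e0; have e4 : 0 < e / 4 by rewrite divr_gt0.
have : (\int[pi]_x ((phi x - s n x) ^+ 2)%:E)%E @[n --> \oo] --> (\int[pi]_(x in [set: V]) 0)%E.
  apply: (dominated_cvg _ _ _ _ ig) => //.
  - by move=> n; exact: measurable_sqr_diff.
  - move=> x _; apply: cvg_EFin; first exact: nearW.
    rewrite /comp/=.
    rewrite -(_ : (phi x - phi x) ^+ 2 = 0); last by rewrite subrr expr0n.
    rewrite expr2; under eq_fun do rewrite expr2.
    by apply: cvgM; apply: cvgB => //; exact: cvg_cst.
  - by move=> n x _; rewrite gee0_abs lee_fin// sqr_ge0.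
rewrite integral0 => /fine_cvgP[fin] /cvgrPdist_lt/(_ _ e4) cv.
have [n [fn hn]] : exists n, (\int[pi]_x ((phi x - s n x) ^+ 2)%:E)%E \is a fin_num /\
    `|0 - fine (\int[pi]_x ((phi x - s n x) ^+ 2)%:E)%E| < e / 4.
  have [m _ hm] := filterI fin cv; exists m.
  by have [] := hm m (leqnn m).
have [psi hpsi dpsi] := hs n _ e4.
exists psi => //.
rewrite /sqdist (_ : (fun x => _) = fun x => ((phi x - s n x + (s n x - psi x)) ^+ 2)%:E).
  apply: le_trans (integral_sqrD _ _) _.
  - exact: measurable_funB.
  - by apply: measurable_funB => //; exact: bounded_lipschitz_measurable.
  apply: (@le_trans _ _ (2%:E * (e / 4)%:E + 2%:E * (e / 4)%:E)%E).
    apply: leeD; rewrite lee_pmul2l ?lte_fin//.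
    rewrite -(fineK fn) lee_fin; apply: le_trans (ltW hn).
    by rewrite sub0r normrN ler_norm.
  by rewrite -!EFinM -EFinD lee_fin; lra.
by apply/funext => x; congr EFin; congr (_ ^+ 2); ring.
Qed.

Lemma sqr_diff_le1 (u v : R) : 0 <= u <= 1 -> 0 <= v <= 1 -> (u - v) ^+ 2 <= 1.
Proof.
move=> /andP[u0 u1] /andP[v0 v1].
by rewrite -[leRHS](expr1n R 2) -real_normK ?num_real// ler_pXn2r ?nnegrE// ler_norml; lra.
Qed.

Lemma indic_bounds (A : set V) x : 0 <= (\1_A x : R) <= 1.
Proof. by rewrite indicE; case: (_ \in _); rewrite /= lexx ler01. Qed.

(** Dynkin induction from the orthants, where the ramps approximate. For a disjoint union, the
    finite sums of indicators are indicators of partial unions and converge pointwise. *)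
Lemma approximable_indic (A : set V) : measurable A ->
  approximable (\1_A : V -> R).
Proof.
move=> mA; have := mA; rewrite measurable_orthantsE; move: A {mA}.
apply: (dynkin_induction measurable_orthantsE orthants_setI) => /=.
- rewrite (_ : \1_setT = cst 1 :> (V -> R)).
    exact/approximable_bounded_lipschitz/bounded_lipschitz_cst.
  by apply/funext => x; rewrite indicE in_setT.
- move=> _ [c _ <-].
  apply: (@approximable_lim (ramp c) _ (cst 1)).
  + by move=> n; exact: bounded_lipschitz_measurable (bounded_lipschitz_ramp c n).
  + by move=> n; exact: approximable_bounded_lipschitz (bounded_lipschitz_ramp c n).
  + exact: ramp_cvg.
  + by apply: measurable_indic; exact: measurable_orthant.
  + exact: integrable_EFin_cst.
  + by move=> n x; apply: sqr_diff_le1; [exact: indic_bounds|exact: ramp_bounds].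
- move=> A mA hA.
  rewrite (_ : \1_(~` A) = fun x : V => 1 + (-1) * \1_A x :> R).
    apply: approximableD => //.
    + by apply: measurable_funM => //; exact: measurable_indic.
    + exact/approximable_bounded_lipschitz/bounded_lipschitz_cst.
    + by apply: approximableZ => //; exact: measurable_indic.
  apply/funext => x; rewrite !indicE in_setC; case: (_ \in _); rewrite /=; ring.
- move=> F mF tF hF.
  have sE n x : \sum_(k < n) (\1_(F k) x : R) = \1_(\bigcup_(k < n) F k) x.
    elim: n => [|n ih]; first by rewrite big_ord0 bigcup_mkord big_ord0 indic0.
    rewrite big_ord_recr/= ih !indicE.
    have -> : (x \in \bigcup_(k < n.+1) F k) = (x \in \bigcup_(k < n) F k) || (x \in F n).
      apply/idP/orP; rewrite !inE.
        move=> [k /=]; rewrite ltnS leq_eqVlt => /orP[/eqP -> ?|kn ?]; first by right.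
        by left; exists k.
      by move=> [[k /= kn ?]|?]; [exists k => //=; exact: ltnW|exists n => /=].
    have [h1|] := boolP (x \in \bigcup_(k < n) F k) => //=; last by rewrite add0r.
    have -> : (x \in F n) = false; last by rewrite addr0.
    apply/negbTE/negP; rewrite inE => h2.
    have [k /= kn h3] := set_mem h1.
    have kE : k = n by apply: (tF k n I I); exists x.
    by rewrite kE ltnn in kn.
  apply: (@approximable_lim (fun n x => \sum_(k < n) (\1_(F k) (x : V) : R)) _ (cst 1)).
  + by move=> n; apply: measurable_sum => k; exact: measurable_indic.
  + by move=> n; apply: approximable_sum => // k; exact: measurable_indic.
  + move=> x; under eq_fun do rewrite sE.
    have [[k _ Fkx]|nx] := pselect ((\bigcup_k F k) x).
      apply: cvg_near_cst; exists k.+1 => // n /= kn; rewrite !indicE !mem_set//.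
        by exists k.
      by exists k.
    rewrite (_ : (fun n => _) = cst 0).
      by rewrite indicE memNset//; exact: cvg_cst.
    apply/funext => n; rewrite indicE memNset// => -[k _ ?]; apply: nx; by exists k.
  + by apply: measurable_indic; exact: bigcup_measurable.
  + exact: integrable_EFin_cst.
  + by move=> n x; rewrite sE; apply: sqr_diff_le1; exact: indic_bounds.
Qed.

Lemma approximable_nnsfun (f : {nnsfun V >-> R}) : approximable f.
Proof.
rewrite (_ : (f : V -> R) = fun x => \sum_(y <- finmap.enum_fset (fset_set (range f))) y * \1_(f @^-1` [set y]) x).
  apply: approximable_sum => y.
    by apply: measurable_funM => //; exact: measurable_indic.
  by apply: approximableZ; [exact: measurable_indic|exact: approximable_indic].
by apply/funext => x; rewrite {1}(fimfunE f x) fsbig_finite.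
Qed.

(** Simple functions increase to [phi], so the squared error is dominated by [phi ^+ 2]. *)
Lemma approximable_ge0 phi : measurableV phi ->
  (forall x, 0 <= phi x) -> pi.-integrable [set: V] (fun x => (phi x ^+ 2)%:E) ->
  approximable phi.
Proof.
move=> mf f0 i2.
have mE : measurable_fun [set: V] (EFin \o (phi : V -> R)) by exact/measurable_EFinP.
have cs x := @cvg_nnsfun_approx _ V R setT measurableT _ mE (fun x _ => f0 x) x I.
have cs' x : (fun n => nnsfun_approx measurableT mE n x) @ \oo --> phi x.
  by have /fine_cvgP[_] := cs x.
apply: (@approximable_lim (fun n => nnsfun_approx measurableT mE n) _ (fun x => phi x ^+ 2)) => //.
  by move=> n; exact: approximable_nnsfun.
move=> n x; have nd := nd_nnsfun_approx measurableT mE.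
have le : nnsfun_approx measurableT mE n x <= phi x.
  rewrite -(cvg_lim _ (cs' x))//; apply: nondecreasing_cvgn_le; last by apply/cvg_ex; exists (phi x).
  by move=> m k mk; have /lefP := nd m k mk; exact.
rewrite ler_pXn2r// ?nnegrE ?subr_ge0// gerBl.
exact: fun_ge0.
Qed.

Lemma approximable_L2 phi : measurableV phi ->
  pi.-integrable [set: V] (fun x => (phi x ^+ 2)%:E) -> approximable phi.
Proof.
move=> mf i2.
have h (chi : V -> R) : measurable_fun setT chi -> (forall x, chi x ^+ 2 <= phi x ^+ 2) ->
    pi.-integrable [set: V] (fun x => (chi x ^+ 2)%:E).
  move=> mchi hchi; apply: le_integrable i2 => //.
    by apply/measurable_EFinP; exact: measurable_funX.
  by move=> x _; rewrite !gee0_abs ?lee_fin ?sqr_ge0.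
have mp : measurable_fun setT (fun x : V => Num.max (phi x) 0).
  exact: measurable_maxr.
have mn : measurable_fun setT (fun x : V => Num.max (- phi x) 0).
  by apply: measurable_maxr => //; exact: measurableT_comp.
rewrite (_ : phi = fun x => Num.max (phi x) 0 + (-1) * Num.max (- phi x) 0).
  apply: approximableD => //; first exact: measurable_funM.
    apply: approximable_ge0 => //; first by move=> x; rewrite le_max lexx orbT.
    apply: h => // x; case: (leP (phi x) 0) => ? //; by rewrite expr0n/= sqr_ge0.
  apply: approximableZ => //; apply: approximable_ge0 => //.
    by move=> x; rewrite le_max lexx orbT.
  apply: h => // x; case: (leP (- phi x) 0) => ?; rewrite ?sqrrN//.
  by rewrite expr0n/= sqr_ge0.
by apply/funext => x; case: (leP (phi x) 0) => h1; case: (leP (- phi x) 0) => h2; lra.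
Qed.

End density.

(** * Contractive semigroups *)

Lemma cvge0P (R : realType) (u : nat -> \bar R) : (forall n, 0 <= u n)%E ->
  u @ \oo --> 0%E <-> forall e : R, 0 < e -> \forall n \near \oo, (u n <= e%:E)%E.
Proof.
move=> u0; split.
  move=> /fine_cvgP[fin /cvgrPdist_lt cv] e e0; near=> n.
  have fn : u n \is a fin_num by near: n.
  rewrite -(fineK fn) lee_fin; apply: le_trans (ler_norm _) _; apply: ltW.
  rewrite -[X in `|X|]opprK normrN -sub0r; near: n; exact: cv.
move=> h; apply/fine_cvgP; split.
  have := h 1 ltr01; apply: filterS => n hn.
  by rewrite ge0_fin_numE//; apply: le_lt_trans hn _; rewrite ltry.
apply/cvgrPdist_le => e e0; have := h e e0; apply: filterS => n hn /=.
rewrite sub0r normrN ger0_norm ?fine_ge0//.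
by rewrite -lee_fin fineK// ge0_fin_numE//; apply: le_lt_trans hn _; rewrite ltry.
Unshelve. all: by end_near. Qed.

Section jensen.
Context {R : realType} {d : measure_display} {T : measurableType d}.
Variable Q : probability T R.

Lemma integrable_EFinD (f g : T -> R) :
  Q.-integrable setT (EFin \o f) -> Q.-integrable setT (EFin \o g) ->
  Q.-integrable setT (EFin \o (fun x => f x + g x)).
Proof. exact: integrableD. Qed.

Lemma integrable_EFinB (f g : T -> R) :
  Q.-integrable setT (EFin \o f) -> Q.-integrable setT (EFin \o g) ->
  Q.-integrable setT (EFin \o (fun x => f x - g x)).
Proof. exact: integrableB. Qed.

Lemma integrable_EFinZ (c : R) (f : T -> R) :
  Q.-integrable setT (EFin \o f) -> Q.-integrable setT (EFin \o (fun x => c * f x)).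
Proof.
rewrite (_ : (EFin \o (fun x => c * f x)) = (fun x => c%:E * (EFin \o f) x)%E).
  exact: integrableZl.
by apply/funext => x /=; rewrite EFinM.
Qed.

Lemma Rintegral_cst_prob (c : R) : \int[Q]_(x in setT) c = c.
Proof. by rewrite /Rintegral integral_cst_prob. Qed.

Lemma normr_Rintegral_le (f : T -> R) (M : R) : Q.-integrable setT (EFin \o f) ->
  (forall x, `|f x| <= M) -> `|\int[Q]_x f x| <= M.
Proof.
move=> i hM; apply: le_trans (le_normr_Rintegral measurableT i) _.
rewrite -[leRHS]Rintegral_cst_prob; apply: le_Rintegral => //.
  exact: integrable_norm i.
exact: integrable_EFin_cst.
Qed.

(** Integrate [2 * c * g - c ^+ 2 <= g ^+ 2] at the mean [c]. If the square is not integrable, the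
    right-hand side is infinite. The finite average below is treated in the same way. *)
Lemma sqr_Rintegral_le (g : T -> R) : measurable_fun setT g ->
  Q.-integrable setT (EFin \o g) ->
  (((\int[Q]_x g x) ^+ 2)%:E <= \int[Q]_x (g x ^+ 2)%:E)%E.
Proof.
move=> mg ig; set c := \int[Q]_x g x.
have ms : measurable_fun setT (fun x => (g x ^+ 2)%:E).
  by apply/measurable_EFinP; exact: measurable_funX.
have [fin|] := ltP (\int[Q]_x (g x ^+ 2)%:E)%E +oo%E; last first.
  by rewrite leye_eq => /eqP ->; rewrite leey.
have i2 : Q.-integrable setT (EFin \o (fun x => g x ^+ 2)).
  apply/integrableP; split => //.
  by under eq_integral do rewrite gee0_abs ?lee_fin ?sqr_ge0//.
have i1 : Q.-integrable setT (EFin \o (fun x => 2 * c * g x)).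
  exact: integrable_EFinZ.
have i0 := integrable_EFin_cst Q (c ^+ 2).
have e : \int[Q]_x (2 * c * g x - c ^+ 2) = c ^+ 2.
  rewrite RintegralB// RintegralZl// Rintegral_cst_prob -/c; ring.
rewrite -(@fineK _ (\int[Q]_x (g x ^+ 2)%:E)%E); last exact: integrable_fin_num.
rewrite lee_fin -[leLHS]e; apply: le_Rintegral => //.
  exact: integrable_EFinB.
by move=> x _; have := sqr_ge0 (g x - c); rewrite sqrrB; lra.
Qed.

End jensen.

Lemma sqr_mean_le (R : realFieldType) (m : nat) (a : nat -> R) :
  (m.+1%:R^-1 * \sum_(k < m.+1) a k) ^+ 2 <= m.+1%:R^-1 * \sum_(k < m.+1) a k ^+ 2.
Proof.
set c := _ * \sum_(k < m.+1) a k.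
have c1 : m.+1%:R^-1 * \sum_(k < m.+1) (2 * c * a k - c ^+ 2) = c ^+ 2.
  have Sc : \sum_(k < m.+1) a k = m.+1%:R * c.
    by rewrite /c mulrA divff ?mul1r// pnatr_eq0.
  rewrite sumrB -mulr_sumr sumr_const card_ord Sc -[c ^+ 2 *+ _]mulr_natl.
  by field; rewrite nat1r pnatr_eq0.
rewrite -[leLHS]c1 ler_wpM2l// ler_sum// => k _.
by have := sqr_ge0 (a k - c); rewrite sqrrB; lra.
Qed.

Section contractive_semigroup.
Context {R : realType} {N : nat}.
Context {dO dS : measure_display} {Omega : measurableType dO} {S : measurableType dS}.
Notation V := (borel_space R N).
Notation measurableV phi := (measurable_fun [set: V] (phi : V -> R)).
Variables (P : probability Omega R) (PP : probability S R) (pi : probability V R).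
Variable U : 'rV[R]_N -> nat -> Omega -> 'rV[R]_N.
Variable Phi : nat -> 'rV[R]_N -> S -> 'rV[R]_N.
Hypothesis mPhi : forall n, measurable_fun [set: V * S] (fun p : V * S => Phi n p.1 p.2 : V).
Variable r : R.
Hypotheses (r0 : 0 < r) (r1 : r < 1).
Hypothesis contractPhi : forall n x y s, norm2 (Phi n x s - Phi n y s) <= r ^+ n * norm2 (x - y).
(** The conclusions depend only on the law of each [U x n], so the flow [Phi], which lives on
    another probability space, may take the place of [U]. *)
Hypothesis PhiE : forall n x (f : V -> \bar R), measurable_fun [set: V] f ->
  (forall y, 0 <= f y)%E -> (\int[P]_w f (U x n w) = \int[PP]_s f (Phi n x s))%E.
Hypothesis stationaryPhi : forall n (f : V -> \bar R), measurable_fun [set: V] f ->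
  (forall y, 0 <= f y)%E ->
  (\int[pi]_x \int[PP]_s f (Phi n x s) = \int[pi]_x f x)%E.
Hypothesis momentPhi : (\int[pi]_x (norm2 x)%:E < +oo)%E.
Implicit Types phi psi : 'rV[R]_N -> R.

Let T n phi x : R := \int[PP]_s phi (Phi n x s).

Let measurable_Phi n x : measurable_fun [set: S] (fun s => Phi n x s : V).
Proof. exact: (measurable_section (x : V) (mPhi n)). Qed.

Let measurable_phiPhi phi n x : measurableV phi ->
  measurable_fun [set: S] (fun s => phi (Phi n x s)).
Proof. by move=> mphi; exact: (measurableT_comp mphi (measurable_Phi n x)). Qed.

Let measurable_integral_Phi n (f : V -> \bar R) : measurable_fun [set: V] f ->
  (forall y, 0 <= f y)%E ->
  measurable_fun [set: V] (fun x : V => \int[PP]_s f (Phi n x s))%E.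
Proof.
move=> mf f0.
exact: (measurable_fun_fubini_tonelli_F (m2 := PP) (fun p : V * S => f (Phi n p.1 p.2))
  (measurableT_comp mf (mPhi n)) (fun p => f0 _)).
Qed.

(** [PhiE] concerns nonnegative functions, so positive and negative parts are treated apart. The
    identity then holds at every [x], even where [phi] is not integrable along the flow, as can
    happen for [phi] in [L^2]. *)
Lemma semigroupE n phi : measurableV phi ->
  semigroup P U n phi = T n phi.
Proof.
move=> mphi; apply/funext => x; rewrite /semigroup /T /Rintegral; congr fine.
have mE : measurable_fun [set: V] (EFin \o (phi : V -> R)) by exact/measurable_EFinP.
rewrite unlock [LHS]integralE [RHS]integralE; congr (_ - _)%E.
- transitivity (\int[P]_w (EFin \o (phi : V -> R))^\+%E (U x n w))%E.
    by apply: eq_integral => w _; rewrite !funeposE.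
  rewrite PhiE//; last exact: measurable_funepos.
  by apply: eq_integral => w _; rewrite !funeposE.
- transitivity (\int[P]_w (EFin \o (phi : V -> R))^\-%E (U x n w))%E.
    by apply: eq_integral => w _; rewrite !funenegE.
  rewrite PhiE//; last exact: measurable_funeneg.
  by apply: eq_integral => w _; rewrite !funenegE.
Qed.

Let measurable_T n phi : measurableV phi ->
  measurable_fun [set: V] (T n phi : V -> R).
Proof.
move=> mphi; rewrite /T /Rintegral.
have mE : measurable_fun [set: V] (EFin \o (phi : V -> R)) by exact/measurable_EFinP.
apply: measurableT_comp => //.
rewrite (_ : (fun x => _) = fun x : V => (\int[PP]_s (EFin \o (phi : V -> R))^\+%E (Phi n x s) -
    \int[PP]_s (EFin \o (phi : V -> R))^\-%E (Phi n x s))%E).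
  apply: emeasurable_funB; apply: measurable_integral_Phi => //.
    exact: measurable_funepos.
  exact: measurable_funeneg.
apply/funext => x; rewrite integralE; congr (_ - _)%E.
  by apply: eq_integral => w _; rewrite !funeposE.
by apply: eq_integral => w _; rewrite !funenegE.
Qed.

Let integrable_phiPhi phi (M : R) n x : measurableV phi ->
  (forall y, `|phi y| <= M) -> PP.-integrable setT (EFin \o (fun s => phi (Phi n x s))).
Proof.
move=> mphi hM; apply: (@bounded_integrable _ _ _ PP _ M) => [|s]; last exact: hM.
exact: measurable_phiPhi.
Qed.

Let T_bounded phi (M : R) n x : measurableV phi ->
  (forall y, `|phi y| <= M) -> `|T n phi x| <= M.
Proof.
by move=> mphi hM; apply: normr_Rintegral_le; [exact: (@integrable_phiPhi _ M)|].
Qed.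

Let integrable_T phi (M : R) n : measurableV phi ->
  (forall y, `|phi y| <= M) -> pi.-integrable setT (EFin \o (T n phi : V -> R)).
Proof.
move=> mphi hM; apply: (@bounded_integrable _ _ _ pi _ M); first exact: measurable_T.
by move=> x; exact: T_bounded.
Qed.

Let mean_T phi (M : R) n : measurableV phi ->
  (forall y, `|phi y| <= M) -> mean pi (T n phi) = mean pi phi.
Proof.
move=> mphi hM.
(* Stationarity is known for nonnegative functions, and [phi + M] is one. *)
have p0 y : 0 <= phi y + M by have := hM y; rewrite ler_norml; lra.
have mp : measurable_fun [set: V] (fun y : V => (phi y + M)%:E).
  by apply/measurable_EFinP; exact: measurable_funD.
have iphi : pi.-integrable setT (EFin \o (phi : V -> R)) by exact: (@bounded_integrable _ _ _ pi _ M).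
have iT := integrable_T n mphi hM.
have := congr1 fine (stationaryPhi n mp p0).
rewrite -[RHS]/(\int[pi]_x (phi x + M)).
have -> : (\int[pi]_x \int[PP]_s (phi (Phi n x s) + M)%:E = \int[pi]_x (T n phi x + M)%:E)%E.
  apply: eq_integral => x _; have ix := integrable_phiPhi n x mphi hM.
  have := RintegralD measurableT ix (integrable_EFin_cst PP M); rewrite Rintegral_cst_prob => <-.
  rewrite /Rintegral fineK//.
  exact: (integrable_fin_num measurableT (integrable_EFinD ix (integrable_EFin_cst PP M))).
rewrite -[LHS]/(\int[pi]_x (T n phi x + M)).
rewrite (etrans (RintegralD measurableT iT (integrable_EFin_cst pi M)) (congr1 _ (Rintegral_cst_prob pi M))).
rewrite (etrans (RintegralD measurableT iphi (integrable_EFin_cst pi M)) (congr1 _ (Rintegral_cst_prob pi M))).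
by move/addIr.
Qed.

Lemma contractive_invariant : Defs.invariant P U pi.
Proof.
by move=> phi mphi [M hM] n; rewrite semigroupE//; exact: (@mean_T phi M).
Qed.

Let m := \int[pi]_x norm2 x.

Let integrable_norm2 : pi.-integrable setT (EFin \o (fun x : V => norm2 x)).
Proof.
apply/integrableP; split; first by apply/measurable_EFinP; exact: measurable_norm2.
rewrite (eq_integral (fun x : V => (norm2 x)%:E)) => [//|x _].
by rewrite /= ger0_norm// norm2_ge0.
Qed.

Let T_lipschitz phi (L M : R) n x y : measurableV phi ->
  (forall y, `|phi y| <= M) -> lipschitz_const L phi ->
  `|T n phi x - T n phi y| <= L * r ^+ n * norm2 (x - y).
Proof.
move=> mphi hM [L0 hL].
have ix := integrable_phiPhi n x mphi hM; have iy := integrable_phiPhi n y mphi hM.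
rewrite /T -RintegralB//; set c := L * _ * _.
have iB : PP.-integrable setT (EFin \o (fun s => phi (Phi n x s) - phi (Phi n y s))).
  rewrite (_ : _ \o _ = (fun s => (EFin \o (fun s => phi (Phi n x s))) s -
      (EFin \o (fun s => phi (Phi n y s))) s)%E); first exact: integrableB.
  by apply/funext => s /=; rewrite EFinB.
apply: normr_Rintegral_le => // s; apply: le_trans (hL _ _) _.
by rewrite /c -mulrA ler_wpM2l.
Qed.

(** By stationarity [mean pi phi] is the [pi]-average of [T n phi y], and each difference from
    [T n phi x] is at most [L * r ^+ n * (norm2 x + norm2 y)]. *)
Let mixing phi (L M : R) n x : (forall y, `|phi y| <= M) -> lipschitz_const L phi ->
  `|T n phi x - mean pi phi| <= L * r ^+ n * (norm2 x + m).
Proof.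
move=> hM hL; have mphi : measurableV phi := measurable_lipschitz hL.
rewrite -(mean_T n mphi hM) /mean.
set t := T n phi x.
have it := integrable_EFin_cst pi t; have iT := integrable_T n mphi hM.
have iB : pi.-integrable setT (EFin \o (fun y : V => t - T n phi y)).
  exact: integrable_EFinB.
have inx := integrable_EFin_cst pi (norm2 x).
have iS : pi.-integrable setT (EFin \o (fun y : V => norm2 x + norm2 y)).
  exact: integrable_EFinD.
have mE : \int[pi]_y (norm2 x + norm2 y) = norm2 x + m.
  by rewrite RintegralD// Rintegral_cst_prob.
rewrite -{1}(Rintegral_cst_prob pi t) -RintegralB//; apply: le_trans (le_normr_Rintegral measurableT iB) _.
rewrite -mE -RintegralZl//; apply: le_Rintegral => //.
- exact: (integrable_norm iB).
- exact: integrable_EFinZ.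
move=> y _; apply: le_trans (T_lipschitz n x y mphi hM hL) _.
rewrite ler_wpM2l//.
  by rewrite mulr_ge0 ?exprn_ge0 ?(ltW r0)//; case: hL.
by rewrite -[norm2 y]norm2N; exact: norm2D.
Qed.

Let m0 : 0 <= m.
Proof. by apply: Rintegral_ge0 => x _; exact: norm2_ge0. Qed.

Lemma contractive_mixing dt : 0 < dt -> exponentially_mixing P U dt pi.
Proof.
(* The rate satisfies [expR (- rho * (n%:R * dt)) = r ^+ n]; the summand [1] keeps the constant
   positive when [norm2 x + m] vanishes. *)
move=> dt0; exists (- ln r / dt), (fun x => norm2 x + m + 1); split.
- by rewrite divr_gt0// oppr_gt0 ln_lt0// r0.
- by move=> x; rewrite ltr_wpDl// addr_ge0// norm2_ge0.
move=> phi L [M hM] hL n x.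
have mphi : measurableV phi := measurable_lipschitz hL.
rewrite semigroupE//; apply: le_trans (mixing n x hM hL) _.
have -> : - (- ln r / dt) * (n%:R * dt) = n%:R * ln r.
  by field; rewrite gt_eqF.
rewrite expRM_natl lnK ?posrE//.
have L0 : 0 <= L by case: hL.
rewrite mulrC mulrA ler_wpM2r ?exprn_ge0 ?(ltW r0)// ler_wpM2r//.
by rewrite lerDl.
Qed.

Let T_cvg phi (L M : R) x : (forall y, `|phi y| <= M) -> lipschitz_const L phi ->
  (fun n => T n phi x) @ \oo --> mean pi phi.
Proof.
move=> hM hL; apply/cvgrPdist_le => e e0.
have : (fun n => L * r ^+ n * (norm2 x + m)) @ \oo --> (0 : R).
  rewrite -[X in _ --> X](_ : L * 0 * (norm2 x + m) = 0); last by rewrite mulr0 mul0r.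
  apply: cvgM; last exact: cvg_cst.
  apply: cvgM; first exact: cvg_cst.
  by apply: cvg_expr; rewrite ger0_norm// ltW.
move/cvgrPdist_le/(_ _ e0); apply: filterS => n.
rewrite sub0r normrN => hn; rewrite distrC; apply: le_trans (mixing n x hM hL) _.
exact: le_trans (ler_norm _) hn.
Qed.

(** Integrated against [pi'], the functions [T n psi] have the constant integral [mean pi' psi],
    while they converge boundedly to the constant [mean pi psi]. *)
Lemma contractive_unique (pi' : probability V R) : Defs.invariant P U pi' ->
  forall A : set V, measurable A -> pi' A = pi A.
Proof.
move=> hinv; apply: bounded_lipschitz_determines => psi [[M hM] [L hL]].
have mpsi : measurableV psi := measurable_lipschitz hL.
have mT n : mean pi' (T n psi) = mean pi' psi.
  by rewrite -semigroupE//; apply: hinv => //; exists M.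
have M0 : 0 <= M := le_trans (normr_ge0 _) (hM 0).
have : (\int[pi']_x (T n psi x)%:E)%E @[n --> \oo] --> (\int[pi']_(x in [set: V]) (mean pi psi)%:E)%E.
  apply: (@dominated_cvg _ _ _ pi' setT _ _ _ (cst M%:E)) => //.
  - by move=> n; apply/measurable_EFinP; exact: measurable_T.
  - by move=> x _; apply: cvg_EFin; [exact: nearW|exact: (@T_cvg psi L M)].
  - exact: (integrable_EFin_cst pi' M).
  - by move=> n x _; rewrite lee_fin; exact: T_bounded.
rewrite integral_cst_prob => /fine_cvgP[_].
rewrite (_ : fine \o _ = fun=> mean pi' psi); last by apply/funext => n; rewrite -(mT n).
by move=> h; apply: (cvg_unique _ (cvg_cst _) h).
Qed.

Let integrable_sqr (f : V -> R) : measurable_fun setT f ->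
  (\int[pi]_x (f x ^+ 2)%:E < +oo)%E -> pi.-integrable setT (EFin \o f).
Proof.
move=> mf h; apply: (@le_integrable _ _ _ pi setT measurableT _ (fun x => (1 + f x ^+ 2)%:E)).
- exact/measurable_EFinP.
- move=> x _; rewrite lee_fin [leRHS]ger0_norm ?addr_ge0 ?sqr_ge0//.
  rewrite ler_norml; have := sqr_ge0 (f x - 1); have := sqr_ge0 (f x + 1).
  by rewrite sqrrB sqrrD; lra.
rewrite (_ : (fun x => _) = (fun x => 1%:E + (f x ^+ 2)%:E)%E).
  apply: integrableD => //; first exact: integrable_EFin_cst.
  apply/integrableP; split; first by apply/measurable_EFinP; exact: measurable_funX.
  by under eq_integral do rewrite gee0_abs ?lee_fin ?sqr_ge0//.
by apply/funext => x; rewrite EFinD.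
Qed.

(** The semigroup contracts [L^2(pi)]: Jensen's inequality under [PP] at fixed [x], then
    stationarity. *)
Let T_diff n phi psi : measurableV phi ->
  measurableV psi ->
  pi.-integrable setT (EFin \o (phi : V -> R)) ->
  pi.-integrable setT (EFin \o (psi : V -> R)) ->
  (\int[pi]_x ((T n phi x - T n psi x) ^+ 2)%:E <= sqdist pi phi psi)%E.
Proof.
move=> mphi mpsi iphi ipsi.
(* For unbounded functions Jensen applies only at almost every [x]: by stationarity the integral of
   the absolute value along the flow is [pi]-integrable, hence almost everywhere finite. *)
have ae f : measurableV f -> pi.-integrable setT (EFin \o (f : V -> R)) ->
    \forall x \ae pi, PP.-integrable setT (EFin \o (fun s => f (Phi n x s))).
  move=> mf i.
  have ma : measurable_fun [set: V] (fun x : V => (`|f x|)%:E).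
    by apply/measurable_EFinP; exact: measurableT_comp.
  have a0 x : (0 <= (`|f x|)%:E)%E by rewrite lee_fin.
  have ii : pi.-integrable setT (fun x : V => \int[PP]_s (`|f (Phi n x s)|)%:E)%E.
    apply/integrableP; split.
      exact: (measurable_integral_Phi n ma a0).
    rewrite (eq_integral (fun x : V => \int[PP]_s (`|f (Phi n x s)|)%:E)%E).
      rewrite (stationaryPhi n ma a0); have /integrableP[_] := i; exact.
    by move=> x _; rewrite gee0_abs// integral_ge0// => s _; rewrite lee_fin.
  have := integrable_ae measurableT ii.
  apply: filterS => x /(_ I) fx; apply/integrableP; split.
    by apply/measurable_EFinP; exact: measurable_phiPhi.
  rewrite -ge0_fin_numE//; apply: integral_ge0 => s _; exact: abse_ge0.
have msq : measurable_fun [set: V] (fun x : V => ((phi x - psi x) ^+ 2)%:E).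
  exact: measurable_sqr_diff.
have sq0 x : (0 <= ((phi x - psi x) ^+ 2)%:E)%E by rewrite lee_fin sqr_ge0.
have le : \forall x \ae pi, (((T n phi x - T n psi x) ^+ 2)%:E <=
    \int[PP]_s ((phi (Phi n x s) - psi (Phi n x s)) ^+ 2)%:E)%E.
  have [A [mA A0 hA]] := ae _ mphi iphi; have [B [mB B0 hB]] := ae _ mpsi ipsi.
  exists (A `|` B); split; [exact: measurableU|by rewrite measureU0|].
  move=> x; apply: contra_notP => /not_orP[nA nB].
  have i1 := contra_notP (@hA x) nA; have i2 := contra_notP (@hB x) nB.
  rewrite /= /T -RintegralB//.
  apply: (sqr_Rintegral_le (Q := PP)); last exact: integrable_EFinB.
  by apply: measurable_funB; exact: measurable_phiPhi.
rewrite /sqdist -(stationaryPhi n msq sq0).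
apply: ae_ge0_le_integral => //.
- by move=> x _; rewrite lee_fin sqr_ge0.
- by apply: measurable_sqr_diff; exact: measurable_T.
- by move=> x _; apply: integral_ge0 => s _.
- exact: (measurable_integral_Phi n msq sq0).
by case: le => A [mA A0 hA]; exists A; split=> // x h; apply: hA => h'; apply: h.
Qed.

Let mean_diff phi psi : measurableV phi ->
  measurableV psi ->
  pi.-integrable setT (EFin \o (phi : V -> R)) ->
  pi.-integrable setT (EFin \o (psi : V -> R)) ->
  (((mean pi phi - mean pi psi) ^+ 2)%:E <= sqdist pi phi psi)%E.
Proof.
move=> mphi mpsi i1 i2; rewrite /mean -RintegralB//.
apply: (sqr_Rintegral_le (Q := pi)); first exact: measurable_funB.
exact: integrable_EFinB.
Qed.

(** Through a bounded Lipschitz [psi] near [phi]: [T_diff] and [mean_diff] bound the cost of the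
    replacement uniformly in [n], and for [psi] itself dominated convergence applies. *)
Let L2_mixing phi : measurableV phi ->
  (\int[pi]_x (phi x ^+ 2)%:E < +oo)%E ->
  (\int[pi]_x ((T n phi x - mean pi phi) ^+ 2)%:E)%E @[n --> \oo] --> 0%E.
Proof.
move=> mphi i2; have iphi := integrable_sqr mphi i2.
have aphi : approximable pi phi.
  apply: approximable_L2 => //; apply/integrableP; split.
    by apply/measurable_EFinP; exact: measurable_funX.
  by under eq_integral do rewrite gee0_abs ?lee_fin ?sqr_ge0//.
pose E n := (\int[pi]_x ((T n phi x - mean pi phi) ^+ 2)%:E)%E.
have E0 n : (0 <= E n)%E by apply: integral_ge0 => x _; rewrite lee_fin sqr_ge0.
(* Two uses of [integral_sqrD] turn three errors [e / 12] into [2 * (e / 12) + 2 * (e / 3)], below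
   [e]. *)
apply/(cvge0P E0) => e e0; have e12 : 0 < e / 12 by rewrite divr_gt0.
have [psi [[M hM] [L hL]] dpsi] := aphi _ e12.
have mpsi : measurableV psi := measurable_lipschitz hL.
have ipsi : pi.-integrable setT (EFin \o (psi : V -> R)).
  exact: (@bounded_integrable _ _ _ pi _ M).
have M0 : 0 <= M := le_trans (normr_ge0 _) (hM 0).
have meanM : `|mean pi psi| <= M.
  exact: normr_Rintegral_le ipsi hM.
have : (\int[pi]_x ((T n psi x - mean pi psi) ^+ 2)%:E)%E @[n --> \oo] -->
    (\int[pi]_(x in [set: V]) 0)%E.
  apply: (@dominated_cvg _ _ _ pi setT _ _ _ (cst (4 * M ^+ 2)%:E)) => //.
  - move=> n; apply: (measurable_sqr_diff (psi := fun=> mean pi psi)) => //; exact: measurable_T.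
  - move=> x _; apply: cvg_EFin; first exact: nearW.
    rewrite /comp/= -(_ : (mean pi psi - mean pi psi) ^+ 2 = 0); last by rewrite subrr expr0n.
    rewrite expr2; under eq_fun do rewrite expr2.
    by apply: cvgM; apply: cvgB; first [exact: cvg_cst | exact: (@T_cvg psi L M)].
  - exact: (integrable_EFin_cst pi (4 * M ^+ 2)).
  - move=> n x _; rewrite gee0_abs ?lee_fin ?sqr_ge0//.
    have := T_bounded n x mpsi hM; have := meanM; rewrite !ler_norml => /andP[a1 a2] /andP[b1 b2].
    rewrite (_ : 4 * M ^+ 2 = (2 * M) ^+ 2); last by ring.
    by rewrite -real_normK ?num_real// ler_pXn2r ?nnegrE ?mulr_ge0// ler_norml; lra.
have X0 n : (0 <= \int[pi]_x ((T n psi x - mean pi psi) ^+ 2)%:E)%E.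
  by apply: integral_ge0 => x _; rewrite lee_fin sqr_ge0.
rewrite integral0 => /(cvge0P X0)/(_ _ e12) cv; near=> n.
have hn : (\int[pi]_x ((T n psi x - mean pi psi) ^+ 2)%:E <= (e / 12)%:E)%E by near: n.
have mT1 := measurable_T n mphi; have mT2 := measurable_T n mpsi.
have eE : E n = (\int[pi]_x ((T n phi x - T n psi x +
    (T n psi x - mean pi psi + (mean pi psi - mean pi phi))) ^+ 2)%:E)%E.
  by apply: eq_integral => x _; congr EFin; congr (_ ^+ 2); ring.
rewrite eE; apply: le_trans (integral_sqrD _ _ _) _.
- exact: measurable_funB.
- by apply: measurable_funD => //; exact: measurable_funB.
have h2 : (\int[pi]_x ((T n psi x - mean pi psi + (mean pi psi - mean pi phi)) ^+ 2)%:E <=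
    (e / 3)%:E)%E.
  apply: le_trans (integral_sqrD (psi := fun=> mean pi psi - mean pi phi) _ _ _) _ => //.
    exact: measurable_funB.
  apply: (@le_trans _ _ (2%:E * (e / 12)%:E + 2%:E * (e / 12)%:E)%E).
    apply: leeD; rewrite lee_pmul2l ?lte_fin//.
    rewrite integral_cst_prob -sqrrN opprB.
    exact: le_trans (mean_diff mphi mpsi iphi ipsi) dpsi.
  by rewrite -!EFinM -EFinD lee_fin; lra.
apply: (@le_trans _ _ (2%:E * (e / 12)%:E + 2%:E * (e / 3)%:E)%E).
  apply: leeD; rewrite lee_pmul2l ?lte_fin//.
  exact: le_trans (T_diff n mphi mpsi iphi ipsi) dpsi.
by rewrite -!EFinM -EFinD lee_fin; lra.
Unshelve. all: by end_near. Qed.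

(** The square of an average is at most the average of the squares, so the claim reduces to Cesaro's
    theorem for the numbers [E n], which tend to [0]. *)
Lemma contractive_ergodic : ergodic P U pi.
Proof.
move=> phi Lphi.
have mphi : measurableV phi.
  by move: Lphi; rewrite inE => /andP[]; rewrite inE.
have i2 : (\int[pi]_x (phi x ^+ 2)%:E < +oo)%E.
  have /integrableP[_] := Lfun2_integrable_sqr Lphi.
  by under eq_integral do rewrite /comp gee0_abs ?lee_fin ?sqr_ge0//.
pose E n := (\int[pi]_x ((T n phi x - mean pi phi) ^+ 2)%:E)%E.
have E0 n : (0 <= E n)%E by apply: integral_ge0 => x _; rewrite lee_fin sqr_ge0.
have mT n : measurable_fun [set: V] (T n phi : V -> R) by exact: measurable_T.
have Efin n : E n \is a fin_num.
  rewrite ge0_fin_numE//; apply: le_lt_trans (integral_sqrD (psi := fun=> - mean pi phi) _ _ _) _ => //.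
  have i0 := integrable_EFin_cst pi (0 : R).
  have := T_diff n mphi (measurable_cst (0 : R)) (integrable_sqr mphi i2) i0.
  rewrite /sqdist; under eq_integral do rewrite {2}/T Rintegral_cst_prob subr0.
  under [X in (_ <= X)%E -> _]eq_integral do rewrite subr0.
  move=> h; rewrite lte_add_pinfty// lte_mul_pinfty ?lee_fin//.
    exact: le_lt_trans h i2.
  by rewrite integral_cst_prob ltry.
have cvE : (fun n => fine (E n)) @ \oo --> (0 : R) by have /fine_cvgP[] := L2_mixing mphi i2.
have bnd k : (\int[pi]_x ((cesaro_mean P U k.+1 phi x - mean pi phi) ^+ 2)%:E <=
    (arithmetic_mean (fun n => fine (E n)) k)%:E)%E.
  rewrite /arithmetic_mean/= /series/= big_mkord EFinM -sumEFin.
  under eq_bigr do rewrite fineK//.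
  have msq n : measurable_fun [set: V] (fun x : V => ((T n phi x - mean pi phi) ^+ 2)%:E).
    exact: (measurable_sqr_diff (psi := fun=> mean pi phi)).
  rewrite -ge0_integral_sum//; last by move=> n x _; rewrite lee_fin sqr_ge0.
  rewrite -ge0_integralZl//; last 2 first.
  - by apply: emeasurable_sum => n.
  - by move=> x _; apply: sume_ge0 => n _; rewrite lee_fin sqr_ge0.
  have ce x : cesaro_mean P U k.+1 phi x - mean pi phi =
      k.+1%:R^-1 * \sum_(n < k.+1) (T n phi x - mean pi phi).
    rewrite /cesaro_mean; under eq_bigr do rewrite semigroupE//.
    rewrite sumrB sumr_const card_ord -[mean pi phi *+ _]mulr_natl.
    by field; rewrite nat1r pnatr_eq0.
  apply: ge0_le_integral => //.
  - by move=> x _; rewrite lee_fin sqr_ge0.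
  - apply/measurable_EFinP; apply: measurable_funX.
    under eq_fun do rewrite ce.
    by apply: measurable_funM => //; apply: measurable_sum => n; exact: measurable_funB.
  - by apply: emeasurable_funM => //; apply: emeasurable_sum => n.
  move=> x _; rewrite ce sumEFin -EFinM lee_fin.
  exact: (sqr_mean_le k (fun n => T n phi x - mean pi phi)).
have Lnorm_sqr k e : 0 < e ->
    (\int[pi]_x ((cesaro_mean P U k.+1 phi x - mean pi phi) ^+ 2)%:E <= (e ^+ 2)%:E)%E ->
    (Lnorm pi 2%:E (fun x => (cesaro_mean P U k.+1 phi x - mean pi phi)%:E) <= e%:E)%E.
  move=> e0 he.
  have := poweR_Lnorm pi (fun x => (cesaro_mean P U k.+1 phi x - mean pi phi)%:E) (r := 2) _.
  rewrite pnatr_eq0 => /(_ isT).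
  under [X in _ = X -> _]eq_integral do rewrite abse_EFin poweR_EFin powR_mulrn// real_normK ?num_real//.
  move: (Lnorm_ge0 pi 2%:E (fun x => (cesaro_mean P U k.+1 phi x - mean pi phi)%:E)).
  move: (Lnorm _ _ _) => -[l| |//] l0 lE.
    move: he; rewrite -lE poweR_EFin !lee_fin powR_mulrn// => he.
    by rewrite -(ler_pXn2r (n := 2))// nnegrE// ltW.
  by move: he; rewrite -lE poweRyr ?pnatr_eq0// leye_eq.
(* Averages over [k.+1] terms avoid the degenerate mean over no terms. *)
rewrite -cvg_shiftS/=; apply/cvge0P => [n|e e0]; first exact: Lnorm_ge0.
have /cvgrPdist_le/(_ _ (exprn_gt0 2 e0)) := cesaro cvE; apply: filterS => k.
rewrite sub0r normrN => hk; apply: Lnorm_sqr => //; apply: le_trans (bnd k) _.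
by rewrite lee_fin; exact: le_trans (ler_norm _) hk.
Qed.

End contractive_semigroup.

(** * The finite difference scheme *)

Section matrices.
Context {R : realType}.

Lemma mul_lin1_mx m n (f : 'rV[R]_m -> 'rV[R]_n) :
  (forall a u v, f (a *: u + v) = a *: f u + f v) -> forall u, u *m lin1_mx f = f u.
Proof.
move=> lf u.
have f0 : f 0 = 0.
  by have := lf 1 0 0; rewrite !scale1r addr0 => /esym/(canRL (addrK _)); rewrite subrr.
have fs (s : seq 'I_m) : f (\sum_(i <- s) u 0 i *: delta_mx 0 i) =
    \sum_(i <- s) u 0 i *: f (delta_mx 0 i).
  by elim: s => [|i s ih]; rewrite ?big_nil// !big_cons lf ih.
rewrite {2}[u]row_sum_delta fs; apply/rowP => j; rewrite !mxE summxE.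
by apply: eq_bigr => i _; rewrite !mxE.
Qed.

Variable n : nat.
Implicit Types (A B : 'M[R]_n) (u v : 'rV[R]_n).

Definition skew B := forall u, dotv (u *m B) u = 0.

(** If [u = u *m B], then [dotv u u = dotv (u *m B) u = 0]. *)
Lemma skew_unitmx B : skew B -> 1%:M - B \in unitmx.
Proof.
move=> hB; rewrite -row_free_unit -kermx_eq0; apply/rowV0P => u /sub_kermxP.
rewrite mulmxBr mulmx1 => /eqP; rewrite subr_eq0 => /eqP uB.
by apply: norm2_eq0; apply/eqP; rewrite -sqrf_eq0 sqr_norm2 {1}uB hB.
Qed.

(* Pair [v - z = (v + z) B + g] with [v + z]. *)
Lemma skew_bound B (v z g : 'rV[R]_n) : skew B -> v = z + (v + z) *m B + g ->
  norm2 v <= norm2 z + norm2 g.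
Proof.
move=> hB e.
have : dotv (v - z) (v + z) = dotv g (v + z).
  have -> : v - z = (v + z) *m B + g.
    by apply/eqP; rewrite subr_eq {1}e -addrA addrC.
  by rewrite dotvDl hB add0r.
rewrite dotvBl !dotvDr (dotvC z v) => /esym e2.
have h : norm2 v ^+ 2 - norm2 z ^+ 2 <= norm2 g * (norm2 v + norm2 z).
  rewrite !sqr_norm2.
  have -> : dotv v v - dotv z z = dotv g v + dotv g z by rewrite e2; ring.
  rewrite -dotvDr; apply: le_trans (ler_norm _) _; apply: le_trans (cauchy_schwarz _ _) _.
  by rewrite ler_wpM2l ?norm2_ge0// norm2D.
have v0 := norm2_ge0 v; have z0 := norm2_ge0 z; have g0 := norm2_ge0 g.
rewrite leNgt; apply/negP => hlt.
have vp : 0 < norm2 v by apply: le_lt_trans hlt; exact: addr_ge0.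
have : norm2 g * (norm2 v + norm2 z) < (norm2 v - norm2 z) * (norm2 v + norm2 z).
  by rewrite ltr_pM2r; lra.
by rewrite -subr_sqr; lra.
Qed.

Lemma norm2_diag_le (c : 'rV[R]_n) (k : R) u : 0 <= k -> (forall a, `|c 0 a| <= k) ->
  norm2 (u *m diag_mx c) <= k * norm2 u.
Proof.
move=> k0 hc; rewrite -(ler_pXn2r (n := 2)) ?nnegrE ?mulr_ge0 ?norm2_ge0//.
rewrite exprMn !sqr_norm2 /dotv mulr_sumr; apply: ler_sum => a _.
rewrite mul_mx_diag mxE -!expr2 exprMn mulrC ler_wpM2r ?sqr_ge0//.
by rewrite -real_normK ?num_real// ler_pXn2r ?nnegrE.
Qed.

End matrices.

Section measurable_matrices.
Context {R : realType} {d : measure_display} {T : measurableType d}.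

Lemma measurable_invr : measurable_fun [set: R] (fun x : R => x^-1).
Proof.
rewrite -(setUv [set 0 : R]); apply/measurable_funU => //; first exact: measurableC.
split; first exact: measurable_fun_set1.
apply: open_continuous_measurable_fun; first by rewrite openC; exact: closed_eq.
move=> x; rewrite inE/= => x0; apply: cvgV => //; exact/eqP.
Qed.

Definition measurable_mx m n (A : T -> 'M[R]_(m, n)) :=
  forall i j, measurable_fun setT (fun t => A t i j).

Lemma measurable_det n (A : T -> 'M[R]_n) : measurable_mx A ->
  measurable_fun setT (fun t => \det (A t)).
Proof.
move=> mA; rewrite /determinant; apply: measurable_sum => s.
by apply: measurable_funM => //; apply: measurable_prod => i _.
Qed.

Lemma measurable_mulmx m n p (A : T -> 'M[R]_(m, n)) (B : T -> 'M[R]_(n, p)) :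
  measurable_mx A -> measurable_mx B -> measurable_mx (fun t => A t *m B t).
Proof.
move=> mA mB i j; under eq_fun do rewrite mxE.
by apply: measurable_sum => k; exact: measurable_funM.
Qed.

Lemma measurable_addmx m n (A B : T -> 'M[R]_(m, n)) :
  measurable_mx A -> measurable_mx B -> measurable_mx (fun t => A t + B t).
Proof. by move=> mA mB i j; under eq_fun do rewrite mxE; exact: measurable_funD. Qed.

Lemma measurable_scalemx m n (c : R) (A : T -> 'M[R]_(m, n)) :
  measurable_mx A -> measurable_mx (fun t => c *: A t).
Proof. by move=> mA i j; under eq_fun do rewrite mxE; exact: measurable_funM. Qed.

Lemma measurable_cst_mx m n (A : 'M[R]_(m, n)) : measurable_mx (fun=> A).
Proof. by move=> i j; exact: measurable_cst. Qed.

(** Cramer's formula. It is needed because the noise enters the matrix that a step inverts. *)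
Lemma measurable_invmx n (A : T -> 'M[R]_n) : (forall t, A t \in unitmx) ->
  measurable_mx A -> measurable_mx (fun t => invmx (A t)).
Proof.
move=> uA mA i j.
rewrite (_ : (fun t => _) = fun t => (\det (A t))^-1 * cofactor (A t) j i); last first.
  by apply/funext => t; rewrite /invmx uA !mxE.
apply: measurable_funM; first exact: (measurableT_comp measurable_invr (measurable_det mA)).
apply: measurable_funM => //; apply: measurable_det => a b.
by under eq_fun do rewrite !mxE; exact: mA.
Qed.

End measurable_matrices.

(** * Difference and averaging operators on the periodic grid *)

Notation grid V := (nat -> nat -> nat -> V).

Lemma grid_ext V (Z Z' : grid V) : (forall i j k, Z i j k = Z' i j k) -> Z = Z'.
Proof. by move=> h; apply/funext => i; apply/funext => j; apply/funext => k. Qed.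

Section grid.
Context {R : realType}.

(** The values are taken in [R^o], an [lmodType], so that the grid operators apply to single
    components. *)
Definition coord (l : 'I_3) (Z : grid (vec3 R)) : grid R^o :=
  fun i j k => Z i j k 0 l.

Lemma coordE :
  ((forall l Z, coord l (avg_x Z) = avg_x (coord l Z)) *
   (forall l Z, coord l (avg_y Z) = avg_y (coord l Z)) *
   (forall l Z, coord l (avg_z Z) = avg_z (coord l Z)) *
   (forall l h Z, coord l (diff_x h Z) = diff_x h (coord l Z)) *
   (forall l h Z, coord l (diff_y h Z) = diff_y h (coord l Z)) *
   (forall l h Z, coord l (diff_z h Z) = diff_z h (coord l Z)))%type.
Proof. by do !split=> *; apply: grid_ext => i j k; rewrite /coord !mxE. Qed.

Lemma avg_xyC (V : lmodType R) (Z : grid V) : avg_x (avg_y Z) = avg_y (avg_x Z).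
Proof.
apply: grid_ext => i j k; rewrite /avg_x /avg_y.
by rewrite -!scalerDr addrACA.
Qed.

Lemma avg_xzC (V : lmodType R) (Z : grid V) : avg_x (avg_z Z) = avg_z (avg_x Z).
Proof.
apply: grid_ext => i j k; rewrite /avg_x /avg_z.
by rewrite -!scalerDr addrACA.
Qed.

Lemma avg_yzC (V : lmodType R) (Z : grid V) : avg_y (avg_z Z) = avg_z (avg_y Z).
Proof.
apply: grid_ext => i j k; rewrite /avg_y /avg_z.
by rewrite -!scalerDr addrACA.
Qed.

(* Discrete integration by parts on a period: the summand telescopes. *)
Lemma sum_by_parts n (h : R) (F G : nat -> R) : F n = F 0%N -> G n = G 0%N ->
  \sum_(i < n) (h^-1 * (G i.+1 - G i) * (2^-1 * (F i + F i.+1)) +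
                h^-1 * (F i.+1 - F i) * (2^-1 * (G i + G i.+1))) = 0.
Proof.
move=> Fn Gn; transitivity (\sum_(0 <= i < n) (h^-1 * (F i.+1 * G i.+1) - h^-1 * (F i * G i))).
  rewrite big_mkord; apply: eq_bigr => i _.
  have e : (2 : R) != 0 by rewrite pnatr_eq0.
  by rewrite -!(mulrA h^-1) -mulrDr -mulrBr; congr (_ * _); field.
by rewrite (telescope_sumr (fun i => h^-1 * (F i * G i)))// Fn Gn subrr.
Qed.

Variables (Ix Jy Kz : nat).
Implicit Types f g : grid R^o.

Lemma periodic_avg_x (V : lmodType R) (Z : grid V) :
  Defs.periodic Ix Jy Kz Z -> Defs.periodic Ix Jy Kz (avg_x Z).
Proof.
move=> h i j k; rewrite /avg_x -addSn; have [h1 h2 h3] := h i j k.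
by have [h4 h5 h6] := h i.+1 j k; split; congr (_ *: (_ + _)).
Qed.

Lemma periodic_avg_y (V : lmodType R) (Z : grid V) :
  Defs.periodic Ix Jy Kz Z -> Defs.periodic Ix Jy Kz (avg_y Z).
Proof.
move=> h i j k; rewrite /avg_y -addSn; have [h1 h2 h3] := h i j k.
by have [h4 h5 h6] := h i j.+1 k; split; congr (_ *: (_ + _)).
Qed.

Lemma periodic_avg_z (V : lmodType R) (Z : grid V) :
  Defs.periodic Ix Jy Kz Z -> Defs.periodic Ix Jy Kz (avg_z Z).
Proof.
move=> h i j k; rewrite /avg_z -addSn; have [h1 h2 h3] := h i j k.
by have [h4 h5 h6] := h i j k.+1; split; congr (_ *: (_ + _)).
Qed.

Lemma periodic_coord l Z : Defs.periodic Ix Jy Kz Z -> Defs.periodic Ix Jy Kz (coord l Z).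
Proof. by move=> h i j k; have [h1 h2 h3] := h i j k; rewrite /coord h1 h2 h3. Qed.

Notation sum3 F := (\sum_(c : 'I_Ix * 'I_Jy * 'I_Kz) F c.1.1 c.1.2 c.2).

Lemma sum3E (F : grid R) :
  sum3 F = \sum_(i < Ix) \sum_(j < Jy) \sum_(k < Kz) F i j k.
Proof.
rewrite (pair_bigA _ (fun (i : 'I_Ix) (j : 'I_Jy) => \sum_(k < Kz) F i j k)).
by rewrite (pair_bigA _ (fun (p : 'I_Ix * 'I_Jy) (k : 'I_Kz) => F p.1 p.2 k)).
Qed.

Lemma sum_by_parts_x h f g : Defs.periodic Ix Jy Kz f -> Defs.periodic Ix Jy Kz g ->
  sum3 (fun i j k => diff_x h g i j k * avg_x f i j k + diff_x h f i j k * avg_x g i j k) = 0.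
Proof.
move=> pf pg; rewrite sum3E exchange_big/= big1// => j _.
rewrite exchange_big/= big1// => k _.
apply: (@sum_by_parts _ h (fun i => f i j k) (fun i => g i j k)).
  by have [] := pf 0%N j k.
by have [] := pg 0%N j k.
Qed.

Lemma sum_by_parts_y h f g : Defs.periodic Ix Jy Kz f -> Defs.periodic Ix Jy Kz g ->
  sum3 (fun i j k => diff_y h g i j k * avg_y f i j k + diff_y h f i j k * avg_y g i j k) = 0.
Proof.
move=> pf pg; rewrite sum3E big1// => i _; rewrite exchange_big/= big1// => k _.
apply: (@sum_by_parts _ h (fun j => f i j k) (fun j => g i j k)).
  by have [] := pf i 0%N k.
by have [] := pg i 0%N k.
Qed.

Lemma sum_by_parts_z h f g : Defs.periodic Ix Jy Kz f -> Defs.periodic Ix Jy Kz g ->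
  sum3 (fun i j k => diff_z h g i j k * avg_z f i j k + diff_z h f i j k * avg_z g i j k) = 0.
Proof.
move=> pf pg; rewrite sum3E big1// => i _; rewrite big1// => j _.
apply: (@sum_by_parts _ h (fun k => f i j k) (fun k => g i j k)).
  by have [] := pf i j 0%N.
by have [] := pg i j 0%N.
Qed.

Variables lo hi : point3 R.
Notation hx := (dx lo hi Ix).
Notation hy := (dy lo hi Jy).
Notation hz := (dz lo hi Kz).
Notation curl := (discrete_curl lo hi Ix Jy Kz).

Definition curl_x f := diff_x hx (avg_y (avg_z f)).
Definition curl_y f := diff_y hy (avg_x (avg_z f)).
Definition curl_z f := diff_z hz (avg_x (avg_y f)).

Let addI3 : (((0 : 'I_3) + 1 = 1) * ((0 : 'I_3) + 2%:R = 2%:R) * ((1 : 'I_3) + 1 = 2%:R) *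
  ((1 : 'I_3) + 2%:R = 0) * ((2%:R : 'I_3) + 1 = 0) * ((2%:R : 'I_3) + 2%:R = 1)).
Proof. by do !split; exact/val_inj. Qed.

Let eqI3 : (((0 : 'I_3) == 1) = false) * (((1 : 'I_3) == 0) = false) *
  (((0 : 'I_3) == 2%:R) = false) * (((2%:R : 'I_3) == 0) = false) *
  (((1 : 'I_3) == 2%:R) = false) * (((2%:R : 'I_3) == 1) = false).
Proof. by []. Qed.

Let cross_basisE m (v : vec3 R) l :
  cross (basis_vec m) v 0 l = (l + 1 == m)%:R * v 0 (l + 2%:R) - (l + 2%:R == m)%:R * v 0 (l + 1).
Proof. by rewrite /cross /basis_vec 3!mxE !eqxx. Qed.

Let addrvE (u v : vec3 R) l : (u + v) 0 l = u 0 l + v 0 l.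
Proof. by rewrite mxE. Qed.

Let curl_xE (Z : grid (vec3 R)) l i j k : diff_x hx (avg_y (avg_z Z)) i j k 0 l = curl_x (coord l Z) i j k.
Proof. by rewrite /curl_x -!coordE. Qed.

Let curl_yE (Z : grid (vec3 R)) l i j k : diff_y hy (avg_x (avg_z Z)) i j k 0 l = curl_y (coord l Z) i j k.
Proof. by rewrite /curl_y -!coordE. Qed.

Let curl_zE (Z : grid (vec3 R)) l i j k : diff_z hz (avg_x (avg_y Z)) i j k 0 l = curl_z (coord l Z) i j k.
Proof. by rewrite /curl_z -!coordE. Qed.

Let cross_sum (a b c : vec3 R) :
  let s := cross (basis_vec 0) a + cross (basis_vec 1) b + cross (basis_vec 2%:R) c in
  [/\ s 0 0 = b 0 2%:R - c 0 1, s 0 1 = c 0 0 - a 0 2%:R & s 0 2%:R = a 0 1 - b 0 0].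
Proof.
have simplE := (mul0r, mul1r, oppr0, subr0, sub0r, add0r, addr0).
split; rewrite !addrvE !cross_basisE !addI3 !eqI3 !eqxx /= !simplE//.
by rewrite addrC.
Qed.

Lemma discrete_curl0 Z i j k : curl Z i j k 0 0 =
  curl_y (coord 2%:R Z) i j k - curl_z (coord 1 Z) i j k.
Proof.
rewrite -curl_yE -curl_zE.
by case: (cross_sum (diff_x hx (avg_y (avg_z Z)) i j k) (diff_y hy (avg_x (avg_z Z)) i j k)
  (diff_z hz (avg_x (avg_y Z)) i j k)).
Qed.

Lemma discrete_curl1 Z i j k : curl Z i j k 0 1 =
  curl_z (coord 0 Z) i j k - curl_x (coord 2%:R Z) i j k.
Proof.
rewrite -curl_xE -curl_zE.
by case: (cross_sum (diff_x hx (avg_y (avg_z Z)) i j k) (diff_y hy (avg_x (avg_z Z)) i j k)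
  (diff_z hz (avg_x (avg_y Z)) i j k)).
Qed.

Lemma discrete_curl2 Z i j k : curl Z i j k 0 2%:R =
  curl_x (coord 1 Z) i j k - curl_y (coord 0 Z) i j k.
Proof.
rewrite -curl_xE -curl_yE.
by case: (cross_sum (diff_x hx (avg_y (avg_z Z)) i j k) (diff_y hy (avg_x (avg_z Z)) i j k)
  (diff_z hz (avg_x (avg_y Z)) i j k)).
Qed.

(** Groups the twelve products by the direction of the difference, each product with the one that
    cancels it after summation by parts. *)
Let curl_pairing (ch ce h e : 'I_3 -> R) hx1 hx2 hy0 hy2 hz0 hz1 ex1 ex2 ey0 ey2 ez0 ez1 :
  ch 0 = hy2 - hz1 -> ch 1 = hz0 - hx2 -> ch 2%:R = hx1 - hy0 ->
  ce 0 = ey2 - ez1 -> ce 1 = ez0 - ex2 -> ce 2%:R = ex1 - ey0 ->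
  \sum_l (ch l * e l - ce l * h l) =
  (hx1 * e 2%:R + ex2 * h 1) - (hx2 * e 1 + ex1 * h 2%:R) +
  ((hy2 * e 0 + ey0 * h 2%:R) - (hy0 * e 2%:R + ey2 * h 0)) +
  ((hz0 * e 1 + ez1 * h 0) - (hz1 * e 0 + ez0 * h 1)).
Proof.
move=> h0 h1 h2 e0 e1 e2; rewrite !big_ord_recl big_ord0.
rewrite (_ : lift ord0 ord0 = 1); last exact/val_inj.
rewrite (_ : lift ord0 (lift ord0 ord0) = 2%:R); last exact/val_inj.
rewrite (_ : ord0 = 0); last exact/val_inj.
by rewrite h0 h1 h2 e0 e1 e2; ring.
Qed.

(** [centre] is the average in [x] of the very grid function that [curl_x] differences in [x]. For
    the other two directions the averages are commuted first. *)
Lemma curl_x_parts f g : Defs.periodic Ix Jy Kz f -> Defs.periodic Ix Jy Kz g ->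
  sum3 (fun i j k => curl_x g i j k * centre f i j k + curl_x f i j k * centre g i j k) = 0.
Proof.
by move=> pf pg; apply: sum_by_parts_x; do 2 (apply: periodic_avg_y || apply: periodic_avg_z).
Qed.

Lemma curl_y_parts f g : Defs.periodic Ix Jy Kz f -> Defs.periodic Ix Jy Kz g ->
  sum3 (fun i j k => curl_y g i j k * centre f i j k + curl_y f i j k * centre g i j k) = 0.
Proof.
move=> pf pg; rewrite /centre !avg_xyC.
by apply: sum_by_parts_y; apply: periodic_avg_x; apply: periodic_avg_z.
Qed.

Lemma curl_z_parts f g : Defs.periodic Ix Jy Kz f -> Defs.periodic Ix Jy Kz g ->
  sum3 (fun i j k => curl_z g i j k * centre f i j k + curl_z f i j k * centre g i j k) = 0.
Proof.
move=> pf pg; rewrite /centre !avg_yzC !avg_xzC.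
by apply: sum_by_parts_z; apply: periodic_avg_x; apply: periodic_avg_y.
Qed.

(** The discrete form of the vanishing integral of [curl H . E - curl E . H] over a torus; the
    averages in the scheme are what places both factors at the cell centres. *)
Lemma discrete_curl_skew (E H : grid (vec3 R)) :
  Defs.periodic Ix Jy Kz E -> Defs.periodic Ix Jy Kz H ->
  sum3 (fun i j k => \sum_l (curl H i j k 0 l * centre E i j k 0 l -
                             curl E i j k 0 l * centre H i j k 0 l)) = 0.
Proof.
move=> pE pH.
have cE l (Z : grid (vec3 R)) i j k : centre Z i j k 0 l = centre (coord l Z) i j k.
  by rewrite /centre -!coordE.
transitivity (sum3 (fun i j k =>
   (curl_x (coord 1 H) i j k * centre (coord 2%:R E) i j k +
    curl_x (coord 2%:R E) i j k * centre (coord 1 H) i j k) -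
   (curl_x (coord 2%:R H) i j k * centre (coord 1 E) i j k +
    curl_x (coord 1 E) i j k * centre (coord 2%:R H) i j k) +
  ((curl_y (coord 2%:R H) i j k * centre (coord 0 E) i j k +
    curl_y (coord 0 E) i j k * centre (coord 2%:R H) i j k) -
   (curl_y (coord 0 H) i j k * centre (coord 2%:R E) i j k +
    curl_y (coord 2%:R E) i j k * centre (coord 0 H) i j k)) +
  ((curl_z (coord 0 H) i j k * centre (coord 1 E) i j k +
    curl_z (coord 1 E) i j k * centre (coord 0 H) i j k) -
   (curl_z (coord 1 H) i j k * centre (coord 0 E) i j k +
    curl_z (coord 0 E) i j k * centre (coord 1 H) i j k)))).
  apply: eq_bigr => c _; rewrite -!cE.
  by apply: curl_pairing; first [exact: discrete_curl0|exact: discrete_curl1|exact: discrete_curl2].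
have parts_x l m := curl_x_parts (periodic_coord m pE) (periodic_coord l pH).
have parts_y l m := curl_y_parts (periodic_coord m pE) (periodic_coord l pH).
have parts_z l m := curl_z_parts (periodic_coord m pE) (periodic_coord l pH).
by rewrite 2!big_split/= !sumrB !parts_x !parts_y !parts_z !subrr !addr0.
Qed.

End grid.

Section linearity.
Context {R : realType}.

Definition lin_comb (V : lmodType R) (a : R) (Z Z' : grid V) :=
  fun i j k => a *: Z i j k + Z' i j k.

Let lin_avg (V : lmodType R) (a : R) (z z' t t' : V) :
  2^-1 *: (a *: z + z' + (a *: t + t')) = a *: (2^-1 *: (z + t)) + 2^-1 *: (z' + t').
Proof. by rewrite addrACA -[in LHS]scalerDr [LHS]scalerDr !scalerA (mulrC a). Qed.

Let lin_diff (V : lmodType R) (h a : R) (z z' t t' : V) :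
  h^-1 *: (a *: z + z' - (a *: t + t')) = a *: (h^-1 *: (z - t)) + h^-1 *: (z' - t').
Proof. by rewrite opprD addrACA -[in LHS]scalerBr [LHS]scalerDr !scalerA (mulrC a). Qed.

Section operators.
Variable V : lmodType R.
Implicit Types Z : grid V.

Lemma avg_x_lin a Z Z' : avg_x (lin_comb a Z Z') = lin_comb a (avg_x Z) (avg_x Z').
Proof. by apply: grid_ext => i j k; exact: lin_avg. Qed.

Lemma avg_y_lin a Z Z' : avg_y (lin_comb a Z Z') = lin_comb a (avg_y Z) (avg_y Z').
Proof. by apply: grid_ext => i j k; exact: lin_avg. Qed.

Lemma avg_z_lin a Z Z' : avg_z (lin_comb a Z Z') = lin_comb a (avg_z Z) (avg_z Z').
Proof. by apply: grid_ext => i j k; exact: lin_avg. Qed.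

Lemma diff_x_lin h a Z Z' : diff_x h (lin_comb a Z Z') = lin_comb a (diff_x h Z) (diff_x h Z').
Proof. by apply: grid_ext => i j k; exact: lin_diff. Qed.

Lemma diff_y_lin h a Z Z' : diff_y h (lin_comb a Z Z') = lin_comb a (diff_y h Z) (diff_y h Z').
Proof. by apply: grid_ext => i j k; exact: lin_diff. Qed.

Lemma diff_z_lin h a Z Z' : diff_z h (lin_comb a Z Z') = lin_comb a (diff_z h Z) (diff_z h Z').
Proof. by apply: grid_ext => i j k; exact: lin_diff. Qed.

Lemma centre_lin a Z Z' : centre (lin_comb a Z Z') = lin_comb a (centre Z) (centre Z').
Proof. by rewrite /centre avg_z_lin avg_y_lin avg_x_lin. Qed.

End operators.

Lemma cross_lin (u v w : vec3 R) a : cross u (a *: v + w) = a *: cross u v + cross u w.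
Proof. by apply/rowP => l; rewrite !mxE; ring. Qed.

Let lin_sum3 (V : lmodType R) a (x y z x' y' z' : V) :
  (a *: x + x') + (a *: y + y') + (a *: z + z') = a *: (x + y + z) + (x' + y' + z').
Proof. by rewrite [X in X + _ = _]addrACA [LHS]addrACA -!scalerDr. Qed.

Lemma discrete_curl_lin lo hi Ix Jy Kz a (Z Z' : grid (vec3 R)) :
  discrete_curl lo hi Ix Jy Kz (lin_comb a Z Z') =
  lin_comb a (discrete_curl lo hi Ix Jy Kz Z) (discrete_curl lo hi Ix Jy Kz Z').
Proof.
apply: grid_ext => i j k; rewrite /discrete_curl.
rewrite !(avg_z_lin, avg_y_lin, avg_x_lin) diff_x_lin diff_y_lin diff_z_lin.
rewrite /lin_comb (cross_lin (basis_vec 0)) (cross_lin (basis_vec 1)).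
by rewrite (cross_lin (basis_vec 2%:R)); exact: lin_sum3.
Qed.

(* [X / 2 = - X / 2 + X] makes [avg_t] an instance of [lin_comb]. *)
Lemma avg_t_lin (V : lmodType R) s dt (Z0 Z1 : grid V) :
  let X := lin_comb (expR (- s * dt)) Z0 Z1 in avg_t s dt Z0 Z1 = lin_comb (- 2^-1) X X.
Proof.
apply: grid_ext => i j k.
rewrite /avg_t /lin_comb addrC -[X in _ = _ + X]scale1r -scalerDl; congr (_ *: _).
by field.
Qed.

Let half_lin a (x y : vec3 R) l :
  (- 2^-1 *: (a *: x + y) + (a *: x + y)) 0 l = 2^-1 * (y 0 l + a * x 0 l).
Proof. by rewrite !mxE; field. Qed.

Lemma centre_avg_t s dt (Z0 Z1 : grid (vec3 R)) i j k l :
  centre (avg_t s dt Z0 Z1) i j k 0 l =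
  2^-1 * (centre Z1 i j k 0 l + expR (- s * dt) * centre Z0 i j k 0 l).
Proof. by rewrite avg_t_lin !centre_lin; exact: half_lin. Qed.

Lemma discrete_curl_avg_t lo hi Ix Jy Kz s dt (Z0 Z1 : grid (vec3 R)) i j k l :
  let curl := discrete_curl lo hi Ix Jy Kz in
  curl (avg_t s dt Z0 Z1) i j k 0 l =
  2^-1 * (curl Z1 i j k 0 l + expR (- s * dt) * curl Z0 i j k 0 l).
Proof. by rewrite /= avg_t_lin !discrete_curl_lin; exact: half_lin. Qed.

End linearity.

(** * The scheme as a random affine map of the state vector *)

Section state_space.
Context {R : realType}.
Variables (lo hi : point3 R) (Ix Jy Kz : nat).
Hypotheses (hIx : (0 < Ix)%N) (hJy : (0 < Jy)%N) (hKz : (0 < Kz)%N).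
Notation curl := (discrete_curl lo hi Ix Jy Kz).
Notation St := (state R Ix Jy Kz).
Notation cell := ('I_Ix * 'I_Jy * 'I_Kz)%type.
Notation index := (state_index Ix Jy Kz).
Notation mesh_periodic := (Defs.periodic Ix Jy Kz).
Implicit Types (y u v : St) (E H Z : grid (vec3 R)) (c : cell) (s : bool) (l : 'I_3).

Definition entry u s l c : R := u 0 (enum_rank (s, l, c)).

Lemma entryP u v : (forall s l c, entry u s l c = entry v s l c) -> u = v.
Proof.
move=> h; apply/rowP => a; rewrite -(enum_valK a).
by case: (enum_val a) => [[s l] c]; exact: h.
Qed.

Lemma entryD u v s l c : entry (u + v) s l c = entry u s l c + entry v s l c.
Proof. by rewrite /entry mxE. Qed.

Lemma entryZ k u s l c : entry (k *: u) s l c = k * entry u s l c.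
Proof. by rewrite /entry mxE. Qed.

Fact state_of_key :
  {F : (bool -> 'I_3 -> cell -> R) -> St | forall f s l c, entry (F f) s l c = f s l c}.
Proof.
exists (fun f => \row_a f (enum_val a).1.1 (enum_val a).1.2 (enum_val a).2) => f s l c.
by rewrite /entry mxE enum_rankK.
Qed.

(* Sealed, like [curl_state] below: rewriting is prohibitively slow when
   unification can unfold these states. *)
Definition state_of := sval state_of_key.

Lemma entry_state_of f s l c : entry (state_of f) s l c = f s l c.
Proof. exact: (svalP state_of_key). Qed.

Lemma entry_cell_vector E H s l c : entry (cell_vector Ix Jy Kz E H) s l c =
  centre (if s then H else E) c.1.1 c.1.2 c.2 0 l.
Proof. by rewrite /entry mxE enum_rankK; case: c => [[i j] k]. Qed.

Lemma dotv_state u v : dotv u v = \sum_c \sum_l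
  (entry u false l c * entry v false l c + entry u true l c * entry v true l c).
Proof.
rewrite /dotv (reindex enum_rank) /=; last exact/onW_bij/enum_rank_bij.
transitivity (\sum_(sl : bool * 'I_3) \sum_c entry u sl.1 sl.2 c * entry v sl.1 sl.2 c).
  rewrite (pair_bigA _ (fun sl c => entry u sl.1 sl.2 c * entry v sl.1 sl.2 c)).
  by apply: eq_bigr => [[[]]].
rewrite exchange_big/=; apply: eq_bigr => c _.
rewrite -(pair_bigA _ (fun s l => entry u s l c * entry v s l c)) big_bool/= addrC -big_split.
by apply: eq_bigr => l _.
Qed.

Definition wrap n (h : (0 < n)%N) (i : nat) : 'I_n := Ordinal (ltn_pmod i h).

(** Here a vector of the state space lists nodal values instead of cell-centre values: a period has
    as many nodes as cells, so one type serves for both. *)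
Definition field y s : grid (vec3 R) := fun i j k =>
  \row_l entry y s l (wrap hIx i, wrap hJy j, wrap hKz k).

Definition nodal E H : St :=
  state_of (fun s l c => (if s then H else E) c.1.1 c.1.2 c.2 0 l).

Lemma periodic_field y s : mesh_periodic (field y s).
Proof.
move=> i j k; split; apply/rowP => l; rewrite !mxE.
- by congr (entry y _ _ (_, _, _)); apply/val_inj; rewrite /= modnDr.
- by congr (entry y _ _ (_, _, _)); apply/val_inj; rewrite /= modnDr.
- by congr (entry y _ _ (_, _)); apply/val_inj; rewrite /= modnDr.
Qed.

Lemma periodic_mod Z i j k : mesh_periodic Z -> Z (i %% Ix)%N (j %% Jy)%N (k %% Kz)%N = Z i j k.
Proof.
move=> pZ; rewrite {2}(divn_eq i Ix) {2}(divn_eq j Jy) {2}(divn_eq k Kz).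
have px m i' j' k' : Z (m * Ix + i')%N j' k' = Z i' j' k'.
  elim: m => [//|m ih]; rewrite mulSn -addnA addnC.
  by have [-> _ _] := pZ (m * Ix + i')%N j' k'.
have py m i' j' k' : Z i' (m * Jy + j')%N k' = Z i' j' k'.
  elim: m => [//|m ih]; rewrite mulSn -addnA addnC.
  by have [_ -> _] := pZ i' (m * Jy + j')%N k'.
have pz m i' j' k' : Z i' j' (m * Kz + k')%N = Z i' j' k'.
  elim: m => [//|m ih]; rewrite mulSn -addnA addnC.
  by have [_ _ ->] := pZ i' j' (m * Kz + k')%N.
by rewrite px py pz.
Qed.

Lemma field_nodal E H s : mesh_periodic E -> mesh_periodic H ->
  field (nodal E H) s = if s then H else E.
Proof.
move=> pE pH; apply: grid_ext => i j k.
apply/rowP => l; rewrite mxE entry_state_of.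
by case: s; rewrite /= periodic_mod.
Qed.

Lemma field_lin a y y' s : field (a *: y + y') s = lin_comb a (field y s) (field y' s).
Proof.
apply: grid_ext => i j k.
by apply/rowP => l; rewrite /lin_comb 5!mxE entryD entryZ.
Qed.

Fact curl_state_key : {F : St -> St | forall y s l c, entry (F y) s l c =
  (if s then - curl (field y false) c.1.1 c.1.2 c.2 else curl (field y true) c.1.1 c.1.2 c.2) 0 l}.
Proof.
exists (fun y => state_of (fun s l c => (if s then - curl (field y false) c.1.1 c.1.2 c.2
  else curl (field y true) c.1.1 c.1.2 c.2) 0 l)) => y s l c.
by rewrite entry_state_of.
Qed.

Definition curl_state := sval curl_state_key.

Lemma entry_curl_state y s l c : entry (curl_state y) s l c =
  (if s then - curl (field y false) c.1.1 c.1.2 c.2 else curl (field y true) c.1.1 c.1.2 c.2) 0 l.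
Proof. exact: (svalP curl_state_key). Qed.

(** Sends [(E, H)] to [(- H, E)], the coupling of the fields by the multiplicative noise. *)
Definition swap_state u : St :=
  state_of (fun s l c => if s then entry u false l c else - entry u true l c).

Definition centre_mx := lin1_mx (fun y => cell_vector Ix Jy Kz (field y false) (field y true)).

Definition curl_mx := lin1_mx curl_state.

Definition swap_mx := lin1_mx swap_state.

Let addE (x y : vec3 R) l : (x + y) 0 l = x 0 l + y 0 l.
Proof. by rewrite mxE. Qed.

Let oppE (x : vec3 R) l : (- x) 0 l = - x 0 l.
Proof. by rewrite mxE. Qed.

Let scaleE k (x : vec3 R) l : (k *: x) 0 l = k * x 0 l.
Proof. by rewrite mxE. Qed.

Let lin_combE a Z Z' i j k l : lin_comb a Z Z' i j k 0 l = a * Z i j k 0 l + Z' i j k 0 l.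
Proof. by rewrite /lin_comb addE scaleE. Qed.

Let lin_combN a Z Z' i j k l :
  (- lin_comb a Z Z' i j k) 0 l = a * (- Z i j k) 0 l + (- Z' i j k) 0 l.
Proof. by rewrite !oppE lin_combE opprD mulrN. Qed.

Lemma mul_centre_mx y : y *m centre_mx = cell_vector Ix Jy Kz (field y false) (field y true).
Proof.
rewrite mul_lin1_mx// => a u v; apply: entryP => s l c.
rewrite entryD entryZ !entry_cell_vector !field_lin.
by case: s; rewrite centre_lin lin_combE.
Qed.

Lemma mul_curl_mx y : y *m curl_mx = curl_state y.
Proof.
rewrite mul_lin1_mx// => a u v; apply: entryP => s l c.
rewrite entryD entryZ !entry_curl_state !field_lin.
by case: s; rewrite discrete_curl_lin; [exact: lin_combN|exact: lin_combE].
Qed.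

Lemma mul_swap_mx u : u *m swap_mx = swap_state u.
Proof.
rewrite mul_lin1_mx// => a v w; apply: entryP => s l c.
rewrite entryD entryZ !entry_state_of !entryD !entryZ.
by case: s => //; rewrite opprD mulrN.
Qed.

Definition cell_diag (f : cell -> R) : 'M[R]_#|{: index}| := diag_mx (state_of (fun _ _ => f)).

Lemma mul_cell_diag u f s l c : entry (u *m cell_diag f) s l c = entry u s l c * f c.
Proof. by rewrite /entry mul_mx_diag mxE; congr (_ * _); exact: entry_state_of. Qed.

Definition rotation (w : cell -> R) := swap_mx *m cell_diag w.

Lemma skew_rotation w : skew (rotation w).
Proof.
move=> u; rewrite dotv_state big1// => c _; rewrite big1// => l _.
by rewrite /rotation mulmxA !mul_cell_diag mul_swap_mx !entry_state_of; ring.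
Qed.

(** The curl as a function of cell-centre values: the nodal values are recovered first, which is
    meaningful when [centre_mx] is invertible. *)
Definition curl_operator := locked (invmx centre_mx *m curl_mx).

Lemma mul_curl_operator u : u *m curl_operator = curl_state (u *m invmx centre_mx).
Proof. by rewrite /curl_operator -lock mulmxA mul_curl_mx. Qed.

(** With [y] the nodal values behind [u], the vector [u] consists of the centre averages of [y], and
    the pairing is the sum of [discrete_curl_skew]. *)
Lemma skew_curl_operator : centre_mx \in unitmx -> skew curl_operator.
Proof.
move=> hC u; set y := u *m invmx centre_mx.
rewrite mul_curl_operator -/y.
rewrite -[X in dotv _ X](mulmxKV hC) -/y mul_centre_mx dotv_state.
have := discrete_curl_skew lo hi (periodic_field y false) (periodic_field y true).
move=> /= h; rewrite -[RHS]h; apply: eq_bigr => c _; apply: eq_bigr => l _.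
by rewrite !entry_curl_state !entry_cell_vector -mulNr; congr (_ * _ + _ * _); rewrite oppE.
Qed.

Variables (sigma : point3 R -> R) (lambda1 : R) (lambda2 : vec3 R) (dt : R).

Definition cell_node c : point3 R := node lo hi Ix Jy Kz c.1.1 c.1.2 c.2.

Definition decay : cell -> R := fun c => expR (- sigma (cell_node c) * dt).

Definition forcing (w : cell -> R) : St := state_of (fun _ l c => w c * lambda2 0 l).

(** The scheme times [dt]: the halves come from [avg_t], and [dt] cancels the denominator of the
    noise. *)
Definition implicit_mx (w : cell -> R) :=
  (dt / 2) *: curl_operator + (lambda1 / 2) *: rotation w.

(** Row vectors are multiplied from the right, so the curl is taken first and damped afterwards:
    [sigma] is frozen in the cell where the equation is written. *)
Definition explicit_mx (w : cell -> R) :=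
  cell_diag decay + (dt / 2) *: (curl_operator *m cell_diag decay)
  + (lambda1 / 2) *: (cell_diag decay *m rotation w).

Definition one_step u (w1 w2 : cell -> R) : St :=
  (u *m explicit_mx w1 + forcing w2) *m invmx (1%:M - implicit_mx w1).

Hypothesis hC : centre_mx \in unitmx.

Lemma skew_implicit_mx w : skew (implicit_mx w).
Proof.
move=> u; rewrite /implicit_mx mulmxDr -!scalemxAr dotvDl !dotvZl.
by rewrite skew_curl_operator// skew_rotation !mulr0 addr0.
Qed.

Lemma one_stepP u v w1 w2 : v = u *m explicit_mx w1 + forcing w2 + v *m implicit_mx w1 ->
  v = one_step u w1 w2.
Proof.
move=> h; apply: (canRL (mulmxK (skew_unitmx (skew_implicit_mx w1)))).
by rewrite mulmxBr mulmx1 {1}h addrK.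
Qed.

Lemma one_stepE u w1 w2 :
  one_step u w1 w2 = u *m explicit_mx w1 + forcing w2 + one_step u w1 w2 *m implicit_mx w1.
Proof.
apply/eqP; rewrite -subr_eq; apply/eqP.
by rewrite -{1}[one_step _ _ _]mulmx1 -mulmxBr mulmxKV// skew_unitmx//; exact: skew_implicit_mx.
Qed.

Lemma entry_explicit u p w s l c : u *m curl_operator = p ->
  entry (u *m explicit_mx w) s l c = entry u s l c * decay c +
  dt / 2 * (entry p s l c * decay c) +
  lambda1 / 2 * ((if s then entry u false l c * decay c
                  else - (entry u true l c * decay c)) * w c).
Proof.
move=> hp; rewrite /explicit_mx /rotation !mulmxDr -!scalemxAr !mulmxA hp.
by rewrite !(entryD, entryZ) !mul_cell_diag mul_swap_mx entry_state_of !mul_cell_diag.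
Qed.

Lemma entry_implicit u p w s l c : u *m curl_operator = p ->
  entry (u *m implicit_mx w) s l c = dt / 2 * entry p s l c +
  lambda1 / 2 * ((if s then entry u false l c else - entry u true l c) * w c).
Proof.
move=> hp; rewrite /implicit_mx /rotation !mulmxDr -!scalemxAr !mulmxA hp.
by rewrite !(entryD, entryZ) !mul_cell_diag mul_swap_mx entry_state_of.
Qed.

Let step_coord (C1 C0 K A : vec3 R) (e k1 k2 : R) l (x1 x0 : R) : dt != 0 ->
  dt^-1 *: (C1 - e *: C0) = K + k1 *: A + k2 *: lambda2 ->
  K 0 l = 2^-1 * (x1 + e * x0) ->
  forall a1 a0, A 0 l = 2^-1 * (a1 + e * a0) ->
  C1 0 l = C0 0 l * e + dt / 2 * (x0 * e) + dt * (k1 / 2) * (a0 * e) + dt * k2 * lambda2 0 l +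
    (dt / 2 * x1 + dt * (k1 / 2) * a1).
Proof.
move=> dt0 /(congr1 (fun v : vec3 R => dt * v 0 l)); rewrite !(addE, oppE, scaleE) => h hK a1 a0 hA.
move: h; rewrite hK hA mulrA divff// mul1r => /eqP; rewrite subr_eq => /eqP ->.
by field.
Qed.

Let opp_coord (X Y Z : vec3 R) e l : X 0 l = 2^-1 * (Y 0 l + e * Z 0 l) ->
  (- X) 0 l = 2^-1 * ((- Y) 0 l + e * (- Z) 0 l).
Proof. by rewrite !oppE => ->; ring. Qed.

Let step_magnetic (C0 e x0 a0 x1 a1 b w1 w2 : R) : dt != 0 ->
  C0 * e + dt / 2 * (x0 * e) + dt * (lambda1 * (w1 / dt) / 2) * (a0 * e) + dt * (w2 / dt) * b +
    (dt / 2 * x1 + dt * (lambda1 * (w1 / dt) / 2) * a1) =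
  C0 * e + dt / 2 * (x0 * e) + lambda1 / 2 * (a0 * e * w1) + w2 * b +
    (dt / 2 * x1 + lambda1 / 2 * (a1 * w1)).
Proof. by move=> ?; field. Qed.

Let step_electric (C0 e x0 a0 x1 a1 b w1 w2 : R) : dt != 0 ->
  C0 * e + dt / 2 * (x0 * e) + dt * (- (lambda1 * (w1 / dt)) / 2) * (a0 * e) +
    dt * (w2 / dt) * b + (dt / 2 * x1 + dt * (- (lambda1 * (w1 / dt)) / 2) * a1) =
  C0 * e + dt / 2 * (x0 * e) + lambda1 / 2 * (- (a0 * e) * w1) + w2 * b +
    (dt / 2 * x1 + lambda1 / 2 * (- a1 * w1)).
Proof. by move=> ?; field. Qed.

(** Periodicity makes the grid functions recoverable from their cell-centre values. Each cell
    equation times [dt] is then an entry of the linear system whose only solution is [one_step]. *)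
Lemma scheme_step_one_step E0 H0 E1 H1 w1 w2 : dt != 0 ->
  mesh_periodic E0 -> mesh_periodic H0 -> mesh_periodic E1 -> mesh_periodic H1 ->
  (forall c, scheme_step lo hi Ix Jy Kz sigma lambda1 lambda2 dt (w1 c) (w2 c) E0 H0 E1 H1
     c.1.1 c.1.2 c.2) ->
  cell_vector Ix Jy Kz E1 H1 = one_step (cell_vector Ix Jy Kz E0 H0) w1 w2.
Proof.
move=> dt0 pE0 pH0 pE1 pH1 hs; apply: one_stepP.
have uL E H : mesh_periodic E -> mesh_periodic H ->
    cell_vector Ix Jy Kz E H *m curl_operator = curl_state (nodal E H).
  move=> pE pH; rewrite mul_curl_operator; congr curl_state.
  have -> : cell_vector Ix Jy Kz E H = nodal E H *m centre_mx.
    by rewrite mul_centre_mx !field_nodal.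
  by rewrite mulmxK.
apply: entryP => s l c; rewrite !entryD.
rewrite (entry_explicit _ _ _ _ (uL _ _ pE0 pH0)) (entry_implicit _ _ _ _ (uL _ _ pE1 pH1)).
rewrite !entry_state_of !entry_curl_state !entry_cell_vector !field_nodal//.
have [hE hH] := hs c; set sg := sigma _ in hE hH; set AE := avg_t _ _ E0 E1 in hE hH.
set AH := avg_t _ _ H0 H1 in hE hH.
have cE := centre_avg_t sg dt E0 E1 c.1.1 c.1.2 c.2 l.
have cH := centre_avg_t sg dt H0 H1 c.1.1 c.1.2 c.2 l.
have kE := discrete_curl_avg_t lo hi Ix Jy Kz sg dt E0 E1 c.1.1 c.1.2 c.2 l.
have kH := discrete_curl_avg_t lo hi Ix Jy Kz sg dt H0 H1 c.1.1 c.1.2 c.2 l.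
case: s.
- exact: etrans (step_coord dt0 hH (opp_coord kE) cE) (step_magnetic _ _ _ _ _ _ _ _ _ dt0).
- have hE' : dt^-1 *: (centre E1 c.1.1 c.1.2 c.2 - decay c *: centre E0 c.1.1 c.1.2 c.2) =
      curl AH c.1.1 c.1.2 c.2 + (- (lambda1 * (w1 c / dt))) *: centre AH c.1.1 c.1.2 c.2
      + (w2 c / dt) *: lambda2.
    by rewrite scaleNr.
  exact: etrans (step_coord dt0 hE' kH cH) (step_electric _ _ _ _ _ _ _ _ _ dt0).
Qed.

Lemma state_ofE f a :
  state_of f 0 a = f (enum_val a).1.1 (enum_val a).1.2 (enum_val a).2.
Proof.
by rewrite -{1}(enum_valK a); case: (enum_val a) => [[s l] c]; exact: (entry_state_of f s l c).
Qed.

Section measurability.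
Context {d : measure_display} {T : measurableType d}.
Variables (x : T -> St) (w1 w2 : T -> cell -> R).
Hypothesis mx : measurable_mx x.
Hypothesis mw1 : forall c, measurable_fun setT (fun t => w1 t c).
Hypothesis mw2 : forall c, measurable_fun setT (fun t => w2 t c).

Let measurable_rotation : measurable_mx (fun t => rotation (w1 t)).
Proof.
apply: measurable_mulmx; first exact: measurable_cst_mx.
move=> i j; under eq_fun do rewrite mxE state_ofE.
by case: (i == j); [under eq_fun do rewrite mulr1n; exact: mw1|
  under eq_fun do rewrite mulr0n; exact: measurable_cst].
Qed.

Lemma measurable_one_step : measurable_mx (fun t => one_step (x t) (w1 t) (w2 t)).
Proof.
apply: measurable_mulmx.
  apply: measurable_addmx.
    apply: measurable_mulmx => //; apply: measurable_addmx.
      exact: measurable_cst_mx.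
    apply: measurable_scalemx; apply: measurable_mulmx => //; exact: measurable_cst_mx.
  move=> i j; rewrite ord1; under eq_fun do rewrite /forcing state_ofE.
  exact: measurable_funM.
apply: measurable_invmx => [t|]; first exact/skew_unitmx/skew_implicit_mx.
apply: measurable_addmx; first exact: measurable_cst_mx.
have -> : (fun t => - implicit_mx (w1 t)) = fun t => (-1) *: implicit_mx (w1 t).
  by apply/funext => t; rewrite scaleN1r.
apply: measurable_scalemx; apply: measurable_addmx; first exact: measurable_cst_mx.
exact: measurable_scalemx.
Qed.

End measurability.

Variables (sigma0 smax : R).
Hypotheses (hdt : 0 < dt) (hsigma0 : 0 < sigma0).
Hypothesis hsigma : forall c, sigma0 <= sigma (cell_node c) <= smax.

Let decay_le c : decay c <= (1 + sigma0 * dt)^-1.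
Proof.
have /andP[s0 _] := hsigma c.
have d1 : 0 < 1 + sigma0 * dt by rewrite ltr_pwDl// mulr_ge0// ltW.
rewrite /decay mulNr expRN lef_pV2 ?posrE ?expR_gt0//.
by apply: le_trans (expR_ge1Dx _); rewrite lerD2l ler_wpM2r// ltW.
Qed.

Let decay_near1 c : `|decay c - 1| <= smax * dt.
Proof.
have /andP[s0 s1] := hsigma c.
have x0 : 0 <= sigma (cell_node c) * dt by rewrite mulr_ge0 ?(ltW hdt)// (le_trans (ltW hsigma0)).
have := expR_ge1Dx (- (sigma (cell_node c) * dt)).
have : expR (- (sigma (cell_node c) * dt)) <= 1 by rewrite -expR0 ler_expR oppr_le0.
have : sigma (cell_node c) * dt <= smax * dt by rewrite ler_wpM2r// ltW.
by rewrite ler_norml /decay mulNr => *; lra.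
Qed.

Lemma norm2_cell_diag_le u f k : 0 <= k -> (forall c, `|f c| <= k) ->
  norm2 (u *m cell_diag f) <= k * norm2 u.
Proof.
move=> k0 hf; apply: norm2_diag_le => // a; rewrite -(enum_valK a).
by case: (enum_val a) => [[s l] c]; rewrite [_ 0 _](entry_state_of (fun _ _ => f) s l c).
Qed.

(** The first term bounds the damping, as [expR (- x) <= (1 + x)^-1]; the second bounds its
    commutator with the curl. *)
Definition contraction_rate :=
  (1 + sigma0 * dt)^-1 + opbound curl_operator * smax * dt ^+ 2.

Let rearrange (V : zmodType) (x p k w a : V) :
  x + p + k + w = x + (w + (a + k)) + (p - a).
Proof.
rewrite (addrC a) (addrA w) (addrA x) addrACA subrr addr0 -!addrA; congr (x + _).
by rewrite addrC -addrA addrCA.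
Qed.

Lemma one_step_contract u u' w1 w2 :
  norm2 (one_step u w1 w2 - one_step u' w1 w2) <= contraction_rate * norm2 (u - u').
Proof.
have [z zE] : {z | z = u - u'} by exists (u - u').
rewrite -zE; pose Ed := cell_diag decay; pose L := curl_operator.
set v := one_step u w1 w2 - _.
have vE : v = z *m explicit_mx w1 + v *m implicit_mx w1.
  rewrite /v {1}one_stepE {1}(one_stepE u') zE !mulmxBl opprD addrACA; congr (_ + _).
  by rewrite opprD addrACA subrr addr0.
(* The damping is the identity plus [E1], and the identity commutes with the curl, so only [E1], of
   size [smax * dt], enters the commutator. *)
pose E1 := cell_diag (fun c => decay c - 1).
have EE u0 : u0 *m Ed = u0 + u0 *m E1.
  by apply: entryP => s l c; rewrite entryD !mul_cell_diag; ring.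
(* The damping fails to commute with the curl only by [O(dt)], so that [g] is
   of order [dt ^+ 2]. *)
pose g := (dt / 2) *: (z *m L *m E1 - z *m E1 *m L).
have gE : v = z *m Ed + (v + z *m Ed) *m implicit_mx w1 + g.
  have -> : g = (dt / 2) *: (z *m L *m Ed) - (dt / 2) *: (z *m Ed *m L).
    rewrite /g -scalerBr; congr (_ *: _).
    have -> : z *m L *m E1 = z *m L *m Ed - z *m L by rewrite EE addrC addKr.
    have -> : z *m E1 = z *m Ed - z by rewrite EE addrC addKr.
    by rewrite (mulmxBl (z *m Ed)) opprB addrA subrK.
  have -> : (v + z *m Ed) *m implicit_mx w1 = v *m implicit_mx w1 +
      ((dt / 2) *: (z *m Ed *m L) + (lambda1 / 2) *: (z *m Ed *m rotation w1)).
    by rewrite mulmxDl; congr (_ + _); rewrite /implicit_mx mulmxDr -!scalemxAr.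
  rewrite [LHS]vE; have -> : z *m explicit_mx w1 = z *m Ed + (dt / 2) *: (z *m L *m Ed) +
      (lambda1 / 2) *: (z *m Ed *m rotation w1).
    by rewrite /explicit_mx !mulmxDr -!scalemxAr !mulmxA.
  exact: rearrange.
apply: le_trans (skew_bound (skew_implicit_mx w1) gE) _.
have d0 := ltW hdt.
have sm0 : 0 <= smax * dt.
  exact: le_trans (normr_ge0 _) (decay_near1 (wrap hIx 0, wrap hJy 0, wrap hKz 0)).
have L0 := opbound_ge0 L; have z0 := norm2_ge0 z.
rewrite /contraction_rate mulrDl; apply: lerD.
  apply: norm2_cell_diag_le => [|c]; last by rewrite ger0_norm ?expR_ge0//; exact: decay_le.
  by rewrite invr_ge0 addr_ge0// mulr_ge0// ltW.
rewrite /g norm2Z ger0_norm ?divr_ge0//.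
have h1 : norm2 (z *m L *m E1) <= smax * dt * (opbound L * norm2 z).
  apply: le_trans (norm2_cell_diag_le _ sm0 decay_near1) _.
  by rewrite ler_wpM2l// norm2_mulmx.
have h2 : norm2 (z *m E1 *m L) <= opbound L * (smax * dt * norm2 z).
  apply: le_trans (norm2_mulmx _ _) _.
  by rewrite ler_wpM2l// norm2_cell_diag_le.
apply: le_trans (_ : _ <= dt / 2 * (smax * dt * (opbound L * norm2 z) + opbound L * (smax * dt * norm2 z))) _.
  rewrite ler_wpM2l ?divr_ge0//; apply: le_trans (norm2D _ _) _.
  by rewrite norm2N; exact: lerD.
by rewrite le_eqVlt -/L; apply/orP; left; apply/eqP; field.
Qed.

(** From the zero state only the additive noise acts, and the skew part cannot enlarge it: a bound
    uniform in [w1], from which the moment condition follows. *)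
Lemma one_step0_le w1 w2 : norm2 (one_step 0 w1 w2) <= norm2 (forcing w2).
Proof.
have e : one_step 0 w1 w2 = 0 + (one_step 0 w1 w2 + 0) *m implicit_mx w1 + forcing w2.
  by rewrite add0r addr0 addrC {1}one_stepE mul0mx add0r.
by have := skew_bound (skew_implicit_mx w1) e; rewrite norm2_0 add0r.
Qed.

End state_space.

(** * The noise as a function of the Brownian increments *)

Section noise_representation.
Context {R : realType} {d : measure_display} {Omega : measurableType d}.
Variable P : probability Omega R.
Variables (eta : nat -> R) (q : nat -> point3 R -> R).

(* By Kolmogorov's theorem the series of the Wiener process at a point converges
   or diverges almost surely; a divergent sequence has the limit [0]. *)
Definition series_value (a z : nat -> R) : R :=
  if `[< cvgn (sumsq a) >] then limn (fun N => psum a N z) else 0.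

Lemma measurable_series_value a d' (T : measurableType d') (Z : T -> nat -> R) :
  (forall k, measurable_fun setT (fun t => Z t k)) ->
  measurable_fun setT (fun t => series_value a (Z t)).
Proof.
move=> mZ; rewrite /series_value; case: asboolP => _; last exact: measurable_cst.
by apply: (measurable_limn (h := fun N t => psum a N (Z t))) => N; exact: measurable_psum.
Qed.

Lemma limn_divergent (u : nat -> R) : ~ cvgn u -> limn u = 0.
Proof. by move/dvgP. Qed.

(** If the coefficients are square summable, both series converge almost surely and the limits
    subtract. Otherwise both diverge almost surely, and both limits are the default [0]. Time [0] is
    separate: there the partial sums vanish almost surely. *)
Lemma wiener_increment_series (beta : nat -> R -> Omega -> R) dt n p :
  0 < dt -> (forall k, \forall w \ae P, beta k 0 w = 0) ->
  (forall t, 0 < t -> iid P (fun k => increment (beta k) t 0) (normal_prob 0 (Num.sqrt t))) ->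
  \forall w \ae P, wiener_increment eta q beta dt n p w =
    series_value (fun k => sqrtQ eta q k p) (fun k => increment (beta k) dt n w).
Proof.
move=> dt0 h0 hiid; set a := fun k => sqrtQ eta q k p.
have h0' : \forall w \ae P, forall k, beta k 0 w = 0 by exact: ae_foralln.
have incE t w k : (forall k, beta k 0 w = 0) -> increment (beta k) t 0 w = beta k t w.
  by move=> h; rewrite /increment mul1r mul0r h subr0.
have psum0 w N : (forall k, beta k 0 w = 0) -> psum a N (fun k => beta k (0%:R * dt) w) = 0.
  by move=> h; rewrite /psum big1// => k _; rewrite mul0r h mulr0.
rewrite /series_value; case: asboolP => [cv|dv].
- have cvt m : \forall w \ae P, cvgn (fun N => psum a N (fun k => beta k (m%:R * dt) w)).
    case: m => [|m].
      apply: filterS h0' => w h; rewrite (_ : (fun N => _) = cst 0); first exact: is_cvg_cst.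
      by apply/funext => N; rewrite psum0.
    have t0 : 0 < m.+1%:R * dt by rewrite mulr_gt0.
    have s0 : 0 < Num.sqrt (m.+1%:R * dt) by rewrite sqrtr_gt0.
    have := psum_converges (lt0r_neq0 s0) (hiid _ t0) cv; apply: filterS2 h0' => w h.
    by under eq_fun do under eq_fun do rewrite incE//.
  apply: filterS2 (cvt n) (cvt n.+1) => w c0 c1.
  rewrite /wiener_increment /wiener -limB//; congr (limn _).
  by apply/funext => N; rewrite fctE /psum/= -sumrB; apply: eq_bigr => k _; rewrite mulrBr.
- have dvt m : \forall w \ae P, limn (fun N => psum a N (fun k => beta k (m%:R * dt) w)) = 0.
    case: m => [|m].
      apply: filterS h0' => w h; rewrite (_ : (fun N => _) = cst 0); first exact: lim_cst.
      by apply/funext => N; rewrite psum0.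
    have t0 : 0 < m.+1%:R * dt by rewrite mulr_gt0.
    have s0 : 0 < Num.sqrt (m.+1%:R * dt) by rewrite sqrtr_gt0.
    have := psum_diverges (lt0r_neq0 s0) (hiid _ t0) dv; apply: filterS2 h0' => w h.
    move=> h'; apply: limn_divergent; apply: contra_not h'.
    by under [X in _ -> cvgn X]eq_fun do under eq_fun do rewrite incE//.
  apply: filterS2 (dvt n) (dvt n.+1) => w e0 e1.
  by rewrite /wiener_increment /wiener -/a; rewrite /psum in e0 e1; rewrite e0 e1 subrr.
Qed.

(** The truncated increment is a single limit of a series in the increments, so it is already a
    function of them whether or not the series converges. *)
Definition truncated_series b dt p (z : nat -> R) : R :=
  Num.sqrt dt * limn (fun N => \sum_(k < N)
    Num.max (- trunc_level b dt) (Num.min (z k / Num.sqrt dt) (trunc_level b dt)) *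
    sqrtQ eta q k p).

Lemma measurable_truncated_series b dt p d' (T : measurableType d') (Z : T -> nat -> R) :
  (forall k, measurable_fun setT (fun t => Z t k)) ->
  measurable_fun setT (fun t => truncated_series b dt p (Z t)).
Proof.
move=> mZ; apply: measurable_funM => //.
apply: (measurable_limn (h := fun N t => \sum_(k < N)
    Num.max (- trunc_level b dt) (Num.min (Z t k / Num.sqrt dt) (trunc_level b dt)) *
    sqrtQ eta q k p)) => N.
apply: measurable_sum => k; apply: measurable_funM => //; apply: measurable_maxr => //.
by apply: measurable_minr => //; exact: measurable_funM.
Qed.

End noise_representation.

(** * The shift on iid noise sequences *)

Section head_tail.
Context {R : realType} {K : eqType} {d : measure_display} {Omega : measurableType d}.
Variables (P : probability Omega R) (X : nat * K -> Omega -> R) (nu : set R -> \bar R).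
Hypothesis hX : iid P X nu.
Notation W := (seqspace R K).
Notation S := (seqspace R (nat * K)%type).

Definition seq_head (s : S) : W := fun k => (s : nat * K -> R) (0%N, k).
Definition seq_tail (s : S) : S := fun nk => (s : nat * K -> R) (nk.1.+1, nk.2).

Lemma measurable_seq_head : measurable_fun setT seq_head.
Proof. by apply: measurable_seq_map => k; exact: measurable_seq_coord. Qed.

Lemma measurable_seq_tail : measurable_fun setT seq_tail.
Proof. by apply: measurable_seq_map => nk; exact: measurable_seq_coord. Qed.

Lemma head_iter_tail n (s : S) k : (seq_head (iter n seq_tail s) : K -> R) k = (s : nat * K -> R) (n, k).
Proof.
rewrite /seq_head; suff -> m : (iter n seq_tail s : nat * K -> R) (m, k) = (s : nat * K -> R) ((n + m)%N, k).
  by rewrite addn0.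
by elim: n m => [//|n ih] m; rewrite iterS /seq_tail/= ih addnS.
Qed.

Lemma measurable_sample : measurable_fun setT ((fun w i => X i w) : Omega -> S).
Proof. by apply: measurable_seq_map => i; exact: hX.1. Qed.

Definition sample_law : probability S R := law P measurable_sample.

Lemma measurable_sample_head : measurable_fun setT ((fun w k => X (0%N, k) w) : Omega -> W).
Proof. by apply: measurable_seq_map => i; exact: hX.1. Qed.

Definition head_law : probability W R := law P measurable_sample_head.

(** Time [0] is read on one copy of the sample space and all later times, with their own indices
    lowered by one, on an independent copy; this is the shift property that the random iteration
    requires. *)
Lemma integral_head_tail (g : W * S -> \bar R) : measurable_fun [set: W * S] g ->
  (forall x, 0 <= g x)%E ->
  (\int[sample_law]_s g (seq_head s, seq_tail s) = \int[head_law \x sample_law]_x g x)%E.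
Proof.
move=> mg g0.
pose h (i : nat * K) : (nat * K) + (nat * K) :=
  if i.1 is n.+1 then inr (n, i.2) else inl (0%N, i.2).
have hI : injective h by move=> [[|n] k] [[|n'] k']//= [] => [->|-> ->].
have mG : measurable_fun [set: S] (fun s => g (seq_head s, seq_tail s)).
  by apply: (measurableT_comp mg); apply: measurable_fun_pair;
    [exact: measurable_seq_head|exact: measurable_seq_tail].
rewrite (ge0_integral_law P measurable_sample mG)//.
rewrite (iid_split hI hX mG)//.
have mg' : measurable_fun setT (fun w : Omega * Omega =>
    g ((fun k => X (0%N, k) w.1) : W, (fun i => X i w.2) : S)).
  apply: (measurableT_comp mg); apply: measurable_fun_pair.
    by apply: (measurableT_comp measurable_sample_head); exact: measurable_fst.
  by apply: (measurableT_comp measurable_sample); exact: measurable_snd.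
transitivity (\int[P \x P]_w g ((fun k => X (0%N, k) w.1) : W, (fun i => X i w.2) : S))%E.
  apply: eq_integral => w _; congr g; congr pair.
  by apply/funext => -[n k].
rewrite !fubini_tonelli1// /fubini_F/=.
rewrite (ge0_integral_law P measurable_sample_head); last 2 first.
- exact: (measurable_fun_fubini_tonelli_F (m2 := sample_law) g mg g0).
- by move=> w; apply: integral_ge0 => s _.
apply: eq_integral => w _; rewrite (ge0_integral_law P measurable_sample)//.
exact: (measurable_section ((fun k => X (0%N, k) w) : W) mg).
Qed.

End head_tail.

(** * Bounds of [sigma] at the nodes *)

Section domain.
Context {R : realType}.
Implicit Types (lo hi p : point3 R).

(** Nodes with a zero index lie on the boundary, where the lower bound of [sigma] is known only
    through continuity on the closure. The points [g t] on the segment from [p] to the midpoint of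
    the cuboid approach [p] from inside. *)
Lemma closure_cuboid lo hi p :
  [/\ lo.1.1 < hi.1.1, lo.1.2 < hi.1.2 & lo.2 < hi.2] ->
  [/\ lo.1.1 <= p.1.1 < hi.1.1, lo.1.2 <= p.1.2 < hi.1.2 & lo.2 <= p.2 < hi.2] ->
  closure (cuboid lo hi) p.
Proof.
move=> [h1 h2 h3] [/andP[a1 b1] /andP[a2 b2] /andP[a3 b3]] B nB.
pose g (t : R) : point3 R := (p.1.1 + t * ((lo.1.1 + hi.1.1) / 2 - p.1.1),
  p.1.2 + t * ((lo.1.2 + hi.1.2) / 2 - p.1.2), p.2 + t * ((lo.2 + hi.2) / 2 - p.2)).
have cg : g t @[t --> (0 : R)] --> p.
  have cc (u v : R) : u + t * v @[t --> (0 : R)] --> u.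
    rewrite -[X in _ --> X]addr0; apply: cvgD; first exact: cvg_cst.
    have : (fun t : R => t * v) @ (0 : R) --> 0 * v by apply: cvgM; [exact: cvg_id|exact: cvg_cst].
    by rewrite mul0r.
  have -> : p = (p.1.1, p.1.2, p.2) by case: p {a1 b1 a2 b2 a3 b3 nB g} => [[]].
  exact: (cvg_pair (cvg_pair (cc _ _) (cc _ _)) (cc _ _)).
have /nbhs_ballP[e /= e0 he] := cg B nB.
pose t := Num.min (e / 2) (1 / 2).
have t0 : 0 < t by rewrite lt_min !divr_gt0.
have t1 : t <= 1 / 2 by rewrite ge_min lexx orbT.
exists (g t); split; last first.
  apply: he; rewrite /ball/= sub0r normrN ger0_norm ?(ltW t0)//.
  by apply: (@le_lt_trans _ _ (e / 2)); [rewrite ge_min lexx|rewrite ltr_pdivrMr// ltr_pMr// ltr1n].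
have key (x u v : R) : u < v -> u <= x < v -> u < x + t * ((u + v) / 2 - x) < v.
  move=> uv /andP[ux xv]; have := mulr_ge0 (ltW t0) (_ : 0 <= x - u).
  rewrite subr_ge0 => /(_ ux) k1.
  have k2 : 0 < (1 - t) * (v - x) by rewrite mulr_gt0 ?subr_gt0//; lra.
  have k3 : 0 < t * (v - u) by rewrite mulr_gt0 ?subr_gt0.
  have k4 : 0 <= (1 - t) * (x - u) by rewrite mulr_ge0 ?subr_ge0//; lra.
  by apply/andP; split; lra.
by split; apply: key => //; apply/andP.
Qed.

Lemma ge_closure (D : set (point3 R)) (f : point3 R -> R) m p :
  {within closure D, continuous f} -> (forall x, D x -> m <= f x) -> closure D p -> m <= f p.
Proof.
move=> cf mf Dp; rewrite leNgt; apply/negP => fp.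
have nb : within (closure D) (nbhs p) [set x | f x < m].
  by rewrite nbhs_subspace_in//; exact: (cvgr_lt _ (cf p)).
have [x [Dx hx]] := Dp _ nb.
by have := hx (subset_closure Dx); rewrite /= ltNge mf.
Qed.

Lemma closure_node lo hi Ix Jy Kz i j k :
  [/\ lo.1.1 < hi.1.1, lo.1.2 < hi.1.2 & lo.2 < hi.2] ->
  (i < Ix)%N -> (j < Jy)%N -> (k < Kz)%N ->
  closure (cuboid lo hi) (node lo hi Ix Jy Kz i j k).
Proof.
move=> hl hi' hj hk; apply: closure_cuboid => //.
have key (u v : R) n m : u < v -> (n < m)%N -> u <= u + n%:R * ((v - u) / m%:R) < v.
  move=> uv nm; have m0 : 0 < m%:R :> R by rewrite ltr0n; exact: leq_ltn_trans nm.
  rewrite lerDl mulr_ge0 ?divr_ge0 ?subr_ge0 ?(ltW uv)//=.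
  rewrite -ltrBrDl mulrA ltr_pdivrMr// mulrC ltr_pM2l ?subr_gt0//.
  by rewrite ltr_nat.
by case: hl => *; split; apply: key.
Qed.

End domain.

(** * Long-time behaviour *)

Section long_time_behaviour.
Context {R : realType} {N : nat}.
Context {dO dW dS : measure_display} {Omega : measurableType dO}.
Context {W : measurableType dW} {S : measurableType dS}.
Variables (P : probability Omega R) (mu : probability W R) (PP : probability S R).
Variables (z0 : S -> W) (th : S -> S).
Hypotheses (mz0 : measurable_fun setT z0) (mth : measurable_fun setT th).
Hypothesis shiftE : forall g : W * S -> \bar R, measurable_fun [set: W * S] g ->
  (forall x, 0 <= g x)%E ->
  (\int[PP]_s g (z0 s, th s) = \int[mu \x PP]_x g x)%E.
Variable F : 'rV[R]_N -> W -> 'rV[R]_N.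
Hypothesis mF : measurable_fun [set: borel_space R N * W]
  (fun p : borel_space R N * W => F p.1 p.2 : borel_space R N).
Variables r dt : R.
Hypotheses (r0 : 0 < r) (r1 : r < 1) (dt0 : 0 < dt).
Hypothesis contractF : forall w x y, norm2 (F x w - F y w) <= r * norm2 (x - y).
Hypothesis momentF : (\int[mu]_w (norm2 (F 0 w))%:E < +oo)%E.
Variable U : 'rV[R]_N -> nat -> Omega -> 'rV[R]_N.
Hypothesis UE : forall n x (f : borel_space R N -> \bar R),
  measurable_fun [set: borel_space R N] f -> (forall y, 0 <= f y)%E ->
  (\int[P]_w f (U x n w) = \int[PP]_s f (iterates z0 th F n x s))%E.

Lemma random_iteration_long_time : exists pi : probability (borel_space R N) R,
  [/\ unique_invariant P U pi, ergodic P U pi & exponentially_mixing P U dt pi].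
Proof.
pose pi := stationary_law PP mz0 mth mF.
have mPhi n := measurable_iterates mz0 mth mF n.
have contractPhi n x y s := iterates_contract z0 th r0 contractF n x y s.
have statPhi n (f : borel_space R N -> \bar R) mf f0 :=
  stationary_law_iterates mz0 mth shiftE mF r0 r1 contractF momentF n (f := f) mf f0.
have momentPhi := moment_stationary_law mz0 mth shiftE mF r0 r1 contractF momentF.
exists pi; split.
- split; first exact: (contractive_invariant mPhi UE statPhi).
  exact: (contractive_unique mPhi r0 r1 contractPhi UE statPhi momentPhi).
- exact: (contractive_ergodic mPhi r0 r1 contractPhi UE statPhi momentPhi).
- exact: (contractive_mixing mPhi r0 r1 contractPhi UE statPhi momentPhi dt0).
Qed.

End long_time_behaviour.

(** Multiplied by [1 + sigma0 * dt], the claim reads [C * dt ^+ 2 * (1 + sigma0 * dt) < sigma0 *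
    dt]. The first bound on [dt] makes the bracket less than 2, the second gives
    [2 * C * dt < sigma0]; [C + 1] keeps the denominator positive. *)
Lemma contraction_rate_lt1 (R : realFieldType) (sigma0 C dt : R) :
  0 < sigma0 -> 0 <= C -> 0 < dt -> dt < Num.min sigma0^-1 (sigma0 / (2 * (C + 1))) ->
  (1 + sigma0 * dt)^-1 + C * dt ^+ 2 < 1.
Proof.
move=> s0 C0 d0; rewrite lt_min => /andP[h1 h2].
have x1 : sigma0 * dt < 1 by rewrite mulrC -ltr_pdivlMr// mul1r.
have C1 : 0 < 2 * (C + 1) by rewrite mulr_gt0// ltr_wpDl.
have x2 : dt * (2 * (C + 1)) < sigma0 by rewrite -ltr_pdivlMr.
have D0 : 0 < 1 + sigma0 * dt by rewrite addr_gt0// mulr_gt0.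
rewrite -(ltr_pM2r D0) mulrDl mulVf ?gt_eqF// mul1r ltrD2l expr2 mulrA -mulrA mulrCA mulrA.
have h : C * dt * (1 + sigma0 * dt) <= C * dt * 2.
  by rewrite ler_wpM2l ?mulr_ge0 ?(ltW d0)//; lra.
have -> : dt * C * dt * (1 + sigma0 * dt) = dt * (C * dt * (1 + sigma0 * dt)) by ring.
by rewrite [ltRHS]mulrC ltr_pM2l//; apply: le_lt_trans h _; lra.
Qed.

Local Notation borel_state R Ix Jy Kz := (borel_space R #|{: state_index Ix Jy Kz}|).

Theorem theorem4p9 (R : realType)
  (* domain and coefficients *)
  (lo hi : R * R * R)
  (hlohi : [/\ lo.1.1 < hi.1.1, lo.1.2 < hi.1.2 & lo.2 < hi.2])
  (sigma : R * R * R -> R) (sigma0 : R)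
  (hsigma : W1infty (cuboid lo hi) sigma)
  (hsigma0 : 0 < sigma0)
  (hsigma_ge : forall p, cuboid lo hi p -> sigma0 <= sigma p)
  (lambda1 : R) (lambda2 : 'rV[R]_3)
  (* filtered probability space and initial fields *)
  (d : measure_display) (Omega : measurableType d) (P : probability Omega R)
  (F : R -> set (set Omega)) (hF : filtration F)
  (E0 H0 : Omega -> R * R * R -> 'rV[R]_3)
  (hE0 : L2_random_field P (cuboid lo hi) E0)
  (hH0 : L2_random_field P (cuboid lo hi) H0)
  (* noise *)
  (q : nat -> R * R * R -> R)
  (hq : orthonormal_basis (cuboid lo hi) q)
  (hqC1 : forall m, C1_on (cuboid lo hi) (q m))
  (eta1 eta2 : nat -> R)
  (heta1 : forall k, 0 <= eta1 k) (heta2 : forall k, 0 <= eta2 k)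
  (gamma gamma1 gamma2 : R) (hgamma : 3 / 2 < gamma)
  (hgamma1 : gamma <= gamma1) (hgamma2 : 1 + gamma <= gamma2)
  (hQ1 : sqrtQ_HS (cuboid lo hi) gamma1 eta1 q)
  (hQ2 : sqrtQ_HS (cuboid lo hi) gamma2 eta2 q)
  (beta1 beta2 : nat -> R -> Omega -> R)
  (hbeta1 : forall k, brownian_motion P F (beta1 k))
  (hbeta2 : forall k, brownian_motion P F (beta2 k))
  (hindep : independent_processes P
    (fun ik : bool * nat => if ik.1 then beta1 ik.2 else beta2 ik.2))
  (b : R) (hb : 4 <= b)
  (* mesh *)
  (Ix Jy Kz : nat) (hIx : (0 < Ix)%N) (hJy : (0 < Jy)%N) (hKz : (0 < Kz)%N) :
  exists dt0 : R, 0 < dt0 /\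
  forall dt : R, 0 < dt -> dt < dt0 ->
  (* E x, H x : the numerical solution started from U^0 = x *)
  forall E H : state R Ix Jy Kz -> nat -> Omega ->
               nat -> nat -> nat -> 'rV[R]_3,
  (forall x,
     numerical_solution lo hi Ix Jy Kz P sigma lambda1 lambda2 dt
       (truncated_increment eta1 q beta1 b dt)
       (wiener_increment eta2 q beta2 dt) (E x) (H x) /\
     forall w, cell_vector Ix Jy Kz (E x 0%N w) (H x 0%N w) = x) ->
  let U := fun x n w => cell_vector Ix Jy Kz (E x n w) (H x n w) in
  exists pi : probability
      (borel_space R #|{: state_index Ix Jy Kz}|) R,
    [/\ unique_invariant P U pi, ergodic P U pi &
        exponentially_mixing P U dt pi].
Proof.
pose cell := ('I_Ix * 'I_Jy * 'I_Kz)%type.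
pose St := state R Ix Jy Kz.
pose beta (ik : bool * nat) := if ik.1 then beta1 ik.2 else beta2 ik.2.
have hbeta ik : brownian_motion P F (beta ik) by rewrite /beta; case: ifP.
have sigma_node (c : cell) : sigma0 <= sigma (cell_node lo hi c).
  case: hsigma => _ _ cs; apply: (ge_closure cs hsigma_ge).
  exact: closure_node.
(* A sum of positive values bounds each of them. *)
pose smax := \sum_(c : cell) sigma (cell_node lo hi c).
have smax_ge (c : cell) : sigma (cell_node lo hi c) <= smax.
  rewrite /smax (bigD1 c)//= lerDl sumr_ge0// => c' _.
  exact: le_trans (ltW hsigma0) (sigma_node c').
have smax0 : 0 <= smax.
  by apply: sumr_ge0 => c _; exact: le_trans (ltW hsigma0) (sigma_node c).
pose C := opbound (curl_operator lo hi hIx hJy hKz) * smax.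
have C0 : 0 <= C by rewrite mulr_ge0// opbound_ge0.
exists (Num.min sigma0^-1 (sigma0 / (2 * (C + 1)))); split.
  by rewrite lt_min invr_gt0 hsigma0 divr_gt0// mulr_gt0// ltr_wpDl.
move=> dt dt0 dtlt E H hEH U.
(* A sample point is needed to evaluate the solutions when [centre_mx] is inverted. *)
have [w0 _] : exists w : Omega, True.
  apply: contrapT => /forallNP h; have := probability_setT P.
  rewrite (_ : [set: Omega] = set0); last by apply/seteqP; split => // w; have := h w.
  by rewrite measure0 => /eqP; rewrite eqe eq_sym oner_eq0.
have pE x n w : Defs.periodic Ix Jy Kz (E x n w) by have [[h _ _] _] := hEH x; exact: (h n w).1.
have pH x n w : Defs.periodic Ix Jy Kz (H x n w) by have [[h _ _] _] := hEH x; exact: (h n w).2.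
(* Every state is a vector of centre averages: this excludes even mesh sizes. *)
have hC : (centre_mx hIx hJy hKz : 'M[R]_#|{: state_index Ix Jy Kz}|) \in unitmx.
  rewrite -row_full_unit; apply/row_fullP.
  exists (\matrix_(a < #|{: state_index Ix Jy Kz}|)
    nodal Ix Jy Kz (E (delta_mx 0 a) 0%N w0) (H (delta_mx 0 a) 0%N w0)).
  apply/row_matrixP => a; rewrite row_mul rowK row1 mul_centre_mx !field_nodal//.
  by have [_ ->] := hEH (delta_mx 0 a).
(* Both noises form one iid family, indexed by time and by a tagged motion: [true] marks [beta1],
   [false] marks [beta2]. *)
pose X (i : nat * (bool * nat)) := increment (beta i.2) dt i.1.
have hX : iid P X (normal_prob 0 (Num.sqrt dt)) := brownian_increments_iid hF hbeta hindep dt0.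
pose ctr (c : cell) := cell_centre lo hi Ix Jy Kz c.1.1 c.1.2 c.2.
pose noise1 (z : bool * nat -> R) (c : cell) :=
  truncated_series eta1 q b dt (ctr c) (fun k => z (true, k)).
pose noise2 (z : bool * nat -> R) (c : cell) :=
  series_value (fun k => sqrtQ eta2 q k (ctr c)) (fun k => z (false, k)).
pose G (u : St) (z : seqspace R (bool * nat)%type) : St :=
  one_step lo hi hIx hJy hKz sigma lambda1 lambda2 dt u (noise1 z) (noise2 z).
have mcoord d' (T : measurableType d') (f : T -> seqspace R (bool * nat)%type) ik :
    measurable_fun setT f -> measurable_fun setT (fun t => (f t : bool * nat -> R) ik).
  by move=> mf; exact: (measurableT_comp (measurable_seq_coord ik) mf).
have mG : measurable_fun [set: borel_state R Ix Jy Kz * seqspace R (bool * nat)%type]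
    (fun p => G p.1 p.2 : borel_state R Ix Jy Kz).
  apply: measurable_borel_coord => a.
  apply: (measurable_one_step lo hi sigma lambda1 lambda2 dt hC
    (x := fun p : borel_state R Ix Jy Kz * seqspace R (bool * nat)%type => p.1)
    (w1 := fun p => noise1 p.2) (w2 := fun p => noise2 p.2)).
  - move=> i j; rewrite ord1; apply: (measurableT_comp (measurable_coord j)).
    exact: measurable_fst.
  - move=> c; apply: measurable_truncated_series => k; apply: mcoord; exact: measurable_snd.
  - move=> c; apply: measurable_series_value => k; apply: mcoord; exact: measurable_snd.
pose r := contraction_rate lo hi hIx hJy hKz dt sigma0 smax.
have r1 : r < 1 by exact: contraction_rate_lt1.
have r0 : 0 < r.
  rewrite /r /contraction_rate ltr_pwDl//.
    by rewrite invr_gt0 addr_gt0// mulr_gt0.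
  by apply: mulr_ge0; [exact: C0|exact: sqr_ge0].
have sigma_bounds (c : cell) : sigma0 <= sigma (cell_node lo hi c) <= smax.
  by rewrite sigma_node smax_ge.
have contractG z u v : norm2 (G u z - G v z) <= r * norm2 (u - v).
  exact: one_step_contract.
have noise2_moment c : (\int[head_law hX]_z (`|noise2 z c|)%:E < +oo)%E.
  have m2 : measurable_fun setT (fun z : seqspace R (bool * nat)%type => (`|noise2 z c|)%:E).
    apply/measurable_EFinP; apply: measurableT_comp => //.
    by apply: measurable_series_value => k; exact: measurable_seq_coord.
  rewrite (ge0_integral_law P (measurable_sample_head hX) m2); last by move=> z; rewrite lee_fin.
  rewrite /noise2 /series_value; case: asboolP => cv; last first.
    by under eq_integral do rewrite normr0; rewrite integral0.
  have hX0 : iid P (fun k => X (0%N, (false, k))) (normal_prob 0 (Num.sqrt dt)).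
    by apply: (iid_comp (f := fun k => (0%N, (false, k))) _ hX) => k k' [].
  have sd0 : Num.sqrt dt != 0 by rewrite lt0r_neq0// sqrtr_gt0.
  exact: (first_moment_limn_psum sd0 hX0 cv).
(* By [one_step0_le] the state reached from [0] is bounded by the forcing, a finite combination of
   the values [noise2 z c]. *)
have momentG : (\int[head_law hX]_z (norm2 (G 0%R z))%:E < +oo)%E.
  have forcingE z a : forcing lambda2 (noise2 z) 0 a =
      noise2 z (enum_val a).2 * lambda2 0 (enum_val a).1.2 by exact: state_ofE.
  have mf a : measurable_fun setT (fun z : seqspace R (bool * nat)%type =>
      (`|forcing lambda2 (noise2 z) 0 a|)%:E).
    apply/measurable_EFinP; apply: measurableT_comp => //.
    rewrite (_ : (fun z => _) = fun z : seqspace R (bool * nat)%type =>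
      noise2 z (enum_val a).2 * lambda2 0 (enum_val a).1.2); last exact/funext/(forcingE^~ a).
    apply: measurable_funM => //.
    by apply: measurable_series_value => k; exact: measurable_seq_coord.
  apply: (@le_lt_trans _ _ (\int[head_law hX]_z \sum_a (`|forcing lambda2 (noise2 z) 0 a|)%:E)%E).
    apply: ge0_le_integral => //.
    - by move=> z _; rewrite lee_fin norm2_ge0.
    - apply/measurable_EFinP; apply: (measurableT_comp measurable_norm2).
      exact: (measurable_section (0%R : borel_state R Ix Jy Kz) mG).
    - by apply: emeasurable_sum => a.
    move=> z _; rewrite sumEFin lee_fin.
    exact: le_trans (one_step0_le lo hi sigma lambda1 lambda2 dt hC _ _) (norm2_le_sum _).
  rewrite ge0_integral_sum//; apply: lte_sum_pinfty => a _.
  under eq_integral do rewrite forcingE normrM mulrC EFinM.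
  rewrite ge0_integralZl//; last first.
    apply/measurable_EFinP; apply: measurableT_comp => //.
    by apply: measurable_series_value => k; exact: measurable_seq_coord.
  by apply: lte_mul_pinfty => //; rewrite ?lee_fin.
have beta2_0 k : \forall w \ae P, beta2 k 0 w = 0 by have [] := hbeta2 k.
have beta2_iid t : 0 < t ->
    iid P (fun k => increment (beta2 k) t 0) (normal_prob 0 (Num.sqrt t)).
  move=> t0; have hY := brownian_increments_iid hF hbeta hindep t0.
  by apply: (iid_comp (f := fun k => (0%N, (false, k))) _ hY) => k k' [].
(* Each identity holds off a null set; there are countably many cells and times, so [UE] can combine
   them into one null set for all [n]. *)
have step x n : \forall w \ae P, U x n.+1 w = G (U x n w) (fun ik => X (n, ik) w).
  have w2E : \forall w \ae P, forall i j k,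
      wiener_increment eta2 q beta2 dt n (cell_centre lo hi Ix Jy Kz i j k) w =
      series_value (fun m => sqrtQ eta2 q m (cell_centre lo hi Ix Jy Kz i j k))
        (fun m => increment (beta2 m) dt n w).
    apply: ae_foralln => i; apply: ae_foralln => j; apply: ae_foralln => k.
    exact: wiener_increment_series dt0 beta2_0 beta2_iid.
  have [[_ _ sch] _] := hEH x; apply: filterS2 w2E (sch n) => w w2E hs.
  apply: scheme_step_one_step => // [|c]; first by rewrite gt_eqF.
  have := hs c.1.1 c.1.2 c.2 (ltn_ord _) (ltn_ord _) (ltn_ord _).
  by rewrite w2E.
have UE n x (f : borel_state R Ix Jy Kz -> \bar R) :
    measurable_fun [set: borel_state R Ix Jy Kz] f -> (forall y, 0 <= f y)%E ->
    (\int[P]_w f (U x n w) =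
     \int[sample_law hX]_s f (iterates (@seq_head R _) (@seq_tail R _) G n x s))%E.
  move=> mf f0.
  have mU : measurable_fun [set: Omega] (fun w => U x n w : borel_state R Ix Jy Kz).
    apply: measurable_borel_coord => a.
    have [[_ mEH _] _] := hEH x.
    under eq_fun do rewrite /U mxE.
    case: (enum_val a) => [[s l] [[i j] k]].
    have mE i' j' k' : measurable_fun setT (fun w => (if s then H x n w else E x n w) i' j' k' 0 l).
      by case: s; have [] := mEH n i' j' k' l.
    under eq_fun do rewrite /centre /avg_x /avg_y /avg_z !mxE.
    by repeat first [exact: mE | apply: measurable_funD | apply: measurable_funM => //].
  have ae_iter : \forall w \ae P, U x n w = iterates (@seq_head R _) (@seq_tail R _) G n x (X^~ w).
    have := ae_foralln (step x); apply: filterS => w hw.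
    elim: n {mU} => [|n ih]; first by have [_ h] := hEH x; exact: h.
    rewrite hw ih iteratesSr; congr (G _ _).
    by apply/funext => ik; rewrite head_iter_tail.
  have mI : measurable_fun [set: seqspace R (nat * (bool * nat))%type]
      (fun s => iterates (@seq_head R _) (@seq_tail R _) G n x s : borel_state R Ix Jy Kz).
    have := measurable_iterates (measurable_seq_head (K := (bool * nat)%type))
      (measurable_seq_tail (K := (bool * nat)%type)) mG n.
    by move=> h; exact: (measurable_section (x : borel_state R Ix Jy Kz) h).
  rewrite (ge0_integral_law P (measurable_sample hX) (measurableT_comp mf mI)); last first.
    by move=> s; exact: f0.
  apply: ge0_ae_eq_integral => //.
  - exact: (measurableT_comp mf mU).
  - exact: (measurableT_comp (measurableT_comp mf mI) (measurable_sample hX)).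
  - by move=> w _; exact: f0.
  - by apply: filterS ae_iter => w hw _; rewrite /= hw.
exact: (random_iteration_long_time (measurable_seq_head (K := (bool * nat)%type))
  (measurable_seq_tail (K := (bool * nat)%type)) (integral_head_tail hX) mG r0 r1 dt0 contractG momentG UE).
Qed.
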